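(* The colength of the Wedderburn embedding $$T\wr G\;\overset{\omega}{\hookrightarrow}\;\prod_{i\in[1,k]}\operatorname{End}_{S_i}V_i ,$$ i.e. the length of its cokernel as an $S$-module, is given by $$\frac12\left(g\,(\delta_{T/S}+v(n)h)-\sum_{i\in[1,k]}x_i^2\Big(\delta_{S_i/S}+v(x_id_i/h)\,r_i\Big)\right).$$
   Context: A finite group $G$ acts (from the right, $y\mapsto y^\sigma$, by field automorphisms, not necessarily faithfully) on a field $L$ with fixed field $K$. Let $N$ be the kernel of this operation, $H=\operatorname{Gal}(L/K)$ its image in $\operatorname{Aut}L$, $g=|G|$, $h=|H|=[L:K]$, $n=|N|$, so $g=hn$. Assume that $n$ is invertible in $K$. The twisted group ring $L\wr G$ is the $K$-algebra which as a right $L$-vector space has basis $G$, with multiplication determined by $(\sigma y)(\tau z)=(\sigma\tau)(y^\tau z)$ for $\sigma,\tau\in G$, $y,z\in L$. It is semisimple. Let $X_1,\dots,X_k$ be representatives of the isomorphism classes of simple right $L\wr G$-modules, with $X_1=L$ on which $L\wr G$ acts by $y\cdot(\sigma z)=y^\sigma z$. Let $K_i=\operatorname{End}_{L\wr G}X_i$ (a skew field, acting on $X_i$ from the left), $x_i$ the left $K_i$-dimension of $X_i$, $r_i=[K_i:K]$, $d_i^2=[K_i:Z(K_i)]$ with $d_i\ge 1$. It is known that $x_id_i/h$ is an integer, nonzero in $K$. Let $\operatorname{tr}_{K_i/K}=\operatorname{Tr}_{Z(K_i)/K}\circ\operatorname{tr}_{K_i/Z(K_i)}$, where $\operatorname{tr}_{K_i/Z(K_i)}$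 is the reduced trace. The Wedderburn isomorphism $\omega:L\wr G\to\prod_i\operatorname{End}_{K_i}X_i$ sends an element to the tuple of its operations on the $X_i$. Let $S\subset K$ be a discrete valuation ring with field of fractions $K$, maximal ideal generated by $\pi$, and $\pi$-adic valuation $v$ on $K$. Let $T$ be the integral closure of $S$ in $L$. The subring $T\wr G\subset L\wr G$ consists of the elements with coefficients in $T$. For each $i$ choose a finitely generated $T\wr G$-module $V_i\subset X_i$ such that $KV_i=X_i$ and such that $S_i:=\operatorname{End}_{T\wr G}V_i$ is a maximal order in $K_i$, with $V_1=T$; such a choice is always possible, and then $V_i$ is free over $S_i$ of rank $x_i$. The map $\omega$ restricts to an embedding of $T\wr G$ into $\prod_i\operatorname{End}_{S_i}V_i$. For an inclusion of $S$-modules with finitely generated torsion quotient, the colength is the (Jordan–Hölder) length of the quotient as an $S$-module. Let $S_i^+=\{y\in K_i\mid\operatorname{tr}_{K_i/K}(yS_i)\subset S\}$ and let $\delta_{S_i/S}$ be the colength of $S_i$ in $S_i^+$. Let $T^+=\{y\in L\mid\operatorname{Tr}_{L/K}(yT)\subset S\}$ and let $\delta_{T/S}$ be the colength of $T$ in $T^+$. *)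

(* Defs.v *)
From HB Require Import structures.
From mathcomp Require Import all_boot all_order all_algebra all_fingroup all_field.
From mathcomp Require Import boolp classical_sets.

Set Implicit Arguments.
Unset Strict Implicit.
Unset Printing Implicit Defensive.

Import Order.TTheory GRing.Theory Num.Theory.

Local Open Scope classical_set_scope.
Local Open Scope ring_scope.

(* A right action y |-> to y s of the finite group gT on L by field            *)
(* automorphisms, not necessarily faithful, with fixed field K.                *)
Record galAction (K : fieldType) (L : fieldExtType K) (gT : finGroupType) :=
  GalAction {
    gact :> {action gT &-> L};
    gactB : forall s, zmod_morphism (gact^~ s);
    gactM : forall s, monoid_morphism (gact^~ s);
    gact_fixed : forall y, (forall s, gact y s = y) <-> y \in 1%VS }.

(* The twisted group ring; the element \sum_s s * y_s is encoded by its         *)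
(* coefficient function y. The action only serves to index the ring structure. *)
Definition twisted (K : fieldType) (L : fieldExtType K) (gT : finGroupType)
  (to : galAction L gT) := {ffun gT -> L}.

Section TwistedGroupRing.

Variables (K : fieldType) (L : fieldExtType K) (gT : finGroupType).
Variable to : galAction L gT.

Lemma gact_mulg y s t : to y (s * t)%g = to (to y s) t.
Proof. by case: (gact to) => f [_ fM] /=; rewrite fM ?inE. Qed.

Lemma gact_id y : to y 1%g = y.
Proof.
have := gact_mulg y 1%g 1%g; rewrite mulg1.
by case: (gact to) => f [f_inj _] /=; move/f_inj.
Qed.

Lemma gact_scale s c y : to (c *: y) s = c *: to y s.
Proof.
have [_ toM] := gactM to s.
have tocA : to c%:A s = c%:A.
  move: s {toM}; apply/(gact_fixed to c%:A); exact: memvZ (memv_line _).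
by rewrite -mulr_algl toM tocA mulr_algl.
Qed.

Lemma gact0 s : to 0 s = 0.
Proof. by have := gactB to s 0 0; rewrite !subrr. Qed.

Lemma gactD s y z : to (y + z) s = to y s + to z s.
Proof.
have toN u : to (- u) s = - to u s.
  by have := gactB to s 0 u; rewrite !sub0r gact0 sub0r.
by have := gactB to s y (- z); rewrite opprK toN opprK.
Qed.

Lemma gact_sum s (I : finType) (F : I -> L) :
  to (\sum_i F i) s = \sum_i to (F i) s.
Proof. exact: (big_morph _ (gactD s) (gact0 s)). Qed.

Definition kernel : {set gT} := [set s | `[< forall y, to y s = y >]]%SET.

Local Notation twisted := (twisted to).

HB.instance Definition _ := Vector.on twisted.

Definition tw (s : gT) (y : L) : twisted := [ffun r => if r == s then y else 0].

Definition twisted_mul (a b : twisted) : twisted :=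
  [ffun r => \sum_t to (a (r * t^-1)%g) t * b t].

Lemma twisted_mulA : associative twisted_mul.
Proof.
move=> a b c; apply/ffunP=> r; rewrite !ffunE.
under [RHS]eq_bigr => t _ do rewrite ffunE gact_sum mulr_suml.
rewrite exchange_big /=.
under [LHS]eq_bigr => t _ do rewrite ffunE mulr_sumr.
rewrite [LHS]exchange_big [RHS]exchange_big /=; apply: eq_bigr => u _.
rewrite (reindex_inj (mulIg u)) /=; apply: eq_bigr => t _.
have [_ toM] := gactM to u.
by rewrite toM mulgK invMg mulgA -gact_mulg mulrA.
Qed.

Lemma twisted_mul1l : left_id (tw 1%g 1) twisted_mul.
Proof.
move=> a; apply/ffunP=> r; rewrite ffunE (bigD1 r) //= big1 => [|t neq_tr].
  by rewrite ffunE mulgV eqxx addr0 (gactM to r).1 mul1r.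
rewrite ffunE ifN ?gact0 ?mul0r //.
by apply: contra neq_tr => /eqP e; rewrite -(mulgKV t r) e mul1g.
Qed.

Lemma twisted_mul1r : right_id (tw 1%g 1) twisted_mul.
Proof.
move=> a; apply/ffunP=> r; rewrite ffunE (bigD1 1%g) //= big1 => [|t neq_t1].
  by rewrite ffunE eqxx invg1 mulg1 gact_id mulr1 addr0.
by rewrite ffunE ifN // mulr0.
Qed.

Lemma twisted_mulDl : left_distributive twisted_mul +%R.
Proof.
move=> a b c; apply/ffunP=> r; rewrite !ffunE -big_split; apply: eq_bigr => t _.
by rewrite ffunE gactD mulrDl.
Qed.

Lemma twisted_mulDr : right_distributive twisted_mul +%R.
Proof.
move=> a b c; apply/ffunP=> r; rewrite !ffunE -big_split; apply: eq_bigr => t _.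
by rewrite ffunE mulrDr.
Qed.

Lemma twisted1_neq0 : tw 1%g 1 != 0 :> twisted.
Proof.
by apply/eqP=> /ffunP/(_ 1%g)/eqP; rewrite !ffunE eqxx oner_eq0.
Qed.

HB.instance Definition _ := GRing.Zmodule_isNzRing.Build twisted
  twisted_mulA twisted_mul1l twisted_mul1r twisted_mulDl twisted_mulDr
  twisted1_neq0.

Lemma twisted_scaleAl (c : K) (a b : twisted) : c *: (a * b) = (c *: a) * b.
Proof.
apply/ffunP=> r; rewrite !ffunE scaler_sumr; apply: eq_bigr => t _.
by rewrite ffunE gact_scale scalerAl.
Qed.

HB.instance Definition _ := GRing.Lmodule_isLalgebra.Build K twisted
  twisted_scaleAl.

Lemma twisted_scaleAr (c : K) (a b : twisted) : c *: (a * b) = a * (c *: b).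
Proof.
apply/ffunP=> r; rewrite !ffunE scaler_sumr; apply: eq_bigr => t _.
by rewrite ffunE scalerAr.
Qed.

HB.instance Definition _ := GRing.Lalgebra_isAlgebra.Build K twisted
  twisted_scaleAr.

Lemma tw_mul s t y z : tw s y * tw t z = tw (s * t)%g (to y t * z).
Proof.
apply/ffunP=> r; rewrite !ffunE (bigD1 t) //= big1 => [|u neq_ut].
  rewrite !ffunE eqxx addr0 (can2_eq (mulgKV t) (mulgK t)).
  by case: eqP => // _; rewrite gact0 mul0r.
by rewrite [tw t z u]ffunE ifN ?mulr0.
Qed.

Lemma twisted_sum (a : twisted) : a = \sum_s tw s (a s).
Proof.
apply/ffunP=> r; rewrite sum_ffunE (bigD1 r) //= big1 => [|s neq_sr].
  by rewrite ffunE eqxx addr0.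
by rewrite ffunE eq_sym ifN.
Qed.

Definition twisted_over (T : set L) : set twisted := [set a | forall s, T (a s)].

End TwistedGroupRing.

Arguments twisted_over {K L gT} to T.

Section RightModules.

Variables (K : fieldType) (A : algType K).

(* Finite-dimensional right A-modules; rm_act X a is the operation x |-> x.a,  *)
(* whence the reversed composition in rm_actM. K acts on X through A.          *)
Record rmod := RMod {
  rm_space :> vectType K;
  rm_act : {linear A -> 'End(rm_space)};
  rm_act1 : rm_act 1 = \1%VF;
  rm_actM : forall a b, rm_act (a * b) = (rm_act b \o rm_act a)%VF }.

Definition rm_simple (X : rmod) :=
  (exists x : X, x != 0) /\
  forall U : {vspace X}, (forall a, (rm_act X a @: U <= U)%VS) ->
    U = 0%VS \/ U = fullv.

Definition rm_iso (X Y : rmod) :=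
  exists f : 'Hom(X, Y), bijective f /\
    forall a x, f (rm_act X a x) = rm_act Y a (f x).

Definition rm_end (X : rmod) : set 'End(X) :=
  [set f | forall a x, f (rm_act X a x) = rm_act X a (f x)].

(* B-linear endomorphisms of V, for B `<=` A and V `<=` X with K V = X,        *)
(* identified with their unique K-linear extension to X.                       *)
Definition lattice_end (B : set A) (X : rmod) (V : set X) : set 'End(X) :=
  [set f | (forall x, V x -> V (f x)) /\
    forall a x, B a -> V x -> f (rm_act X a x) = rm_act X a (f x)].

Definition fg_submod (B : set A) (X : rmod) (V : set X) :=
  exists m (w : 'I_m -> X), V =
    [set x | exists a : 'I_m -> A, (forall j, B (a j)) /\
                                   x = \sum_j rm_act X (a j) (w j)].

End RightModules.

Arguments rm_end {K A} X.

(* Linear endomorphisms of V commuting with the set D of endomorphisms,        *)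
(* again identified with their K-linear extension to the ambient space.        *)
Definition bilattice_end (K : fieldType) (X : vectType K)
    (D : set 'End(X)) (V : set X) : set 'End(X) :=
  [set f | (forall x, V x -> V (f x)) /\
    forall (d : 'End(X)) x, D d -> V x -> f (d x) = d (f x)].

Section EndProduct.

Variables (K : fieldType) (A : algType K) (I : finType) (X : I -> rmod A).

Definition endprod := {dffun forall i, 'End(X i)}.

HB.instance Definition _ := Choice.on endprod.

Definition endprod0 : endprod := [ffun i => 0 : 'End(X i)].
Definition endprodN (f : endprod) : endprod := [ffun i => - f i].
Definition endprodD (f g : endprod) : endprod := [ffun i => f i + g i].
Definition endprodZ (c : K) (f : endprod) : endprod := [ffun i => c *: f i].

Lemma endprodDA : associative endprodD.
Proof. by move=> f g h; apply/ffunP=> i; rewrite !ffunE addrA. Qed.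
Lemma endprodDC : commutative endprodD.
Proof. by move=> f g; apply/ffunP=> i; rewrite !ffunE addrC. Qed.
Lemma endprod0D : left_id endprod0 endprodD.
Proof. by move=> f; apply/ffunP=> i; rewrite !ffunE add0r. Qed.
Lemma endprodND : left_inverse endprod0 endprodN endprodD.
Proof. by move=> f; apply/ffunP=> i; rewrite !ffunE addNr. Qed.

HB.instance Definition _ := GRing.isZmodule.Build endprod
  endprodDA endprodDC endprod0D endprodND.

Lemma endprodZA c d f : endprodZ c (endprodZ d f) = endprodZ (c * d) f.
Proof. by apply/ffunP=> i; rewrite !ffunE scalerA. Qed.
Lemma endprod1Z : left_id 1 endprodZ.
Proof. by move=> f; apply/ffunP=> i; rewrite !ffunE scale1r. Qed.
Lemma endprodZDr : right_distributive endprodZ +%R.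
Proof. by move=> c f g; apply/ffunP=> i; rewrite !ffunE scalerDr. Qed.
Lemma endprodZDl f : {morph endprodZ^~ f : c d / c + d}.
Proof. by move=> c d; apply/ffunP=> i; rewrite !ffunE scalerDl. Qed.

HB.instance Definition _ := GRing.Zmodule_isLmodule.Build K endprod
  endprodZA endprod1Z endprodZDr endprodZDl.

Definition wedderburn (a : A) : endprod := [ffun i => rm_act (X i) a].

Definition setprod (E : forall i, set 'End(X i)) : set endprod :=
  [set f | forall i, E i (f i)].

End EndProduct.

Arguments wedderburn {K A I} X a.
Arguments setprod {K A I X} E.

(* U is free over the scalars D, acting through op, with a basis of m elements *)
Definition free_basis (R : choiceType) (W : nmodType) (op : R -> W -> W)
    (D : set R) (U : set W) m (b : 'I_m -> W) :=
  (forall j, U (b j)) /\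
  forall u, U u -> exists! c : {ffun 'I_m -> R},
    (forall j, D (c j)) /\ u = \sum_j op (c j) (b j).

Definition has_dim (R : choiceType) (W : nmodType) (op : R -> W -> W)
    (D : set R) (U : set W) m :=
  exists b : 'I_m -> W, free_basis op D U b.

(* t is the trace of f, restricted to the f-stable subspace U of W             *)
Definition is_trace (K : fieldType) (W : lmodType K) (U : set W) (f : W -> W)
    (t : K) :=
  exists m (b : 'I_m -> W) (M : 'M[K]_m),
    [/\ free_basis ( *:%R) setT U b,
        forall j, f (b j) = \sum_l M j l *: b l & t = \tr M].

Section EndomorphismAlgebras.

Variables (K : fieldType) (X : vectType K).
Implicit Types D O : set 'End(X).

Definition end_center D : set 'End(X) :=
  [set z | D z /\ forall y, D y -> (z \o y = y \o z)%VF].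

(* phi is a splitting D (x)_Z(D) E = M_m(E): over the embedding of Z(D) in E   *)
(* as scalar matrices, surjectivity makes the induced map an isomorphism       *)
(* because D (x)_Z(D) E is simple for a skew field D.                          *)
Definition is_splitting D (E : fieldType) m (phi : 'End(X) -> 'M[E]_m.+1) :=
  [/\ forall x y, D x -> D y -> phi (x + y) = phi x + phi y,
      forall x y, D x -> D y -> phi (x \o y)%VF = phi x *m phi y,
      phi \1%VF = 1%:M,
      forall z, end_center D z -> is_scalar_mx (phi z) &
      forall M, exists l (e : 'I_l -> E) (y : 'I_l -> 'End(X)),
        (forall j, D (y j)) /\ M = \sum_j e j *: phi (y j)].

Definition is_reduced_trace D (x z : 'End(X)) :=
  end_center D z /\
  exists (E : fieldType) m (phi : 'End(X) -> 'M[E]_m.+1),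
    is_splitting D phi /\ phi z = (\tr (phi x))%:M.

(* tr_{D/K} = Tr_{Z(D)/K} \o tr_{D/Z(D)} *)
Definition is_total_trace D (x : 'End(X)) (t : K) :=
  exists z, is_reduced_trace D x z /\
            is_trace (end_center D) (fun y => (z \o y)%VF) t.

End EndomorphismAlgebras.

(* v is a discrete valuation of K, normalised by v pi = 1, and S is its        *)
(* valuation ring; the value v 0 is irrelevant.                                *)
Record is_dvr (K : fieldType) (S : set K) (pi : K) (v : K -> int) : Prop :=
  IsDvr {
    dvrM : forall a b, a != 0 -> b != 0 -> v (a * b) = v a + v b;
    dvrD : forall a b, a != 0 -> b != 0 -> a + b != 0 ->
      Num.min (v a) (v b) <= v (a + b);
    dvr_pi0 : pi != 0;
    dvr_pi : v pi = 1;
    dvr_ring : S = [set a | a = 0 \/ 0 <= v a] }.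

Section Lattices.

Variables (K : fieldType) (S : set K).

Definition is_submod (W : lmodType K) (M : set W) :=
  [/\ M 0, forall x y, M x -> M y -> M (x + y) &
      forall c x, S c -> M x -> M (c *: x)].

(* A composition series of length l of M / N, pulled back to M                 *)
Definition is_colength (W : lmodType K) (N M : set W) (l : nat) :=
  exists C : nat -> set W,
    [/\ C 0 = N, C l = M, forall j, (j <= l)%N -> is_submod (C j) &
        forall j, (j < l)%N -> C j `<` C j.+1 /\
          forall P, is_submod P -> C j `<=` P -> P `<=` C j.+1 ->
            P = C j \/ P = C j.+1].

Definition spans (W : lmodType K) (M U : set W) :=
  forall u, U u -> exists m (c : 'I_m -> K) (w : 'I_m -> W),
    (forall j, M (w j)) /\ u = \sum_j c j *: w j.

Definition fin_gen (W : lmodType K) (M : set W) :=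
  exists m (w : 'I_m -> W), M =
    [set x | exists c : 'I_m -> K, (forall j, S (c j)) /\
                                   x = \sum_j c j *: w j].

Definition is_order (X : vectType K) (D O : set 'End(X)) :=
  [/\ O `<=` D, O \1%VF, forall f g, O f -> O g -> O (f \o g)%VF,
      fin_gen O & spans O D].

Definition is_max_order (X : vectType K) (D O : set 'End(X)) :=
  is_order D O /\ forall P, is_order D P -> O `<=` P -> P = O.

Definition integral_closure (L : fieldExtType K) : set L :=
  [set y | exists p : {poly K},
    [/\ p \is monic, forall i, S p`_i & root (map_poly (in_alg L) p) y]].

Definition field_dual (L : fieldExtType K) (T : set L) : set L :=
  [set y | forall t, T t -> exists c, S c /\ is_trace setT ( *%R (y * t)) c].

Definition order_dual (X : vectType K) (D O : set 'End(X)) : set 'End(X) :=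
  [set y | D y /\ forall s, O s -> exists c, S c /\ is_total_trace D (y \o s)%VF c].

End Lattices.

Arguments integral_closure {K} S L.

(* Main.v *)
(* The form (a, b) |-> Tr_{L/K} ((a b)_1) on the twisted group ring A is      *)
(* nondegenerate, and the dual of T wr G consists of the elements with        *)
(* coefficients in T^+, which contains T wr G with colength g delta_{T/S}.    *)
(* Over a splitting field E of the kernel N, n times the form is the sum of   *)
(* the traces of the representations of A induced from the irreducible        *)
(* representations of N, weighted by the degrees of the latter. Those that do *)
(* not vanish on the block of X_i correspond to the embeddings of Z(K_i) into *)
(* E; they split K_i, so they all have degree x_i d_i and are induced from    *)
(* degree m_i = x_i d_i / h. Hence the form is (m_i / n) tr_{K_i/K} on the    *)
(* diagonal of End_{K_i} X_i. Left ideals of the maximal order S_i are        *)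
(* principal, so V_i is free and prod_i End_{S_i} V_i is a product of matrix  *)
(* rings over the S_i, whose dual is given by the S_i^+ up to the scalars     *)
(* n / m_i. Comparing the colengths of both lattices in their duals gives     *)
(* twice their relative colength.                                             *)

From HB Require Import structures.
Require Import Defs.
From mathcomp Require Import all_boot all_order all_algebra all_fingroup all_field.
From mathcomp Require Import all_solvable mxrepresentation.
From mathcomp Require Import boolp classical_sets.
From mathcomp Require Import zify ring.

Set Implicit Arguments.
Unset Strict Implicit.
Unset Printing Implicit Defensive.

Import Order.TTheory GRing.Theory Num.Theory.

Local Open Scope classical_set_scope.
Local Open Scope ring_scope.

(** * Lattices over a discrete valuation ring *)

(** Colengths are read off from determinants. In a K-basis of A = L wr G a full S-lattice is the row
    lattice [lat S P] of an invertible matrix, colengths are differences of the volumes [vol v P],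
    the valuations of the determinants ([lat_colength], [colength_val]), and dualising with respect
    to a form with Gram matrix B sends the volume w to - w - vol B ([lat_dual]).

    The form is [tform], and the basis [unit_basis] consists of matrix units with entries in S-bases
    of the S_i. In this basis the product of the End V_i is the standard lattice, of volume 0, so
    the length l sought is the volume of T wr G. The dual of T wr G is T^+ wr G, whence 2 l + vol B
    = g delta_{T/S} ([twisted_over_vol]). On the block of X_i the form is kappa_i = (x_i d_i / h) /
    n times the reduced trace form on matrices over K_i, whence vol B is the sum of the x_i^2
    (delta_{S_i/S} + r_i v(kappa_i)) ([coef_set_vol]). Eliminating vol B, and using that the x_i^2
    r_i add up to g h ([sum_rank]), gives the formula.

    Two facts carry this. The first is that V_i is free over S_i. Left ideals of a maximal order
    over S are principal ([principal]): a chain of simple extensions reduces this to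
    [simple_ext_principal], where the annihilator P of the simple quotient is invertible by
    maximality and the generator comes from an idempotent modulo P. A triangular basis then yields
    [free_lattice].

    The second is the value of the form on each block. The representations of A induced from the
    irreducible representations of the kernel N have traces whose weighted sum is n times the form
    ([ind_trace_formula]). This gives faithfulness of A on the X_i ([wedderburn_inj]), full matrix
    images over a splitting field ([rho_mx_full]), the number of representations in each block
    ([card_center]), and finally the reduced trace ([total_trace_corner], [trace_form_coef]). The
    elements of A that act as prescribed come from the density theorem [jacobson_density], which
    also provides dual elements for bases of L over K and of K_i over its center. *)

Section Valuation.

Variables (K : fieldType) (S : set K) (pi : K) (v : K -> int).
Hypothesis hS : is_dvr S pi v.

Lemma dvrE a : S a <-> a = 0 \/ 0 <= v a.
Proof. by rewrite (dvr_ring hS). Qed.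

Lemma val1 : v 1 = 0.
Proof.
have : v (1 * 1) = v 1 + v 1 by apply: (dvrM hS); exact: oner_neq0.
by rewrite mulr1; lia.
Qed.

Lemma valN1 : v (-1) = 0.
Proof.
have n1 : (-1 : K) != 0 by rewrite oppr_eq0 oner_neq0.
by have := dvrM hS n1 n1; rewrite mulrNN mulr1 val1; lia.
Qed.

Lemma valV a : a != 0 -> v a^-1 = - v a.
Proof.
by move=> a0; have := dvrM hS a0 (invr_neq0 a0); rewrite divff // val1; lia.
Qed.

Lemma valX a e : a != 0 -> v (a ^+ e) = e%:Z * v a.
Proof.
move=> a0; elim: e => [|e IHe]; first by rewrite expr0 val1 mul0r.
by rewrite exprS (dvrM hS) ?expf_neq0 // IHe; lia.
Qed.

Lemma val_prod (I : finType) (P : pred I) (F : I -> K) :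
  (forall i, P i -> F i != 0) -> v (\prod_(i | P i) F i) = \sum_(i | P i) v (F i).
Proof.
move=> F0.
suff [] : \prod_(i | P i) F i != 0 /\
  v (\prod_(i | P i) F i) = \sum_(i | P i) v (F i) by [].
elim/big_rec2: _ => [|i y x Pi [x0 <-]]; first by rewrite val1 oner_neq0.
by rewrite (dvrM hS) ?F0 // mulf_neq0 ?F0.
Qed.

Lemma dvr0 : S 0. Proof. by apply/dvrE; left. Qed.
Lemma dvr1 : S 1. Proof. by apply/dvrE; right; rewrite val1. Qed.

Lemma dvrMS a b : S a -> S b -> S (a * b).
Proof.
move=> /dvrE Sa /dvrE Sb; apply/dvrE.
have [->|a0] := eqVneq a 0; first by left; rewrite mul0r.
have [->|b0] := eqVneq b 0; first by left; rewrite mulr0.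
case: Sa => [e|Sa]; first by rewrite e eqxx in a0.
case: Sb => [e|Sb]; first by rewrite e eqxx in b0.
by right; rewrite (dvrM hS) //; lia.
Qed.

Lemma dvrNS a : S a -> S (- a).
Proof.
move=> Sa; rewrite -mulN1r; apply: dvrMS => //.
by apply/dvrE; right; rewrite valN1.
Qed.

Lemma dvrDS a b : S a -> S b -> S (a + b).
Proof.
move=> Sa Sb; have [->|a0] := eqVneq a 0; first by rewrite add0r.
have [->|b0] := eqVneq b 0; first by rewrite addr0.
have [->|ab0] := eqVneq (a + b) 0; first exact: dvr0.
apply/dvrE; right; have := dvrD hS a0 b0 ab0.
move/dvrE: Sa => [e|Sa]; first by rewrite e eqxx in a0.
move/dvrE: Sb => [e|Sb]; first by rewrite e eqxx in b0.
by apply: le_trans; rewrite le_min Sa Sb.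
Qed.

Lemma dvr_sum (I : Type) (r : seq I) (P : pred I) (F : I -> K) :
  (forall i, P i -> S (F i)) -> S (\sum_(i <- r | P i) F i).
Proof. by move=> SF; apply: big_ind => //; [exact: dvr0|exact: dvrDS]. Qed.

Lemma dvr_prod (I : Type) (r : seq I) (P : pred I) (F : I -> K) :
  (forall i, P i -> S (F i)) -> S (\prod_(i <- r | P i) F i).
Proof. by move=> SF; apply: big_ind => //; [exact: dvr1|exact: dvrMS]. Qed.

Lemma dvr_piS : S pi.
Proof. by apply/dvrE; right; rewrite (dvr_pi hS). Qed.

Lemma dvr_piXS e : S (pi ^+ e).
Proof.
by elim: e => [|e IHe]; rewrite ?exprS; [apply: dvr1|apply: dvrMS=> //; apply: dvr_piS].
Qed.

Lemma piX_neq0 e : pi ^+ e != 0.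
Proof. by rewrite expf_neq0 ?(dvr_pi0 hS). Qed.

Lemma val_piX e : v (pi ^+ e) = e.
Proof. by rewrite valX ?(dvr_pi0 hS)// (dvr_pi hS) mulr1. Qed.

Lemma dvr_clear a : exists e, forall e', (e <= e')%N -> S (pi ^+ e' * a).
Proof.
exists `|v a|%N => e le_e; have [->|a0] := eqVneq a 0.
  by rewrite mulr0; apply: dvr0.
by apply/dvrE; right; rewrite (dvrM hS) ?piX_neq0 // val_piX; lia.
Qed.

Lemma dvr_clear_all (I : finType) (F : I -> K) :
  exists e, forall e', (e <= e')%N -> forall i, S (pi ^+ e' * F i).
Proof.
have /choice[e He] i := dvr_clear (F i).
exists (\max_i e i)%N => e' le_e i; apply: He.
exact: leq_trans (leq_bigmax i) le_e.
Qed.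

Lemma dvr_unit a : a != 0 -> v a = 0 -> S a /\ S a^-1.
Proof. by move=> a0 va; split; apply/dvrE; right; rewrite ?valV // va. Qed.

Lemma dvr_or_pi a : S a -> (a != 0 /\ v a = 0) \/ exists2 b, S b & a = pi * b.
Proof.
move=> Sa; have [->|a0] := eqVneq a 0.
  by right; exists 0; rewrite ?mulr0 //; apply: dvr0.
have [va0|va0] := eqVneq (v a) 0; [by left | right].
exists (pi^-1 * a); last by rewrite mulrA divff ?mul1r ?(dvr_pi0 hS).
apply/dvrE; right; rewrite (dvrM hS) ?invr_neq0 ?(dvr_pi0 hS) //.
rewrite valV ?(dvr_pi0 hS) // (dvr_pi hS).
by move/dvrE: Sa => [e|]; [rewrite e eqxx in a0 | lia].
Qed.

End Valuation.

(** * Submodules and composition series, and their transport along injective linear maps *)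

Section Submodules.

Variables (K : fieldType) (S : set K) (pi : K) (v : K -> int).
Hypothesis hS : is_dvr S pi v.
Variable W : lmodType K.
Implicit Types M N P : set W.

Lemma submodN M x : is_submod S M -> M x -> M (- x).
Proof.
case=> _ _ MZ Mx; rewrite -scaleN1r; apply: MZ => //.
by apply: (dvrNS hS); apply: (dvr1 hS).
Qed.

Lemma submodB M x y : is_submod S M -> M x -> M y -> M (x - y).
Proof. by move=> hM Mx My; case: (hM) => _ MD _; apply: MD (submodN _ _). Qed.

Lemma submod_sum (I : Type) (r : seq I) (Q : pred I) (F : I -> W) M :
  is_submod S M -> (forall i, Q i -> M (F i)) -> M (\sum_(i <- r | Q i) F i).
Proof. by case=> M0 MD _ MF; apply: big_ind. Qed.

Lemma colength_sub N M l : is_colength S N M l -> N `<=` M.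
Proof.
case=> C [<- <- _ CS]; have {CS} CS j : (j < l)%N -> C j `<=` C j.+1.
  by move=> /CS[[]].
suff H j : (j <= l)%N -> C 0 `<=` C j by apply: H.
elim: j => [_|j IHj lt_jl] x // /(IHj (ltnW lt_jl)); exact: CS.
Qed.

Lemma colength_submod N M l :
  is_colength S N M l -> is_submod S N /\ is_submod S M.
Proof. by case=> C [<- <- CS _]; split; apply: CS. Qed.

Lemma colength0 M : is_submod S M -> is_colength S M M 0.
Proof. by move=> hM; exists (fun=> M). Qed.

Lemma colength_cat N P M l m :
  is_colength S N P l -> is_colength S P M m -> is_colength S N M (l + m).
Proof.
case=> C [C0 Cl CS Cs] [C' [C'0 C'm C'S C's]].
pose F j := if (j <= l)%N then C j else C' (j - l)%N.
have FE j : (l <= j)%N -> F j = C' (j - l)%N.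
  rewrite /F leq_eqVlt => /orP[/eqP <-|]; first by rewrite leqnn subnn Cl.
  by rewrite ltnNge => /negbTE->.
exists F; split.
- by rewrite /F.
- by rewrite FE ?leq_addr // addKn.
- move=> j lj; rewrite /F; case: leqP => // lj'; first exact: CS.
  by apply: C'S; lia.
- move=> j lj; have [lj'|lj'] := ltnP j l.
    by rewrite /F ltnW // lj'; apply: Cs.
  rewrite !FE ?leqW // subSn //; apply: C's; lia.
Qed.

Lemma colength_step N M : is_submod S N -> is_submod S M -> N `<` M ->
  (forall P, is_submod S P -> N `<=` P -> P `<=` M -> P = N \/ P = M) ->
  is_colength S N M 1.
Proof.
move=> hN hM lt_NM sNM; exists (fun j => if j is 0%N then N else M).
by split=> // -[|j].
Qed.

End Submodules.

Section Transport.

Variables (K : fieldType) (S : set K) (pi : K) (v : K -> int).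
Hypothesis hS : is_dvr S pi v.
Variables (W W' : lmodType K) (f : W -> W').
Hypotheses (fD : {morph f : x y / x + y}) (fZ : forall c x, f (c *: x) = c *: f x).
Hypothesis f_inj : injective f.

Lemma submod_image (M : set W) : is_submod S M -> is_submod S (f @` M).
Proof.
have f0 : f 0 = 0 by rewrite -(scale0r (0 : W)) fZ scale0r.
case=> M0 MD MZ; split.
- by exists 0.
- by move=> _ _ [x Mx <-] [y My <-]; exists (x + y); [apply: MD|rewrite fD].
- by move=> c _ Sc [x Mx <-]; exists (c *: x); [apply: MZ|rewrite fZ].
Qed.

Lemma colength_image (N M : set W) l :
  is_colength S N M l -> is_colength S (f @` N) (f @` M) l.
Proof.
have f0 : f 0 = 0 by rewrite -(scale0r (0 : W)) fZ scale0r.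
case=> C [C0 Cl CS Cs]; exists (fun j => f @` C j); split.
- by rewrite C0.
- by rewrite Cl.
- by move=> j lj; apply/submod_image/CS.
move=> j lj; have [[sC nsC] sim] := Cs j lj; split.
  split; first exact: image_subset.
  move=> sf; apply: nsC => x Cx; have [] := sf (f x); first by exists x.
  by move=> y Cy /f_inj <-.
move=> P [P0 PD PZ] sP Ps.
have eP : P = f @` (f @^-1` P).
  apply/seteqP; split=> [y Py|_ [x Px <-] //].
  by have [x Cx exy] := Ps y Py; exists x; rewrite /preimage /= ?exy.
have [||| e|e] := sim (f @^-1` P).
- split; rewrite /preimage /=; first by rewrite f0.
    by move=> x y Px Py; rewrite fD; apply: PD.
  by move=> c x Sc Px; rewrite fZ; apply: PZ.
- by move=> x Cx; apply: sP; exists x.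
- move=> x Px; have [y Cy /f_inj <- //] := Ps _ Px.
- by left; rewrite eP e.
- by right; rewrite eP e.
Qed.

End Transport.

(** * Row lattices of invertible matrices: volume, colength and dual *)

Section MatrixLattices.

Variables (K : fieldType) (S : set K) (pi : K) (v : K -> int).
Hypothesis hS : is_dvr S pi v.

Definition intmx m n (M : 'M[K]_(m, n)) := forall i j, S (M i j).

Lemma intmxM m n p (M : 'M[K]_(m, n)) (N : 'M[K]_(n, p)) :
  intmx M -> intmx N -> intmx (M *m N).
Proof.
move=> SM SN i j; rewrite mxE; apply: (dvr_sum hS) => k _; exact: (dvrMS hS).
Qed.

Lemma intmx_det n (M : 'M[K]_n) : intmx M -> S (\det M).
Proof.
move=> SM; rewrite /determinant; apply: (dvr_sum hS) => s _.
apply: (dvrMS hS); last exact: (dvr_prod hS).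
by case: (odd_perm s); rewrite ?expr1 ?expr0; [apply: (dvrNS hS)|]; apply: (dvr1 hS).
Qed.

Lemma intmx_delta m n i j : intmx (delta_mx i j : 'M[K]_(m, n)).
Proof. by move=> k l; rewrite mxE; case: andP => _; [apply: (dvr1 hS)|apply: (dvr0 hS)]. Qed.

Variable n : nat.
Implicit Types (P Q R : 'M[K]_n) (M : set 'rV[K]_n).

(** A covolume on a logarithmic scale: for invertible matrices it depends on the lattice [lat P]
    alone ([lat_vol_le]), and a larger lattice has a smaller volume. *)
Definition vol P : int := v (\det P).

Definition lat P : set 'rV[K]_n := [set x | exists2 u, intmx u & x = u *m P].

Lemma lat_submod P : is_submod S (lat P).
Proof.
split.
- by exists 0; rewrite ?mul0mx // => i j; rewrite mxE; apply: (dvr0 hS).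
- move=> _ _ [x Sx ->] [y Sy ->]; exists (x + y); rewrite ?mulmxDl // => i j.
  by rewrite mxE; apply: (dvrDS hS).
- move=> c _ Sc [x Sx ->]; exists (c *: x); rewrite ?scalemxAl // => i j.
  by rewrite mxE; apply: (dvrMS hS).
Qed.

Lemma latP P x : P \in unitmx -> lat P x <-> intmx (x *m invmx P).
Proof.
move=> uP; split=> [[u Su ->]|Sx]; first by rewrite mulmxK.
by exists (x *m invmx P); rewrite ?mulmxKV.
Qed.

Lemma lat_row P i : lat P (row i P).
Proof. by exists (delta_mx 0 i); [exact: intmx_delta|rewrite -rowE]. Qed.

Lemma lat_subP P Q : Q \in unitmx ->
  lat P `<=` lat Q <-> exists2 U, intmx U & P = U *m Q.
Proof.
move=> uQ; split=> [sPQ|[U SU ->] _ [u Su ->]]; last first.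
  by exists (u *m U); rewrite ?mulmxA //; apply: intmxM.
exists (P *m invmx Q); last by rewrite mulmxKV.
move=> i j; have /(sPQ _)/(latP _ uQ)/(_ 0 j) := lat_row P i.
by rewrite -row_mul mxE.
Qed.

Lemma lat_vol_le P Q : P \in unitmx -> Q \in unitmx ->
  lat P `<=` lat Q -> vol Q <= vol P.
Proof.
move=> uP uQ /(lat_subP _ uQ)[U SU eP].
have dQ : \det Q != 0 by rewrite -unitfE -unitmxE.
have : \det P != 0 by rewrite -unitfE -unitmxE.
rewrite /vol eP det_mulmx mulf_eq0 negb_or => /andP[dU _].
rewrite (dvrM hS) //; have /(dvrE hS)[e|] := intmx_det SU; last by rewrite lerDr.
by rewrite e eqxx in dU.
Qed.

(** As [pi *: x] lies in the lattice and x does not, some coordinate u j0 of x has valuation exactly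
    -1, and exchanging row j0 of P for x multiplies the determinant by u j0. The quotient is simple
    because the coefficient at x of an element of an intermediate M is either a unit, which puts x
    into M, or divisible by pi, which puts the element into [lat P]. *)
Lemma mem_step P x : P \in unitmx -> ~ lat P x -> lat P (pi *: x) ->
  exists Q, [/\ Q \in unitmx, vol Q = vol P - 1,
    lat Q x /\ lat P `<` lat Q,
    (forall M, is_submod S M -> lat P `<=` M -> M x -> lat Q `<=` M) &
    forall M, is_submod S M -> lat P `<=` M -> M `<=` lat Q ->
      M = lat P \/ M = lat Q].
Proof.
move=> uP nPx Ppx.
have [u [eux eu]] : exists u, x = u *m P /\ u = x *m invmx P.
  by exists (x *m invmx P); rewrite mulmxKV.
have Spu j : S (pi * u 0 j).
  by move/(latP _ uP): Ppx => /(_ 0 j); rewrite -scalemxAl -eu mxE.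
have [j0 nSu] : exists j0, ~ S (u 0 j0).
  apply: contrapT => /forallNP nS; apply: nPx; apply/(latP _ uP) => i j.
  by rewrite ord1 -eu; apply: contrapT (nS j).
have u0 : u 0 j0 != 0 by apply/eqP=> e; apply: nSu; rewrite e; apply: (dvr0 hS).
have vu : v (u 0 j0) = -1.
  have := Spu j0; have := nSu; rewrite !(dvrE hS) (dvrM hS) ?(dvr_pi0 hS) //.
  rewrite (dvr_pi hS) => /not_orP[_ /negP nv] [/eqP|]; last by lia.
  by rewrite mulf_eq0 (negbTE (dvr_pi0 hS)) (negbTE u0).
have Spuinv : S (pi^-1 / u 0 j0).
  apply/(dvrE hS); right; rewrite (dvrM hS) ?invr_neq0 ?(dvr_pi0 hS) //.
  by rewrite !(valV hS) ?(dvr_pi0 hS) // (dvr_pi hS) vu.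
(* The identity with row j0 replaced by the coordinates of x, so that [U *m P] is P with x as row
   j0. *)
pose U : 'M[K]_n := \matrix_(i, j) if i == j0 then u 0 j else (i == j)%:R.
have detU : \det U = u 0 j0.
  rewrite (expand_det_col _ j0) (bigD1 j0) //= big1 => [|i nij]; last first.
    by rewrite mxE (negbTE nij) mul0r.
  rewrite addr0 mxE eqxx /cofactor addnn -signr_odd odd_double expr0 mul1r.
  rewrite (_ : row' _ _ = 1%:M) ?det1 ?mulr1 //.
  apply/matrixP=> i j; rewrite !mxE eq_sym (negbTE (neq_lift _ _)).
  by rewrite (inj_eq lift_inj).
have UE (w : 'rV[K]_n) :
    w *m U = w - w 0 j0 *: delta_mx 0 j0 + w 0 j0 *: u.
  apply/rowP=> j; rewrite !mxE (bigD1 j0) //= !mxE eqxx addrC; congr (_ + _).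
  have [->|nj] := eqVneq j j0.
    rewrite mulr1 subrr big1 // => i ni.
    by rewrite mxE (negbTE ni) mulr0.
  rewrite mulr0 subr0 (bigD1 j) //= mxE (negbTE nj) eqxx mulr1 big1 ?addr0 //.
  by move=> i /andP[ni nij]; rewrite mxE (negbTE ni) (negbTE nij) mulr0.
pose Q := U *m P.
have dP : \det P != 0 by rewrite -unitfE -unitmxE.
have uQ : Q \in unitmx by rewrite unitmxE det_mulmx detU unitfE mulf_neq0.
have QE (w : 'rV[K]_n) :
    w *m Q = w *m P - w 0 j0 *: row j0 P + w 0 j0 *: x.
  rewrite mulmxA UE mulmxDl mulmxBl -!scalemxAl -rowE -eux.
  by [].
have Qx : lat Q x.
  exists (delta_mx 0 j0); first exact: intmx_delta.
  by rewrite QE -rowE !mxE !eqxx scale1r subrr scale1r add0r.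
have sPQ : lat P `<=` lat Q.
  apply/(lat_subP _ uQ).
  (* The inverse of U. It is integral because z / u j0 = (pi z) (pi^-1 / u j0), where the second
     factor has valuation 0. *)
  pose U' : 'M[K]_n := \matrix_(i, j)
    if i == j0 then (if j == j0 then 1 else - u 0 j) / u 0 j0 else (i == j)%:R.
  exists U'.
    move=> i j; rewrite mxE; case: eqP => _; last first.
      by case: eqP => _; [apply: (dvr1 hS)|apply: (dvr0 hS)].
    have -> z : z / u 0 j0 = (pi * z) * (pi^-1 / u 0 j0).
      by rewrite mulrACA divff ?mul1r ?(dvr_pi0 hS).
    apply: (dvrMS hS) => //; case: eqP => _; first by rewrite mulr1; apply: (dvr_piS hS).
    by rewrite mulrN; apply: (dvrNS hS).
  rewrite mulmxA (_ : U' *m U = 1%:M) ?mul1mx //.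
  apply/row_matrixP=> i; rewrite row_mul UE.
  apply/rowP=> j; rewrite !mxE; have [->|ni] := eqVneq i j0; last first.
    by rewrite !mul0r subr0 addr0.
  rewrite eqxx; have [->|nj] := eqVneq j j0.
    by rewrite !eqxx /=; field.
  by rewrite andbF /=; field.
have least M : is_submod S M -> lat P `<=` M -> M x -> lat Q `<=` M.
  move=> hM sPM Mx _ [w Sw ->]; rewrite QE.
  case: (hM) => M0 MD MZ; apply: MD; last exact: MZ.
  apply: (submodB hS) => //; first by apply: sPM; exists w.
  apply: MZ => //; apply: sPM; exact: lat_row.
exists Q; split=> //.
- by rewrite /vol det_mulmx detU (dvrM hS) // vu addrC.
- by split=> //; split=> // sQP; apply/nPx/sQP.
- move=> M hM sPM sMQ; have [Mx|nMx] := EM (M x).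
    by right; apply/seteqP; split=> //; apply: least.
  left; apply/seteqP; split=> // y My; have [w Sw ey] := sMQ y My.
  have [|[w0 vw]|[b Sb eb]] := @dvr_or_pi _ _ _ _ hS (w 0 j0); first exact: Sw.
    case: nMx; have [Sw0 Swi] := dvr_unit hS w0 vw.
    case: (hM) => M0 MD MZ.
    have -> : x = (w 0 j0)^-1 *: (y - (w *m P - w 0 j0 *: row j0 P)).
      by rewrite ey QE addrC addKr scalerA mulVf ?scale1r.
    apply: (MZ) => //; apply: (submodB hS) => //; apply: (submodB hS) => //.
      by apply: sPM; exists w.
    by apply: MZ => //; apply: sPM; exact: lat_row.
  case: (lat_submod P) => P0 PD PZ.
  rewrite ey QE; apply: PD; last by rewrite eb mulrC -scalerA; apply: PZ.
  apply: (submodB hS) => //; [exact: lat_submod|by exists w|].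
  by apply: PZ => //; exact: lat_row.
Qed.

Lemma lat_clear P x : P \in unitmx -> exists e, lat P (pi ^+ e *: x).
Proof.
move=> uP; have [e /(_ e (leqnn e)) He] := dvr_clear_all hS (fun j => (x *m invmx P) 0 j).
exists e; apply/(latP _ uP) => i j; rewrite ord1 -scalemxAl mxE; exact: He.
Qed.

Lemma lat_step P M : P \in unitmx -> is_submod S M -> lat P `<` M ->
  exists Q, [/\ Q \in unitmx, vol Q = vol P - 1, lat P `<` lat Q,
    lat Q `<=` M &
    forall N, is_submod S N -> lat P `<=` N -> N `<=` lat Q ->
      N = lat P \/ N = lat Q].
Proof.
move=> uP hM [sPM nsMP].
have [x [Mx nPx]] : exists x, M x /\ ~ lat P x.
  by apply: contrapT => /forallNP H; apply: nsMP => x Mx;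
    apply: contrapT => nPx; apply: (H x).
(* Some power of pi carries x into the lattice; y is the last multiple of x by a power of pi that is
   still outside. *)
have [y [My nPy Ppy]] : exists y, [/\ M y, ~ lat P y & lat P (pi *: y)].
  have [e] := lat_clear x uP.
  elim: e => [|e IHe]; first by rewrite expr0 scale1r.
  rewrite exprS -scalerA => Pe; have [/IHe//|nPe] := EM (lat P (pi ^+ e *: x)).
  exists (pi ^+ e *: x); split=> //; case: hM => _ _; apply=> //.
  exact: (dvr_piXS hS).
have [Q [uQ vQ [Qy ltPQ] least sim]] := mem_step uP nPy Ppy.
by exists Q; split=> //; apply: least.
Qed.

(** Each [lat_step] towards M lowers the volume by one, and the volume of R is a lower bound, so the
    steps end, and they can only end at M. This produces a basis of M and a composition series at
    once. *)
Lemma lat_sandwich P R M : P \in unitmx -> R \in unitmx -> is_submod S M ->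
  lat P `<=` M -> M `<=` lat R ->
  exists Q l, [/\ Q \in unitmx, M = lat Q, is_colength S (lat P) M l &
                  vol P = vol Q + l].
Proof.
move=> uP uR hM sPM sMR.
have [m Hm] : exists m : nat, vol P - vol R <= m%:Z.
  by exists `|vol P - vol R|%N; lia.
elim: m P uP sPM Hm => [|m IHm] P uP sPM Hm;
  (have [->|/eqP nMP] := pselect (M = lat P); first by
    exists P, 0%N; split=> //; [exact/colength0/lat_submod|rewrite addr0]).
all: have ltPM : lat P `<` M by split=> // sMP; apply: (elimN eqP nMP);
    apply/seteqP; split.
all: have [Q [uQ vQ ltPQ sQM sim]] := lat_step uP hM ltPM.
all: have := lat_vol_le uQ uR (subset_trans sQM sMR).
  by lia.
move=> vRQ; have [|Q' [l [uQ' eM cl vl]]] := IHm Q uQ sQM; first by lia.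
exists Q', l.+1; split=> //; last by lia.
apply: (colength_cat (l := 1)) cl.
by apply: colength_step => //; apply: lat_submod.
Qed.

Lemma lat_colength P Q : P \in unitmx -> Q \in unitmx -> lat P `<=` lat Q ->
  exists2 l, is_colength S (lat P) (lat Q) l & vol P = vol Q + l%:Z.
Proof.
move=> uP uQ sPQ.
have [Q' [l [uQ' eQ cl vl]]] := lat_sandwich uP uQ (lat_submod Q) sPQ (fun _ => id).
exists l => //; rewrite vl; congr (_ + _); apply/eqP; rewrite eq_le.
by apply/andP; split; apply: lat_vol_le; rewrite // eQ.
Qed.

(** Each factor of a composition series is simple, hence coincides with one [lat_step] and costs one
    unit of volume. So every series between two lattices has the same length. *)
Lemma colength_val P Q l : P \in unitmx -> Q \in unitmx ->
  is_colength S (lat P) (lat Q) l -> vol P = vol Q + l%:Z.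
Proof.
move=> uP uQ [C [C0 Cl CS Cs]].
suff H j : (j <= l)%N ->
    exists Qj, [/\ Qj \in unitmx, C j = lat Qj & vol P = vol Qj + j%:Z].
  have [Q' [uQ' eQ ->]] := H l (leqnn l); congr (_ + _).
  by apply/eqP; rewrite eq_le; apply/andP; split; apply: lat_vol_le; rewrite // -eQ Cl.
elim: j => [_|j IHj lj]; first by exists P; rewrite C0 addr0.
have [Qj [uQj eCj vj]] := IHj (ltnW lj).
have [ltC sim] := Cs j lj; rewrite eCj in ltC sim.
have [Q' [uQ' vQ' ltQ sQ' _]] := lat_step uQj (CS _ lj) ltC.
exists Q'; split=> //; last by lia.
have [e|->//] := sim (lat Q') (lat_submod _) (properW ltQ) sQ'.
by case: ltQ => _; rewrite e; case.
Qed.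

Lemma lat_proper_val P Q : P \in unitmx -> Q \in unitmx -> lat P `<` lat Q ->
  vol Q < vol P.
Proof.
move=> uP uQ ltPQ; have [Q' [uQ' vQ' _ sQ _]] := lat_step uP (lat_submod Q) ltPQ.
by have := lat_vol_le uQ' uQ sQ; lia.
Qed.

(** Pairing x with the rows of P shows that x is in the dual exactly when x B P^T is integral, that
    is, when x lies in the row lattice of the inverse of B P^T. *)
Lemma lat_dual P (B : 'M[K]_n) : P \in unitmx -> B \in unitmx ->
  exists2 Q, Q \in unitmx /\ vol Q = - vol P - vol B &
    [set x : 'rV[K]_n | forall y, lat P y -> S ((x *m B *m y^T) 0 0)] = lat Q.
Proof.
move=> uP uB; pose Q := invmx (B *m P^T).
have uBP : B *m P^T \in unitmx by rewrite unitmx_mul uB unitmx_tr.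
have dP : \det P != 0 by rewrite -unitfE -unitmxE.
have dB : \det B != 0 by rewrite -unitfE -unitmxE.
exists Q; first split; rewrite ?unitmx_inv //.
  by rewrite /vol det_inv det_mulmx det_tr (valV hS) ?mulf_neq0 // (dvrM hS) // opprD addrC.
apply/seteqP; split=> x /=.
  move=> Hx; apply/latP; rewrite ?unitmx_inv // /Q invmxK => i j.
  have := Hx _ (lat_row P j).
  by rewrite ord1 tr_row colE !mulmxA -colE mxE.
move=> /latP; rewrite unitmx_inv => /(_ uBP); rewrite /Q invmxK => Sx _ [u Su ->].
rewrite trmx_mul mulmxA -(mulmxA x); apply: intmxM => // i j; rewrite mxE; exact: Su.
Qed.

End MatrixLattices.

(** * One-sided ideals of a maximal order *)

Lemma exists_minimizer (T : Type) (P : T -> Prop) (f : T -> nat) :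
  (exists x, P x) -> exists2 x, P x & forall y, P y -> (f x <= f y)%N.
Proof.
case=> x Px; have [n] := ubnP (f x); elim: n x Px => // n IHn x Px le_n.
have [//|/existsNP[y /not_implyP[Py /negP]]] := pselect (forall y, P y -> (f x <= f y)%N).
  by exists x.
by rewrite -ltnNge => lt_yx; apply: (IHn y) => //; apply: leq_trans lt_yx _.
Qed.

Section MaximalOrder.

Variables (R : nzRingType) (D Lam : set R) (p : R).

Definition additive_set (M : set R) := M 0 /\ forall x y, M x -> M y -> M (x - y).

(** The additive group generated by the products; the inductive form reduces each inclusion of a
    product of ideals to single products ([setmul_sub]). *)
Inductive setmul (M N : set R) : set R :=
  | setmul_in a b of M a & N b : setmul M N (a * b)
  | setmul0 : setmul M N 0
  | setmulB x y of setmul M N x & setmul M N y : setmul M N (x - y).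

Lemma additiveN M x : additive_set M -> M x -> M (- x).
Proof. by case=> M0 MB Mx; rewrite -sub0r; apply: MB. Qed.

Lemma additiveD M x y : additive_set M -> M x -> M y -> M (x + y).
Proof.
move=> aM Mx My; rewrite -[y]opprK; case: (aM) => _; apply=> //.
exact: additiveN.
Qed.

Lemma setmul_additive M N : additive_set (setmul M N).
Proof. exact: (conj (setmul0 M N) (@setmulB M N)). Qed.

Lemma setmul_sub M N U : additive_set U -> (forall a b, M a -> N b -> U (a * b)) ->
  setmul M N `<=` U.
Proof. by move=> [U0 UB] HU x; elim=> [a b Ma Nb||y z _ Uy _ Uz]; [exact: HU|exact: U0|exact: UB]. Qed.

Definition setadd (M N : set R) : set R := [set x | exists2 y, M y & N (x - y)].

Lemma setadd_additive M N : additive_set M -> additive_set N ->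
  additive_set (setadd M N).
Proof.
move=> [M0 MB] [N0 NB]; split; first by exists 0; rewrite ?subrr.
move=> x y [x1 Mx Nx] [y1 My Ny]; exists (x1 - y1); first exact: MB.
by rewrite (_ : x - y - _ = (x - x1) - (y - y1)); [exact: NB|rewrite !opprD !opprK addrACA].
Qed.

Lemma setaddl M N x : N 0 -> M x -> setadd M N x.
Proof. by exists x => //; rewrite subrr. Qed.

Lemma setaddr M N x : M 0 -> N x -> setadd M N x.
Proof. by exists 0 => //; rewrite subr0. Qed.

Hypotheses (D1 : D 1) (DB : forall x y, D x -> D y -> D (x - y)).
Hypotheses (DM : forall x y, D x -> D y -> D (x * y)).
Hypothesis Dinv : forall x, D x -> x != 0 -> exists y, [/\ D y, x * y = 1 & y * x = 1].
Hypotheses (sLD : Lam `<=` D) (L1 : Lam 1).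
Hypotheses (LB : forall x y, Lam x -> Lam y -> Lam (x - y)).
Hypotheses (LM : forall x y, Lam x -> Lam y -> Lam (x * y)).
Hypotheses (pL : Lam p) (p0 : p != 0) (pC : forall x, D x -> p * x = x * p).
Hypothesis clear : forall x, D x -> exists e, Lam (p ^+ e * x).
Hypothesis Lmax : forall O : set R, O 1 -> (forall x y, O x -> O y -> O (x - y)) ->
  (forall x y, O x -> O y -> O (x * y)) -> Lam `<=` O -> O `<=` D ->
  (exists e, forall x, O x -> Lam (p ^+ e * x)) -> O `<=` Lam.

Definition lsub (M : set R) :=
  [/\ M `<=` D, additive_set M & forall l m, Lam l -> M m -> M (l * m)].

Definition bounded e (M : set R) :=
  (forall x, Lam x -> M (p ^+ e * x)) /\ (forall x, M x -> Lam (p ^+ e * x)).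

(** A substitute for the length of left submodules with denominators bounded by [p ^+ e]. Only its
    strict monotonicity is assumed; it makes the chains of ideals below finite. *)
Hypothesis len : forall e, exists mu : set R -> nat, forall M N,
  lsub M -> lsub N -> bounded e M -> bounded e N ->
  M `<=` N -> ~ (N `<=` M) -> (mu M < mu N)%N.

Let L0 : Lam 0. Proof. by rewrite -(subrr 1); apply: LB. Qed.
Let D0 : D 0. Proof. exact: sLD. Qed.
Let aL : additive_set Lam. Proof. by []. Qed.
Let LD x y : Lam x -> Lam y -> Lam (x + y). Proof. exact: additiveD. Qed.
Let pXL e : Lam (p ^+ e).
Proof. by elim: e => [|e IHe]; rewrite ?exprS //; apply: LM. Qed.
Let pXC e x : D x -> p ^+ e * x = x * p ^+ e.
Proof.
by move=> Dx; elim: e => [|e IHe]; rewrite ?mul1r ?mulr1 // exprS -mulrA IHe mulrA pC // mulrA.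
Qed.
Let Dmul0 x y : D x -> x * y = 0 -> x = 0 \/ y = 0.
Proof.
move=> Dx xy0; have [->|/(Dinv Dx)[z [_ _ zx]]] := eqVneq x 0; first by left.
by right; rewrite -[y]mul1r -zx -mulrA xy0 mulr0.
Qed.
Let pX0 e : p ^+ e != 0.
Proof.
elim: e => [|e IHe]; first by rewrite oner_neq0.
by apply/eqP; rewrite exprS => /(Dmul0 (sLD pL))[]; apply/eqP.
Qed.
Let lsubL : lsub Lam. Proof. by []. Qed.

Lemma lsub_setmul M N : M `<=` D -> (forall l m, Lam l -> M m -> M (l * m)) ->
  N `<=` D -> lsub (setmul M N).
Proof.
move=> sMD LMM sND; split.
- by apply: setmul_sub => // a b /sMD Da /sND Db; apply: DM.
- exact: setmul_additive.
- move=> l m Ll; move: m; apply: setmul_sub.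
    split; first by rewrite mulr0; case: (setmul_additive M N).
    by move=> x y Hx Hy; rewrite mulrBr; case: (setmul_additive M N) => _; apply.
  by move=> a b Ma Nb; rewrite mulrA; apply: setmul_in => //; apply: LMM.
Qed.

Lemma lsub_setadd M N : lsub M -> lsub N -> lsub (setadd M N).
Proof.
move=> [sMD aM lM] [sND aN lN]; split.
- move=> x [y /sMD Dy /sND Dxy]; rewrite -(subrK y x).
  by apply: additiveD.
- exact: setadd_additive.
- move=> l x Ll [y My Nxy]; exists (l * y); first exact: lM.
  by rewrite -mulrBr; apply: lN.
Qed.

Lemma lsub_princ a : D a -> lsub [set x | exists2 l, Lam l & x = l * a].
Proof.
move=> Da; split.
- by move=> _ [l /sLD Dl ->]; apply: DM.
- split; first by exists 0; rewrite ?mul0r.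
  by move=> _ _ [l Ll ->] [m Lm ->]; exists (l - m); rewrite ?mulrBl //; apply: LB.
- by move=> l _ Ll [m Lm ->]; exists (l * m); rewrite ?mulrA //; apply: LM.
Qed.

Definition twosided (J : set R) :=
  [/\ J `<=` Lam, additive_set J, forall l x, Lam l -> J x -> J (l * x) &
      forall l x, Lam l -> J x -> J (x * l)].

Lemma twosided_lsub J : twosided J -> lsub J.
Proof. by case=> sJ aJ lJ _; split=> // x /sJ/sLD. Qed.

(** The left multipliers of J form a ring that contains Lam. Its denominators are bounded, since a
    multiplier sends [p ^+ e] into J and hence into Lam, so maximality makes it equal to Lam. *)
Lemma twosided_stab_l J e : twosided J -> J (p ^+ e) ->
  forall d, D d -> (forall x, J x -> J (d * x)) -> Lam d.
Proof.
move=> [sJ aJ lJ rJ] Jq d0 Dd0 Hd0.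
pose O := [set d | D d /\ forall x, J x -> J (d * x)].
apply: (_ : O `<=` Lam) => //; apply: Lmax.
- by split=> // x; rewrite mul1r.
- move=> x y [Dx Hx] [Dy Hy]; split; first exact: DB.
  by move=> z Jz; rewrite mulrBl; case: (aJ) => _; apply; [apply: Hx|apply: Hy].
- move=> x y [Dx Hx] [Dy Hy]; split; first exact: DM.
  by move=> z Jz; rewrite -mulrA; apply/Hx/Hy.
- by move=> x Lx; split; [exact: sLD|move=> z; apply: lJ].
- by move=> x [].
- by exists e => x [Dx Hx]; rewrite pXC //; apply/sJ/Hx.
Qed.

Lemma twosided_stab_r J e : twosided J -> J (p ^+ e) ->
  forall d, D d -> (forall x, J x -> J (x * d)) -> Lam d.
Proof.
move=> [sJ aJ lJ rJ] Jq d0 Dd0 Hd0.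
pose O := [set d | D d /\ forall x, J x -> J (x * d)].
apply: (_ : O `<=` Lam) => //; apply: Lmax.
- by split=> // x; rewrite mulr1.
- move=> x y [Dx Hx] [Dy Hy]; split; first exact: DB.
  by move=> z Jz; rewrite mulrBr; case: (aJ) => _; apply; [apply: Hx|apply: Hy].
- move=> x y [Dx Hx] [Dy Hy]; split; first exact: DM.
  by move=> z Jz; rewrite mulrA; apply/Hy/Hx.
- by move=> x Lx; split; [exact: sLD|move=> z; apply: rJ].
- by move=> x [].
- by exists e => x [Dx Hx]; apply/sJ/Hx.
Qed.

(** * Simple extensions of a maximal order are principal *)

Section SimpleExtension.

Variables (I : set R) (e0 : nat).
Hypotheses (lI : lsub I) (sLI : Lam `<=` I) (nIL : ~ (I `<=` Lam)).
Hypothesis simI : forall N, lsub N -> Lam `<=` N -> N `<=` I -> N `<=` Lam \/ I `<=` N.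
Local Notation q := (p ^+ e0).
Hypothesis qI : forall x, I x -> Lam (q * x).

Let sID : I `<=` D. Proof. by case: lI. Qed.
Let aI : additive_set I. Proof. by case: lI. Qed.
Let I1 : I 1. Proof. exact: sLI. Qed.
Let LI l x : Lam l -> I x -> I (l * x). Proof. by case: lI => _ _; apply. Qed.

Let simI' N : lsub N -> N `<=` I -> ~ (N `<=` Lam) -> I `<=` setadd Lam N.
Proof.
move=> lN sNI nNL; have lLN := lsub_setadd lsubL lN.
have N0 : N 0 by case: lN => _ [].
have [||sL|//] := simI lLN.
- by move=> x Lx; apply: setaddl.
- by move=> x [y Ly Nxy]; rewrite -(subrK y x); apply: additiveD => //; [apply: sNI|apply: sLI].
- by case: nNL => x Nx; apply: sL; apply: setaddr.
Qed.

(** The annihilator in Lam of the simple left module I / Lam, a primitive two-sided ideal. *)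
Let P : set R := [set l | Lam l /\ forall x, I x -> Lam (l * x)].

Let tP : twosided P.
Proof.
split.
- by move=> x [].
- split; first by split=> // x _; rewrite mul0r.
  move=> x y [Lx Hx] [Ly Hy]; split; first exact: LB.
  by move=> z Iz; rewrite mulrBl; apply: LB; [apply: Hx|apply: Hy].
- move=> l x Ll [Lx Hx]; split; first exact: LM.
  by move=> z Iz; rewrite -mulrA; apply: LM => //; apply: Hx.
- move=> l x Ll [Lx Hx]; split; first exact: LM.
  by move=> z Iz; rewrite -mulrA; apply/Hx/LI.
Qed.

Let sPL : P `<=` Lam. Proof. by case: tP. Qed.
Let aP : additive_set P. Proof. by case: tP. Qed.
Let lP l x : Lam l -> P x -> P (l * x). Proof. by case: tP => _ _ H _; apply: H. Qed.
Let rP l x : Lam l -> P x -> P (x * l). Proof. by case: tP => _ _ _; apply. Qed.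
Let Pq : P q. Proof. by split. Qed.
Let stabl := twosided_stab_l tP Pq.
Let stabr := twosided_stab_r tP Pq.

(** The inverse of P as a fractional ideal, as [QP1] and [PQ1] confirm. It contains I by [sIQ], and
    therefore is not inside Lam. *)
Let Q : set R := [set d | D d /\ forall l, P l -> Lam (d * l)].

Let sIQ : I `<=` Q.
Proof.
move=> x Ix; split; first exact: sID.
move=> l Pl; apply: stabr; first by apply: DM; [apply: sID|apply/sLD/sPL].
by move=> m [Lm Hm]; rewrite mulrA; apply: lP => //; apply: Hm.
Qed.

Let nQL : ~ (Q `<=` Lam). Proof. by move=> sQL; apply: nIL => x /sIQ/sQL. Qed.

Let PQ l d : P l -> Q d -> Lam (l * d).
Proof.
move=> Pl [Dd Hd]; apply: stabl; first by apply: DM => //; apply/sLD/sPL.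
by move=> m Pm; rewrite -mulrA; apply: rP => //; apply: Hd.
Qed.

Let sQD : Q `<=` D. Proof. by move=> x []. Qed.
Let lQ l d : Lam l -> Q d -> Q (l * d).
Proof.
move=> Ll [Dd Hd]; split; first by apply: DM => //; apply: sLD.
by move=> m Pm; rewrite -mulrA; apply: LM => //; apply: Hd.
Qed.
Let rQ l d : Lam l -> Q d -> Q (d * l).
Proof.
move=> Ll [Dd Hd]; split; first by apply: DM => //; apply: sLD.
by move=> m Pm; rewrite -mulrA; apply/Hd/lP.
Qed.
Let Q1 : Q 1. Proof. exact/sIQ. Qed.

Let mulI_sub (J : set R) : twosided J -> lsub (setmul J I) /\ setmul J I `<=` I.
Proof.
case=> sJ aJ lJ rJ; split; first by apply: lsub_setmul => // x /sJ/sLD.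
by apply: setmul_sub => // a b /sJ La; apply: LI.
Qed.

Let nJI (J : set R) : twosided J -> ~ (J `<=` P) -> ~ (setmul J I `<=` Lam).
Proof.
move=> [sJ aJ lJ rJ] nJP sJIL; apply: nJP => x Jx; split; first exact: sJ.
by move=> y Iy; apply: sJIL; exact: setmul_in.
Qed.

Let lift_nsub (J : set R) : twosided J -> ~ (J `<=` P) -> I `<=` setadd Lam (setmul J I).
Proof. by move=> tJ nJP; have [lJI sJI] := mulI_sub tJ; apply: simI' => //; apply: nJI. Qed.

(* The primitive ideal P is maximal: shrink a left ideal N, comaximal with C, *)
(* by the annihilators of the points of I / Lam.                              *)
Let comax (C : set R) : twosided C -> ~ (C `<=` P) -> exists2 c, C c & P (1 - c).
Proof.
move=> tC nCP; case: (tC) => sC aC lC rC; have [mu Hmu] := len e0.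
suff H n (N : set R) : (mu N < n)%N -> lsub N -> P `<=` N -> N `<=` Lam ->
    (exists2 c, C c & N (1 - c)) -> exists2 c, C c & P (1 - c).
  apply: (H (mu Lam).+1 Lam) => //; exists 0; rewrite ?subr0 //.
  by case: aC.
elim: n N => // n IHn N ltn lN sPN sNL [c Cc Nc].
have bN : bounded e0 N.
  split=> x; last by move/sNL=> Lx; apply: LM.
  by move=> Lx; apply: sPN; apply: rP.
have [sNP|nNP] := pselect (N `<=` P); first by exists c => //; apply: sNP.
case: (lN) => sND aN lNN.
have [t [It nNt]] : exists t, I t /\ exists2 m, N m & ~ Lam (m * t).
  apply: contrapT => /forallNP H; apply: nNP => m Nm; split; first exact: sNL.
  by move=> t It; apply: contrapT => nL; apply: (H t); split=> //; exists m.
pose Nt := [set x | exists2 m, N m & x = m * t].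
have lNt : lsub Nt.
  split.
  - by move=> _ [m /sND Dm ->]; apply: DM => //; apply: sID.
  - split; first by exists 0; rewrite ?mul0r //; case: aN.
    move=> _ _ [x Nx ->] [y Ny ->]; exists (x - y); rewrite ?mulrBl //.
    by case: aN => _; apply.
  - by move=> l _ Ll [m Nm ->]; exists (l * m); rewrite ?mulrA //; apply: lNN.
have INt : I `<=` setadd Lam Nt.
  apply: simI' => //; first by move=> _ [m /sNL Lm ->]; apply: LI.
  by case: nNt => m Nm nmt /(_ (m * t)) H; apply: nmt; apply: H; exists m.
pose CNt := [set x | exists2 m, setmul C N m & x = m * t].
have aCN := setmul_additive C N.
have ICNt : I `<=` setadd Lam CNt.
  have aCNt : additive_set CNt.
    split; first by exists 0; rewrite ?mul0r //; case: aCN.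
    move=> _ _ [x Nx ->] [y Ny ->]; exists (x - y); rewrite ?mulrBl //.
    by case: aCN => _; apply.
  have aS := setadd_additive aL aCNt.
  move=> x /(lift_nsub tC nCP)[y Ly]; rewrite -{2}(subrK y x) => Hxy.
  apply: additiveD => //; last by apply: setaddl => //; case: aCNt.
  move: Hxy; move: (x - y); apply: setmul_sub => // a b Ca /INt[z Lz [m Nm ebz]].
  rewrite -(subrK z b) mulrDr ebz; apply: additiveD => //.
    apply: setaddr => //; exists (a * m); rewrite ?mulrA //.
    exact: setmul_in.
  apply: setaddl; first by case: aCNt.
  by apply: LM => //; apply: sC.
(* This writes (1 - c) t as y + m t with y in Lam and m in C N. Hence 1 - (c + m) annihilates t
   modulo Lam, and c + m replaces c for the smaller ideal N'. *)
have [y Ly [m CNm em]] := ICNt _ (LI (sNL _ Nc) It).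
have Cm : C m.
  by move: m CNm {em}; apply: setmul_sub => // a b Ca /sNL Lb; apply: rC.
have Nm : N m.
  by move: m CNm {em Cm}; apply: setmul_sub => // a b /sC La Nb; apply: lNN.
pose N' := [set x | N x /\ Lam (x * t)].
have sN'N : N' `<=` N by move=> x [].
have lN' : lsub N'.
  split.
  - by move=> x [/sND].
  - split; first by split; rewrite ?mul0r //; case: aN.
    move=> x1 x2 [N1 L1'] [N2 L2']; split; first by case: aN => _; apply.
    by rewrite mulrBl; apply: LB.
  - by move=> l x Ll [Nx Lx]; split; [apply: lNN|rewrite -mulrA; apply: LM].
have sPN' : P `<=` N'.
  by move=> x Px; split; [apply: sPN|case: Px => _; apply].
have bN' : bounded e0 N'.
  split=> x; last by move/sN'N/sNL=> Lx; apply: LM.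
  by move=> Lx; apply: sPN'; apply: rP.
have ltN' : (mu N' < mu N)%N.
  apply: Hmu => //; case: nNt => m' Nm' nL sNN'; apply: nL.
  by case: (sNN' _ Nm').
apply: (IHn N') => //.
- exact: leq_trans ltN' ltn.
- by move=> x /sN'N/sNL.
exists (c + m); first exact: additiveD.
rewrite opprD addrA; split; first by case: aN => _; apply.
by rewrite mulrBl -em subKr.
Qed.

(** If the two-sided ideal Q P were inside P, then Q would multiply P into P and lie in Lam by
    [stabl], against [nQL]. So Q P is comaximal with P by [comax]; and P is inside Q P, as 1 is in
    Q. *)
Let QP1 : setmul Q P 1.
Proof.
have tQP : twosided (setmul Q P).
  have sQPL : setmul Q P `<=` Lam by apply: setmul_sub => // a b [_]; apply.
  have [_ aQP lQP] : lsub (setmul Q P).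
    by apply: lsub_setmul => // x /sPL/sLD.
  split=> // l x Ll; move: x; apply: setmul_sub.
    split; first by rewrite mul0r; case: aQP.
    by move=> x y Hx Hy; rewrite mulrBl; case: aQP => _; apply.
  by move=> a b Qa Pb; rewrite -mulrA; apply: setmul_in => //; apply: rP.
have nQP : ~ (setmul Q P `<=` P).
  move=> sQP; apply: nQL => d Qd; apply: stabl; first exact: sQD.
  by move=> x Px; apply: sQP; exact: setmul_in.
have [c Qc Pc] := comax tQP nQP.
rewrite -(subrK c 1); apply: additiveD => //; first exact: setmul_additive.
by rewrite -[_ - _]mul1r; apply: setmul_in.
Qed.

Let PQ1 : setmul P Q 1.
Proof.
have tPQ : twosided (setmul P Q).
  have sPQL : setmul P Q `<=` Lam by apply: setmul_sub.
  have [_ aPQ lPQ] : lsub (setmul P Q).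
    by apply: lsub_setmul => // x /sPL/sLD.
  split=> // l x Ll; move: x; apply: setmul_sub.
    split; first by rewrite mul0r; case: aPQ.
    by move=> x y Hx Hy; rewrite mulrBl; case: aPQ => _; apply.
  by move=> a b Pa Qb; rewrite -mulrA; apply: setmul_in => //; apply: rQ.
have nPQ : ~ (setmul P Q `<=` P).
  move=> sPQ; apply: nQL => d Qd; apply: stabr; first exact: sQD.
  by move=> x Px; apply: sPQ; exact: setmul_in.
have [c Qc Pc] := comax tPQ nPQ.
rewrite -(subrK c 1); apply: additiveD => //; first exact: setmul_additive.
by rewrite -[_ - _]mulr1; apply: setmul_in.
Qed.

(* Dividing q Lam by P as long as possible: q Lam contains P^k A with A not   *)
(* in P; the exponent k is hidden in the closure of G under products.         *)
Let cofactor_ideal : exists A, [/\ twosided A, ~ (A `<=` P) &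
  forall G : set R -> Prop, (forall J J', twosided J -> twosided J' -> G J ->
      G J' -> forall J'', setmul J J' `<=` J'' -> G J'') ->
    G P -> G A -> G [set x | exists2 l, Lam l & x = q * l]].
Proof.
have [mu Hmu] := len e0.
have tbound J : twosided J -> J q -> bounded e0 J.
  move=> [sJ aJ lJ rJ] Jq; split=> x Hx; first exact: rJ.
  by apply: LM => //; apply: sJ.
suff H n (A0 : set R) : (mu Lam - mu A0 < n)%N -> twosided A0 -> A0 q ->
    exists A, [/\ twosided A, ~ (A `<=` P) &
  forall G : set R -> Prop, (forall J J', twosided J -> twosided J' -> G J ->
      G J' -> forall J'', setmul J J' `<=` J'' -> G J'') ->
    G P -> G A -> G A0].
  pose qL := [set x | exists2 l, Lam l & x = q * l].
  apply: (H (mu Lam - mu qL).+1 qL) => //.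
    split.
    - by move=> _ [l Ll ->]; apply: LM.
    - split; first by exists 0; rewrite ?mulr0.
      by move=> _ _ [l Ll ->] [m Lm ->]; exists (l - m); rewrite ?mulrBr //; apply: LB.
    - move=> l _ Ll [m Lm ->]; exists (l * m); first exact: LM.
      by rewrite !mulrA pXC //; apply: sLD.
    - by move=> l _ Ll [m Lm ->]; exists (m * l); rewrite ?mulrA //; apply: LM.
  by exists 1; rewrite ?mulr1.
elim: n A0 => // n IHn A0 ltn tA0 A0q.
have [sAP|nAP] := pselect (A0 `<=` P); last by exists A0.
case: (tA0) => sA aA lA rA.
(* Division of A0 by P. The product P A1 lies in A0, and A1 is strictly larger than A0, since
   otherwise Q would consist of multipliers of A0 and lie in Lam. *)
pose A1 := setmul Q A0.
have sA01 : A0 `<=` A1 by move=> x Ax; rewrite -[x]mul1r; apply: setmul_in.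
have sA1L : A1 `<=` Lam by apply: setmul_sub => // a b [_ Hd] /sAP; apply: Hd.
have tA1 : twosided A1.
  have [_ aA1 lA1] : lsub A1 by apply: lsub_setmul => // x /sA/sLD.
  split=> // l x Ll; move: x; apply: setmul_sub.
    split; first by rewrite mul0r; case: aA1.
    by move=> x y Hx Hy; rewrite mulrBl; case: aA1 => _; apply.
  by move=> a b Qa Ab; rewrite -mulrA; apply: setmul_in => //; apply: rA.
have nA10 : ~ (A1 `<=` A0).
  move=> sA10; apply: nQL => d Qd; apply: (twosided_stab_l tA0 A0q); first exact: sQD.
  by move=> x Ax; apply: sA10; exact: setmul_in.
have ltA : (mu A0 < mu A1)%N.
  by apply: Hmu => //; [exact: twosided_lsub|exact: twosided_lsub|exact: tbound|
    apply: tbound => //; exact: sA01].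
have leA : (mu A0 < mu Lam)%N.
  have [sLA1|nLA1] := pselect (Lam `<=` A1).
    by rewrite (_ : Lam = A1) //; apply/seteqP.
  apply: ltn_trans ltA _; apply: Hmu => //; first exact: twosided_lsub.
    by apply: tbound => //; exact: sA01.
  by apply: tbound; [split=> // l x *; exact: LM|exact: pXL].
have [||A [tA nA HG]] := IHn A1 _ tA1; [lia | exact: sA01 |].
exists A; split=> // G Gmul GP GA.
apply: (Gmul P A1) => //; first exact: HG.
apply: setmul_sub => // l x Pl; move: x; apply: setmul_sub.
  split; first by rewrite mulr0; case: aA.
  by move=> x y Hx Hy; rewrite mulrBr; case: aA => _; apply.
by move=> d x Qd Ax; rewrite mulrA; apply: lA => //; apply: PQ.
Qed.

Let PI := setmul P I.
Let lPI : lsub PI. Proof. by case: (mulI_sub tP). Qed.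
Let sPIL : PI `<=` Lam. Proof. by apply: setmul_sub => // a b [_]; apply. Qed.
Let sPPI : P `<=` PI. Proof. by move=> x Px; rewrite -[x]mulr1; apply: setmul_in. Qed.
Let aPI : additive_set PI. Proof. exact: setmul_additive. Qed.

(** Since P is invertible with inverse Q, multiplication by Q takes the left submodules between P
    and P I to those between Lam and I, and multiplication by P takes them back. So P I / P inherits
    simplicity from I / Lam. *)
Let simPI N : lsub N -> P `<=` N -> N `<=` PI -> N `<=` P \/ PI `<=` N.
Proof.
move=> lN sPN sNPI; case: (lN) => sND aN lNN.
have lQN : lsub (setmul Q N) by apply: lsub_setmul.
have sLQN : Lam `<=` setmul Q N.
  move=> l Ll; rewrite -[l]mulr1; case: lQN => _ _; apply=> //.
  by move: {+}1 QP1; apply: setmul_sub => [|d x Qd Px]; [exact: setmul_additive|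
    apply: setmul_in => //; apply: sPN].
have sQNI : setmul Q N `<=` I.
  apply: setmul_sub => // d x Qd /sNPI; move: x; apply: setmul_sub.
    split; first by rewrite mulr0; case: aI.
    by move=> x y Hx Hy; rewrite mulrBr; case: aI => _; apply.
  by move=> l x Pl Ix; rewrite mulrA; apply: LI => //; case: Qd => _; apply.
have [sQNL|sIQN] := simI lQN sLQN sQNI; [left|right].
  move=> x Nx; rewrite -[x]mul1r; move: {+}1 PQ1; apply: setmul_sub.
    split; first by rewrite mul0r; case: aP.
    by move=> a b Ha Hb; rewrite mulrBl; case: aP => _; apply.
  by move=> l d Pl Qd; rewrite -mulrA; apply: rP => //; apply: sQNL; exact: setmul_in.
apply: setmul_sub => // l x Pl /sIQN; move: x; apply: setmul_sub.
  split; first by rewrite mulr0; case: aN.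
  by move=> x y Hx Hy; rewrite mulrBr; case: aN => _; apply.
by move=> d x Qd Nx; rewrite mulrA; apply: lNN => //; apply: PQ.
Qed.

Let simPI' N : lsub N -> N `<=` PI -> ~ (N `<=` P) -> PI `<=` setadd P N.
Proof.
move=> lN sNI nNL; have lPN := lsub_setadd (twosided_lsub tP) lN.
have N0 : N 0 by case: lN => _ [].
have [||sL|//] := simPI lPN.
- by move=> x Lx; apply: setaddl.
- by move=> x [y Ly Nxy]; rewrite -(subrK y x); apply: additiveD => //; [apply: sNI|apply: sPPI].
- by case: nNL => x Nx; apply: sL; apply: setaddr => //; case: aP.
Qed.

Let nPIP : ~ (PI `<=` P).
Proof.
move=> sPI; apply: nIL => x Ix; apply: stabr; first exact: sID.
by move=> l Pl; apply: sPI; exact: setmul_in.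
Qed.

(** If (P I)(P I) were inside P, multiplication by Q from the left would give I (P I) inside Lam.
    Then every element of I would multiply P into P, and I would lie in Lam by [stabl]. *)
Let PI_sq : exists2 a, PI a & exists2 x, PI x & ~ P (x * a).
Proof.
apply: contrapT => H.
have {}H x y : PI x -> PI y -> P (x * y).
  by move=> Px Py; apply: contrapT => nP; apply: H; exists y => //; exists x.
have IPI x y : I x -> PI y -> Lam (x * y).
  move=> Ix Py; rewrite -[x]mul1r; move: {+}1 QP1; apply: setmul_sub.
    split; first by rewrite !mul0r.
    by move=> a b Ha Hb; rewrite !mulrBl; apply: LB.
  move=> d l Qd Pl; rewrite -!mulrA; case: (Qd) => _; apply; rewrite mulrA.
  by apply: H => //; apply: setmul_in.
apply: nIL => x Ix; apply: stabl; first exact: sID.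
move=> l Pl; split.
  by rewrite -[x * l]mulr1 -mulrA; apply: IPI => //; rewrite mulr1; apply: sPPI.
by move=> z Iz; rewrite -mulrA; apply: IPI => //; apply: setmul_in.
Qed.

(** Brauer's lemma in Lam / P. The minimal left ideal P I / P has nonzero square, so right
    multiplication by some a in it is injective on it, and an e with e a congruent to a is
    idempotent modulo P. The left ideal Y = A (P I) already fills P I modulo P, so e can be chosen
    in Y and thereby in A. *)
Let idempotent A : twosided A -> ~ (A `<=` P) ->
  exists e, [/\ A e, PI e, P (e * e - e) & ~ P e].
Proof.
move=> tA nAP; case: (tA) => sA aA lA rA.
pose Y := setmul A PI.
have sYA : Y `<=` A by apply: setmul_sub => // a x Aa /sPIL Lx; exact: rA.
have sYPI : Y `<=` PI.
  by apply: setmul_sub => // a x /sA La; case: lPI => _ _; apply.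
have aY : additive_set Y by exact: setmul_additive.
have lY : lsub Y.
  by apply: lsub_setmul => // x; [move/sA/sLD|case: lPI => sD _ _ /sD].
have nYP : ~ (Y `<=` P).
  move=> sYP; apply: (nJI tA nAP); apply: setmul_sub => // a x Aa Ix.
  have tPIs : lsub (setmul PI I).
    by apply: lsub_setmul => //; case: lPI.
  have [||y Ly] := @simI' (setmul PI I) tPIs _ _ x Ix.
  - by apply: setmul_sub => // u z /sPIL Lu; apply: LI.
  - move=> s; apply: nPIP => u PIu; split; first exact: sPIL.
    by move=> z Iz; apply: s; exact: setmul_in.
  move=> Hxy; rewrite -(subrK y x) mulrDr; apply: LD; last first.
    by apply: LM => //; apply: sA.
  move: (x - y) Hxy; apply: setmul_sub.
    split; first by rewrite mulr0.
    by move=> u w Hu Hw; rewrite mulrBr; apply: LB.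
  move=> u z PIu Iz; rewrite mulrA.
  have [|_] := sYP (a * u); first exact: setmul_in.
  exact.
have PIY := simPI' lY sYPI nYP.
have [a PIa [x0 PIx0 nPx0a]] := PI_sq.
have La := sPIL PIa.
pose Ya := [set x | exists2 y, Y y & x = y * a].
have lYa : lsub Ya.
  split.
  - by move=> _ [y /sYA/sA/sLD Dy ->]; apply: DM => //; apply: sLD.
  - split; first by exists 0; rewrite ?mul0r //; case: aY.
    move=> _ _ [x Nx ->] [y Ny ->]; exists (x - y); rewrite ?mulrBl //.
    by case: aY => _; apply.
  - move=> l _ Ll [m Nm ->]; exists (l * m); rewrite ?mulrA //.
    by case: lY => _ _; apply.
have sYaPI : Ya `<=` PI.
  by move=> _ [y /sYA/sA Ly ->]; case: lPI => _ _; apply.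
have nYaP : ~ (Ya `<=` P).
  move=> sYaP; apply: nPx0a; have [y Py Yxy] := PIY _ PIx0.
  rewrite -(subrK y x0) mulrDl; apply: additiveD => //; last exact: rP.
  by apply: sYaP; exists (x0 - y).
have [y Py [e Ye ea]] := simPI' lYa sYaPI nYaP PIa.
have PIe := sYPI _ Ye; have Le := sPIL PIe.
have ker z : PI z -> P (z * a) -> P z.
  pose N := [set z | PI z /\ P (z * a)].
  have lN : lsub N.
    split.
    - by move=> u [/sPIL/sLD].
    - split; first by split; rewrite ?mul0r; [case: aPI|case: aP].
      move=> u w [Nu Pu] [Nw Pw]; split; first by case: aPI => _; apply.
      by rewrite mulrBl; case: aP => _; apply.
    - move=> l u Ll [Nu Pu]; split; first by case: lPI => _ _; apply.
      by rewrite -mulrA; apply: lP.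
  have [||sNP|sPIN] := simPI lN.
  - by move=> u Pu; split; [apply: sPPI|apply: rP].
  - by move=> u [].
  - by move=> PIz Pza; apply: sNP.
  - by case: nPx0a; case: (sPIN _ PIx0).
have eay : e * a = a - y by [].
exists e; split=> //; first exact: sYA.
- apply: ker.
    by case: aPI => _; apply=> //; case: lPI => _ _; apply.
  rewrite mulrBl -mulrA eay mulrBr eay addrAC subrr sub0r.
  by apply: additiveN => //; apply: lP.
- move=> Pe; apply: nPx0a; apply: lP; first exact: sPIL.
  by rewrite -(subrK y a) -eay; apply: additiveD => //; apply: rP.
Qed.

(** The element b below satisfies I = Lam b + J I for J = P and for J = A. This relation passes to
    products of ideals, hence to q Lam by [cofactor_ideal], and iterates to I = Lam b + q^j I; for
    large j the last term is inside Lam b. *)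
Lemma simple_ext_principal : exists2 b, D b /\ b != 0 &
  forall x, I x <-> exists2 l, Lam l & x = l * b.
Proof.
have [A [tA nAP HG]] := cofactor_ideal.
have [e [Ae PIe Pe nPe]] := idempotent tA nAP.
case: (tA) => sA aA lA rA.
have Le := sA _ Ae.
have [t It nLet] : exists2 t, I t & ~ Lam (e * t).
  apply: contrapT => H; apply: nPe; split=> // x Ix.
  by apply: contrapT => nL; apply: H; exists x.
(* Modulo A I this is 1, since e lies in A. Modulo P I it reduces to 1 after multiplication by 1 -
   e, and to e t after multiplication by e, since e is in P I and idempotent modulo P. The element e
   t is outside Lam. *)
pose b := 1 - e + e * t.
have Ib : I b by apply: additiveD => //; [apply/sLI/LB|apply: LI].
have Db : D b by exact: sID.
pose Lb := [set x | exists2 l, Lam l & x = l * b].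
have lLb : lsub Lb by exact: lsub_princ.
have sLbI : Lb `<=` I by move=> _ [l Ll ->]; apply: LI.
(* The hypothesis of Nakayama's lemma for the ideal J, in the form handed to [cofactor_ideal]. *)
pose G (J : set R) := I `<=` setadd Lb (setmul J I).
have GE (J : set R) : twosided J -> lsub (setadd Lb (setmul J I)) /\
    setadd Lb (setmul J I) `<=` I.
  move=> tJ; have [lJI sJI] := mulI_sub tJ; split; first exact: lsub_setadd.
  move=> x [y Ly Hxy]; rewrite -(subrK y x); apply: additiveD => //.
    exact: sJI.
  exact: sLbI.
have Lb0 : Lb 0 by exists 0; rewrite ?mul0r.
have GJ (J : set R) : twosided J -> setadd Lb (setmul J I) 1 ->
    (exists2 x, setadd Lb (setmul J I) x & ~ Lam x) -> G J.
  move=> tJ N1 [x Nx nLx]; have [lN sN] := GE _ tJ.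
  have [||s|//] := simI lN => //.
    by move=> l Ll; rewrite -[l]mulr1; case: lN => _ _; apply.
  by case: nLx; apply: s.
have J0 (J : set R) : setmul J I 0 by case: (setmul_additive J I).
have Pe' : P (e - e * e) by rewrite -opprB; apply: additiveN.
have Dt := sID It; have De := sLD Le.
have kE : (1 - e) * e = e - e * e by rewrite mulrBl mul1r.
have GP : G P.
  have [[_ aN lN] sN] := GE _ tP.
  apply: GJ => //.
    exists ((1 - e) * b); first by exists (1 - e) => //; apply: LB.
    have -> : 1 - (1 - e) * b = e + (e - e * e) - (e - e * e) * t.
      have -> : (1 - e) * b = 1 - (e + (e - e * e)) + (e - e * e) * t.
        by rewrite /b mulrDr mulrBr mulr1 mulrA kE; move: (e - e * e) => k; rewrite opprD addrA.
      by rewrite opprD opprB addrA [1 + _]addrC subrK.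
    case: (aPI) => _; apply; last exact: setmul_in.
    by apply: additiveD => //; apply: sPPI.
  exists (e * t) => //; exists (e * b); first by exists e.
  have -> : e * t - e * b = (e - e * e) * t - (e - e * e).
    rewrite /b mulrDr mulrBr mulr1 mulrA mulrBl.
    by move: (e * t) (e * e * t) (e - e * e) => u w k; rewrite opprD addrA addrAC.
  by case: (aPI) => _; apply; [exact: setmul_in|exact: sPPI].
have GA : G A.
  have [[_ aN lN] sN] := GE _ tA.
  apply: GJ => //.
    exists b; first by exists 1; rewrite ?mul1r.
    have -> : 1 - b = e - e * t.
      by rewrite /b opprD opprB addrA [1 + _]addrC subrK.
    case: (setmul_additive A I) => _; apply; last exact: setmul_in.
    by rewrite -[e]mulr1; apply: setmul_in.
  apply: contrapT => H; apply: (nJI tA nAP) => x Hx.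
  by apply: contrapT => nLx; apply: H; exists x => //; apply: setaddr.
have b_step : G [set x | exists2 l, Lam l & x = q * l].
  apply: HG => // J J' tJ tJ' GJ1 GJ2 J'' sJ x /GJ1[y Ly Hxy].
  rewrite -(subrK y x).
  have [lN sN] := GE _ tJ.
  have lR : additive_set (setadd Lb (setmul J'' I)).
    by apply: setadd_additive; [case: lLb|exact: setmul_additive].
  apply: additiveD => //; last exact: setaddl.
  move: (x - y) Hxy; apply: setmul_sub => // a z Ja /GJ2[w [l Ll ew] Hzw].
  rewrite -(subrK w z) mulrDr; case: (tJ) => sJL aJ _ rJ.
  apply: additiveD => //; last first.
    by apply: setaddl => //; exists (a * l); rewrite ?ew ?mulrA //; apply: LM; [exact: sJL|].
  apply: setaddr => //; move: (z - w) Hzw; apply: setmul_sub.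
    split; first by rewrite mulr0; case: (setmul_additive J'' I).
    by move=> u u' Hu Hu'; rewrite mulrBr; case: (setmul_additive J'' I) => _; apply.
  by move=> c z' J'c Iz'; rewrite mulrA; apply: setmul_in => //; apply: sJ; exact: setmul_in.
have q_step x : I x -> exists2 y, I y & Lb (x - q * y).
  move=> /b_step[y Ly Hxy].
  suff [z Iz ez] : exists2 z, I z & x - y = q * z by exists z => //; rewrite -ez opprB addrC subrK.
  move: (x - y) Hxy; apply: setmul_sub.
    split; first by exists 0; rewrite ?mulr0 //; case: aI.
    move=> _ _ [u Iu ->] [w Iw ->]; exists (u - w); rewrite ?mulrBr //.
    by case: aI => _; apply.
  by move=> _ z [l Ll ->] Iz; exists (l * z); rewrite ?mulrA //; apply: LI.
have b0 : b != 0.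
  apply/eqP=> b0; apply: nIL => x /q_step[y Iy [l _]].
  by rewrite b0 mulr0 => /eqP; rewrite subr_eq0 => /eqP ->; apply: qI.
have qj_step j x : I x -> exists2 y, I y & Lb (x - q ^+ j * y).
  move=> Ix; elim: j => [|j [y Iy Hxy]].
    by exists x => //; rewrite mul1r subrr.
  have [z Iz Hyz] := q_step _ Iy; exists z => //.
  have -> : x - q ^+ j.+1 * z = (x - q ^+ j * y) + q ^+ j * (y - q * z).
    by rewrite mulrBr addrA subrK mulrA -exprSr.
  apply: additiveD => //; first by case: lLb.
  by case: lLb => _ _; apply=> //; rewrite -exprM.
have [b' [Db' bb' b'b]] := Dinv Db b0.
have [j Hj] := clear Db'.
exists b => // x; split=> [Ix|[l Ll ->]]; last exact: LI.
have [y Iy [l Ll el]] := qj_step j.+1 _ Ix.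
have Dy := sID Iy.
suff [m Lm em] : Lb (q ^+ j.+1 * y).
  exists (l + m); first exact: LD.
  by rewrite mulrDl -el -em subrK.
have [e00|e0_gt0] := posnP e0.
  by case: nIL => z Iz; have := qI Iz; rewrite e00 expr0 mul1r.
(* The factor q y is integral because y is in I; q^j b^-1 is integral because p^j b^-1 is, and e0 >
   0 makes q^j a multiple of p^j. *)
exists ((q * y) * (q ^+ j * b')).
  apply: LM; first exact: qI.
  rewrite -exprM (_ : (e0 * j = (e0 * j - j) + j)%N); last first.
    by rewrite subnK // leq_pmull.
  by rewrite exprD -mulrA; apply: LM.
rewrite -!mulrA b'b mulr1 exprS -!mulrA; congr (_ * _).
by rewrite -exprM pXC.
Qed.

End SimpleExtension.

(** One climbs from the ideal generated by [p ^+ e]. Above a principal ideal Lam a inside M take N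
    strictly larger of least length. Then N a^-1 is a simple extension of Lam, hence equal to some
    Lam b, and N = Lam b a is principal again; the length bounds the number of steps. *)
Lemma principal M e : lsub M -> bounded e M ->
  exists2 a, D a /\ a != 0 & forall x, M x <-> exists2 l, Lam l & x = l * a.
Proof.
move=> lM bM; have [mu Hmu] := len e; case: (lM) => sMD aM lMM.
pose Lp a := [set x | exists2 l, Lam l & x = l * a].
have bnd a N : (exists2 l, Lam l & p ^+ e = l * a) -> Lp a `<=` N -> N `<=` M -> bounded e N.
  move=> [l Ll el] sN sNM; split=> x Hx; last by case: bM => _; apply; apply: sNM.
  apply: sN; exists (x * l); first exact: LM.
  by rewrite -mulrA -el pXC //; apply: sLD.
suff H n a : (mu M - mu (Lp a) < n)%N -> D a -> Lp a (p ^+ e) -> M a ->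
    exists2 a, D a /\ a != 0 & forall x, M x <-> exists2 l, Lam l & x = l * a.
  apply: (H (mu M - mu (Lp (p ^+ e))).+1 (p ^+ e)) => //.
  - by apply: sLD; apply: pXL.
  - by exists 1; rewrite ?mul1r.
  - by rewrite -[p ^+ e]mulr1; case: bM => H1 _; apply: H1.
elim: n a => // n IHn a ltn Da Lpa Ma.
have sLpM : Lp a `<=` M by move=> _ [l Ll ->]; apply: lMM.
have a0 : a != 0.
  by apply/eqP=> a0; case: Lpa => l _; rewrite a0 mulr0; apply/eqP.
have [sMLp|nMLp] := pselect (M `<=` Lp a).
  by exists a => // x; split=> [/sMLp//|]; apply: sLpM.
have lLp : lsub (Lp a) by exact: lsub_princ.
have [N [lN sLpN sNM nNLp] Nmin] : exists2 N, [/\ lsub N, Lp a `<=` N, N `<=` M &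
    ~ (N `<=` Lp a)] & forall N', [/\ lsub N', Lp a `<=` N', N' `<=` M &
    ~ (N' `<=` Lp a)] -> (mu N <= mu N')%N.
  by apply: (@exists_minimizer _ _ mu); exists M; split.
have [a' [Da' aa' a'a]] := Dinv Da a0.
have aK x : x * a * a' = x by rewrite -mulrA aa' mulr1.
have aVK x : x * a' * a = x by rewrite -mulrA a'a mulr1.
have [sND aN lNN] := lN.
have bN := bnd a N Lpa sLpN sNM.
have bLp : bounded e (Lp a) by apply: (bnd a).
pose I := [set x | N (x * a)].
have [k Hk] := clear Da'.
have lI : lsub I.
  split.
  - by move=> x /sND Dxa; rewrite -(aK x); apply: DM.
  - split; first by rewrite /I /= mul0r; case: aN.
    by move=> x y Hx Hy; rewrite /I /= mulrBl; case: aN => _; apply.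
  - by move=> l x Ll Ix; rewrite /I /= -mulrA; apply: lNN.
have sLI : Lam `<=` I by move=> l Ll; apply: sLpN; exists l.
have nIL : ~ (I `<=` Lam).
  move=> sIL; apply: nNLp => y Ny; exists (y * a'); rewrite ?aVK //.
  by apply: sIL; rewrite /I /= aVK.
have simI N' : lsub N' -> Lam `<=` N' -> N' `<=` I -> N' `<=` Lam \/ I `<=` N'.
  move=> [sND' aN' lN'] sLN' sN'I; apply: contrapT => /not_orP[nL nI].
  pose N2 := [set y | D y /\ N' (y * a')].
  have lN2 : lsub N2.
    split.
    - by move=> y [].
    - split; first by split; rewrite ?mul0r //; case: aN'.
      move=> x y [Dx Hx] [Dy Hy]; split; first exact: DB.
      by rewrite mulrBl; case: aN' => _; apply.
    - move=> l x Ll [Dx Hx]; split; first by apply: DM => //; apply: sLD.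
      by rewrite -mulrA; apply: lN'.
  have sN2N : N2 `<=` N by move=> y [_ /sN'I]; rewrite /I /= aVK.
  have sLpN2 : Lp a `<=` N2.
    move=> _ [l Ll ->]; split; first by apply: DM => //; apply: sLD.
    by rewrite aK; apply: sLN'.
  have sN2M : N2 `<=` M by move=> y /sN2N/sNM.
  have : (mu N2 < mu N)%N.
    apply: Hmu => //; first exact: (bnd a).
    move=> sNN2; apply: nI => x Ix; rewrite -(aK x).
    by have [] := sNN2 _ Ix.
  rewrite ltnNge Nmin //; split=> // sN2Lp; apply: nL => x N'x.
  have [|l Ll /(congr1 (fun z => z * a'))] := sN2Lp (x * a).
    by split; [apply: DM => //; apply: sND'|rewrite aK].
  by rewrite !aK => ->.
have qI x : I x -> Lam (p ^+ (e + k) * x).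
  move=> Ix; have Dx : D x by case: lI => s _ _; apply: s.
  rewrite -(aK x) exprD -mulrA [p ^+ k * _]mulrA (pXC k (DM Dx Da)).
  rewrite -mulrA mulrA; apply: LM => //.
  by case: bM => _; apply; apply: sNM.
have [b [Db b0] Hb] := simple_ext_principal lI sLI nIL simI qI.
have Dba : D (b * a) by apply: DM.
have eN : Lp (b * a) = N.
  apply/seteqP; split=> [_ [l Ll ->]|y Ny].
    by rewrite mulrA; apply/Hb; exists l.
  have /Hb[l Ll el] : I (y * a') by rewrite /I /= aVK.
  by exists l => //; rewrite mulrA -el aVK.
apply: (IHn (b * a)) => //; rewrite ?eN.
- have lt1 : (mu (Lp a) < mu N)%N by apply: Hmu.
  have le2 : (mu N <= mu M)%N.
    have [sMN|nMN] := pselect (M `<=` N).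
      by rewrite (_ : M = N) //; apply/seteqP.
    by apply: ltnW; apply: Hmu.
  by move: ltn lt1 le2; clear; lia.
- exact: sLpN.
- by apply: sNM; rewrite -eN; exists 1; rewrite ?mul1r.
Qed.

Definition lscale n (a : R) (x : {ffun 'I_n -> R}) : {ffun 'I_n -> R} :=
  [ffun k => a * x k].

(* Project V to its last coordinates: each projection is a left ideal, hence *)
(* principal, and the basis is triangular.                                    *)
Lemma triangular_basis n (V : set {ffun 'I_n -> R}) e :
  (forall x k, V x -> D (x k)) -> V 0 -> (forall x y, V x -> V y -> V (x - y)) ->
  (forall l x, Lam l -> V x -> V (lscale l x)) ->
  (forall l j, Lam l -> V [ffun k => if k == j then p ^+ e * l else 0]) ->
  (forall x k, V x -> Lam (p ^+ e * x k)) ->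
  exists w : 'I_n -> {ffun 'I_n -> R},
    [/\ forall j, V (w j), forall j k : 'I_n, (j < k)%N -> w j k = 0,
        forall j, w j j != 0 &
        forall x, V x -> exists2 c : 'I_n -> R, (forall j, Lam (c j)) &
          x = \sum_j lscale (c j) (w j)].
Proof.
move=> VD V0 VB VL Vin Vout.
pose Vj (j : nat) := [set x | V x /\ forall k : 'I_n, (j < k)%N -> x k = 0].
have Hw (j : 'I_n) : exists wj : {ffun 'I_n -> R}, Vj j wj /\ wj j != 0 /\
    forall x, Vj j x -> exists2 l, Lam l & x j = l * wj j.
  pose I := [set y | exists2 x, Vj j x & y = x j].
  have [||a [Da a0] Ha] := @principal I e.
  - split.
    + by move=> _ [x [Vx _] ->]; apply: VD.
    + split; first by exists 0; rewrite ?ffunE //; split=> // k _; rewrite ffunE.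
      move=> _ _ [x [Vx Hx] ->] [y [Vy Hy] ->]; exists (x - y); rewrite ?ffunE //.
      by split; [apply: VB|move=> k jk; rewrite !ffunE Hx ?Hy ?subrr].
    + move=> l _ Ll [x [Vx Hx] ->]; exists (lscale l x); rewrite ?ffunE //.
      by split; [apply: VL|move=> k jk; rewrite ffunE Hx ?mulr0].
  - split.
      move=> l Ll; exists [ffun k => if k == j then p ^+ e * l else 0].
        by split; [apply: Vin|move=> k jk; rewrite ffunE; case: eqP jk => // ->; rewrite ltnn].
      by rewrite ffunE eqxx.
    by move=> _ [x [Vx _] ->]; apply: Vout.
  have [|w Hwj ea] := (Ha a).2; first by exists 1; rewrite ?mul1r.
  by exists w; rewrite -?ea //; split=> //; split=> // x Hx; apply/Ha; exists x.
have [w Hw1] := choice Hw.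
have wV j : V (w j) by have [[]] := Hw1 j.
exists w; split=> //; [by move=> j; have [[]] := Hw1 j|by move=> j; have [_ []] := Hw1 j|].
suff H m x : (m <= n)%N -> V x -> (forall k : 'I_n, (m <= k)%N -> x k = 0) ->
    exists2 c : 'I_n -> R, (forall j, Lam (c j)) & x = \sum_j lscale (c j) (w j).
  move=> x Vx; apply: (H n) => // k; by rewrite leqNgt ltn_ord.
elim: m x => [|m IHm] x le_mn Vx Hx.
  exists (fun=> 0) => //; apply/ffunP=> k; rewrite Hx // sum_ffunE big1 // => j _.
  by rewrite ffunE mul0r.
pose j := Ordinal le_mn.
have [[_ wj0] [_ Hj]] := Hw1 j.
have [l Ll el] : exists2 l, Lam l & x j = l * w j j by apply: Hj.
have Vy : V (x - lscale l (w j)) by apply: VB => //; apply: VL.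
have [k le_mk|c Lc ec] := IHm _ (ltnW le_mn) Vy.
  rewrite !ffunE; move: le_mk; rewrite leq_eqVlt => /orP[/eqP emk|lt_mk].
    by rewrite (_ : k = j) ?el ?subrr //; apply/val_inj.
  by rewrite Hx // wj0 // mulr0 subrr.
exists (fun i => c i + if i == j then l else 0).
  by move=> i; apply: LD => //; case: eqP.
rewrite (eq_bigr (fun i => lscale (c i) (w i) + if i == j then lscale l (w i) else 0)).
  by rewrite big_split /= -big_mkcond big_pred1_eq -ec subrK.
move=> i _; apply/ffunP=> k; rewrite !ffunE; case: eqP => _; rewrite ?ffunE ?addr0 //.
exact: mulrDl.
Qed.

End MaximalOrder.

(** * Finitely generated spanning submodules as row lattices *)

Section FinGen.

Variables (K : fieldType) (S : set K) (pi : K) (v : K -> int).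
Hypothesis hS : is_dvr S pi v.
Variable W : lmodType K.

Lemma fin_gen_submod (M : set W) : fin_gen S M -> is_submod S M.
Proof.
case=> m [w ->]; split.
- exists (fun=> 0); split; first by move=> j; apply: (dvr0 hS).
  by rewrite big1 // => j _; rewrite scale0r.
- move=> _ _ [c [Sc ->]] [d [Sd ->]]; exists (fun j => c j + d j); split.
    by move=> j; apply: (dvrDS hS).
  by rewrite -big_split; apply: eq_bigr => j _; rewrite scalerDl.
- move=> a _ Sa [c [Sc ->]]; exists (fun j => a * c j); split.
    by move=> j; apply: (dvrMS hS).
  by rewrite scaler_sumr; apply: eq_bigr => j _; rewrite scalerA.
Qed.

Lemma spans_clear (M U : set W) u : is_submod S M -> spans M U -> U u ->
  exists e, forall e', (e <= e')%N -> M (pi ^+ e' *: u).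
Proof.
move=> hM sMU /sMU[m [c [w [Mw ->]]]].
have [e He] := dvr_clear_all hS c.
exists e => e' le_e; rewrite scaler_sumr; apply: (submod_sum _ hM) => j _.
by rewrite scalerA; case: hM => _ _; apply=> //; apply: He.
Qed.

Lemma fin_gen_gen (M : set W) m (w : 'I_m -> W) : M = [set x | exists c : 'I_m -> K,
    (forall j, S (c j)) /\ x = \sum_j c j *: w j] -> forall j, M (w j).
Proof.
move=> -> j; exists (fun i => (i == j)%:R); split.
  by move=> i; case: eqP => _; [apply: (dvr1 hS)|apply: (dvr0 hS)].
by rewrite (bigD1 j) //= eqxx scale1r big1 ?addr0 // => i /negbTE->; rewrite scale0r.
Qed.

Variables (U : set W) (m : nat) (b : 'I_m -> W).
Hypotheses (UD : forall x y, U x -> U y -> U (x + y)) (U0 : U 0).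
Hypotheses (UZ : forall c x, U x -> U (c *: x)).
Hypothesis hb : free_basis ( *:%R : K -> W -> W) setT U b.

Definition rowc (x : 'rV[K]_m) : W := \sum_j x 0 j *: b j.

Lemma rowcD : {morph rowc : x y / x + y}.
Proof.
move=> x y; rewrite /rowc -big_split; apply: eq_bigr => j _.
by rewrite mxE scalerDl.
Qed.

Lemma rowcZ c x : rowc (c *: x) = c *: rowc x.
Proof.
by rewrite /rowc scaler_sumr; apply: eq_bigr => j _; rewrite mxE scalerA.
Qed.

Lemma rowc_sum I r (P : pred I) F :
  rowc (\sum_(i <- r | P i) F i) = \sum_(i <- r | P i) rowc (F i).
Proof.
apply: (big_morph rowc rowcD); rewrite -(scale0r (0 : 'rV_m)) rowcZ.
exact: scale0r.
Qed.

Lemma rowcU x : U (rowc x).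
Proof. by apply: big_ind => // j _; apply: UZ; case: hb. Qed.

Lemma rowc_inj : injective rowc.
Proof.
move=> x y exy; have [_ /(_ _ (rowcU x))[c [_ cU]]] := hb.
have e1 z : rowc x = rowc z -> c = [ffun j => z 0 j].
  move=> exz; apply: cU; split=> //.
  by rewrite exz; apply: eq_bigr => j _; rewrite ffunE.
by apply/rowP=> j; have := e1 _ erefl; rewrite (e1 _ exy) => /ffunP/(_ j); rewrite !ffunE.
Qed.

Lemma rowc_surj u : U u -> exists x, u = rowc x.
Proof.
case: hb => _ hu /hu[c [[_ ->] _]]; exists (\row_j c j).
by apply: eq_bigr => j _; rewrite mxE.
Qed.

Lemma rowc_submod (M : set W) : is_submod S M -> is_submod S (rowc @^-1` M).
Proof.
case=> M0 MD MZ; split; rewrite /preimage /=.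
- by rewrite /rowc big1 // => j _; rewrite mxE scale0r.
- by move=> x y Mx My; rewrite rowcD; apply: MD.
- by move=> c x Sc Mx; rewrite rowcZ; apply: MZ.
Qed.

Lemma rowc_preimage (M : set W) : M `<=` U -> M = rowc @` (rowc @^-1` M).
Proof.
move=> sMU; apply/seteqP; split=> [u Mu|_ [x Mx <-] //].
by have [x eu] := rowc_surj (sMU _ Mu); exists x; rewrite -?eu // /preimage /= -eu.
Qed.

(** Agreement of M with the lattice of P up to the factor [pi ^+ e] places M between the lattices of
    pi^e P and pi^-e P, where [lat_sandwich] applies. *)
Lemma lattice_bounds (P : 'M[K]_m) e (M : set W) : P \in unitmx ->
  is_submod S M -> M `<=` U ->
  (forall x, lat S P x -> M (pi ^+ e *: rowc x)) ->
  (forall u, M u -> (rowc @` lat S P) (pi ^+ e *: u)) ->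
  exists Q l, [/\ Q \in unitmx, M = rowc @` lat S Q,
    is_colength S (lat S (pi ^+ e *: P)) (lat S Q) l &
    vol v (pi ^+ e *: P) = vol v Q + l%:Z].
Proof.
move=> uP hM sMU sPM sMP; have pe0 := piX_neq0 hS e.
have uP1 : pi ^+ e *: P \in unitmx by rewrite unitmxZ // unitfE.
have uP2 : pi ^- e *: P \in unitmx by rewrite unitmxZ // unitfE invr_neq0.
have [||Q [l [uQ eQ cl vl]]] := lat_sandwich hS uP1 uP2 (rowc_submod hM).
- move=> _ [u Su ->]; rewrite -scalemxAr /preimage /= rowcZ; apply: sPM.
  by exists u.
- move=> x Mx; have [_ [u Su ->] ex] := sMP _ Mx; exists u => //.
  apply: (scalerI pe0); rewrite -scalemxAr scalerA divff // scale1r.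
  by apply: rowc_inj; rewrite rowcZ.
exists Q, l; split=> //; rewrite -eQ //; exact: rowc_preimage.
Qed.

(** The generators span U, so their coordinate matrix Y has full column rank and contains an
    invertible square submatrix P. Clearing the denominators of Y P^-1 compares M with the lattice
    of P. *)
Lemma fin_gen_lat (M : set W) : fin_gen S M -> M `<=` U -> spans M U ->
  exists2 P, P \in unitmx & M = rowc @` lat S P.
Proof.
move=> fgM sMU sp; have hM := fin_gen_submod fgM.
case: (fgM) => n [w eM]; have Mw := fin_gen_gen eM.
have [x Hx] := choice (fun j => rowc_surj (sMU _ (Mw j))).
pose Y : 'M[K]_(n, m) := \matrix_(i, j) x i 0 j.
have rowY i : row i Y = x i by apply/rowP=> j; rewrite !mxE.
have wE (c : 'rV_n) : \sum_j c 0 j *: w j = rowc (c *m Y).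
  rewrite mulmx_sum_row rowc_sum; apply: eq_bigr => j _.
  by rewrite rowcZ rowY -Hx.
have fullY : row_full Y.
  rewrite -sub1mx; apply/row_subP=> i; rewrite row1.
  have [|k [c [z [Mz ez]]]] := sp (rowc (delta_mx 0 i)); first exact: rowcU.
  have /choice[d Hd] : forall j, exists d : 'rV_n, z j = rowc (d *m Y).
    move=> j; have := Mz j; rewrite eM => -[a [_ ->]].
    exists (\row_l a l); rewrite -wE; apply: eq_bigr => l _; by rewrite mxE.
  have -> : delta_mx 0 i = (\sum_j c j *: d j) *m Y.
    apply: rowc_inj; rewrite ez mulmx_suml rowc_sum; apply: eq_bigr => j _.
    by rewrite -scalemxAl rowcZ Hd.
  exact: submxMl.
pose P := rowsub (fullrankfun fullY) Y.
have uP : P \in unitmx.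
  exact: fullrowsub_unit.
have [e He] : exists e, forall i j, S (pi ^+ e * (Y *m invmx P) i j).
  have [e He] := dvr_clear_all hS (fun ij => (Y *m invmx P) ij.1 ij.2).
  by exists e => i j; apply: (He e (leqnn e) (i, j)).
have [||Q [l [uQ eQ _ _]]] := lattice_bounds (e := e) uP hM sMU.
- move=> _ [u Su ->]; case: (hM) => _ _; apply; first exact: (dvr_piXS hS).
  rewrite mulmx_sum_row rowc_sum; apply: (submod_sum _ hM) => j _.
  rewrite rowcZ; case: hM => _ _; apply=> //.
  by rewrite /P row_rowsub rowY -Hx.
- move=> u; rewrite {1}eM => -[c [Sc ->]].
  exists ((pi ^+ e *: (\row_j c j)) *m Y).
    exists ((\row_j c j) *m (pi ^+ e *: (Y *m invmx P))); last first.
      by rewrite -scalemxAl -scalemxAr -scalemxAl mulmxA mulmxKV.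
    by apply: (intmxM hS) => i j; rewrite !mxE //; have := He i j; rewrite mxE.
  rewrite -scalemxAl rowcZ -wE; congr (_ *: _); apply: eq_bigr => j _.
  by rewrite mxE.
by exists Q.
Qed.

Lemma lat_fin_gen (P : 'M[K]_m) : fin_gen S (rowc @` lat S P).
Proof.
exists m, (fun j => rowc (row j P)); apply/seteqP; split.
  move=> _ [_ [u Su ->] <-]; exists (fun j => u 0 j); split=> //.
  by rewrite mulmx_sum_row rowc_sum; apply: eq_bigr => j _; rewrite rowcZ.
move=> _ [c [Sc ->]]; exists ((\row_j c j) *m P).
  by exists (\row_j c j) => // i j; rewrite mxE.
rewrite mulmx_sum_row rowc_sum; apply: eq_bigr => j _.
by rewrite rowcZ mxE.
Qed.

End FinGen.

(** * Lattices over a maximal order are free *)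

Definition division_set (K : fieldType) (X : vectType K) (D : set 'End(X)) :=
  [/\ D \1%VF, forall f g, D f -> D g -> D (f - g),
      forall f g, D f -> D g -> D (f \o g)%VF, forall c f, D f -> D (c *: f) &
      forall f, D f -> f != 0 ->
        exists g, [/\ D g, (f \o g)%VF = \1%VF & (g \o f)%VF = \1%VF]].

Lemma division_set0 (K : fieldType) (X : vectType K) (D : set 'End(X)) :
  division_set D -> D 0.
Proof. by case=> D1 DB _ _ _; rewrite -(subrr \1%VF); apply: DB. Qed.

Lemma division_setD (K : fieldType) (X : vectType K) (D : set 'End(X)) :
  division_set D -> forall f g, D f -> D g -> D (f + g).
Proof.
move=> hD f g Df Dg; have [_ DB _ _ _] := hD; rewrite -[g]opprK; apply: (DB) => //.
by rewrite -[- g]sub0r; apply: (DB) => //; exact: division_set0.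
Qed.

Section FreeLattice.

Variables (K : fieldType) (S : set K) (pi : K) (v : K -> int).
Hypothesis hS : is_dvr S pi v.
Variables (X : vectType K) (D : set 'End(X)).
Hypothesis hD : division_set D.

Let D1 : D \1%VF. Proof. by case: hD. Qed.
Let DB f g : D f -> D g -> D (f - g). Proof. by case: hD => _ H _ _ _; apply: H. Qed.
Let DM f g : D f -> D g -> D (f \o g)%VF. Proof. by case: hD => _ _ H _ _; apply: H. Qed.
Let DZ c f : D f -> D (c *: f). Proof. by case: hD => _ _ _ H _; apply: H. Qed.
Let Dinv f : D f -> f != 0 -> exists g, [/\ D g, (f \o g)%VF = \1%VF & (g \o f)%VF = \1%VF].
Proof. by case: hD => _ _ _ _; apply. Qed.
Let D0 : D 0. Proof. exact: division_set0. Qed.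
Let DD f g : D f -> D g -> D (f + g). Proof. exact: division_setD. Qed.

Variables (r : nat) (hr : has_dim ( *:%R : K -> 'End(X) -> 'End(X)) setT D r).
Variables (Lam : set 'End(X)) (hLam : is_max_order S D Lam).

Let sLD : Lam `<=` D. Proof. by case: hLam => [[]]. Qed.
Let L1 : Lam \1%VF. Proof. by case: hLam => [[]]. Qed.
Let LM f g : Lam f -> Lam g -> Lam (f \o g)%VF. Proof. by case: hLam => [[_ _ H _ _] _]; apply: H. Qed.
Let fgL : fin_gen S Lam. Proof. by case: hLam => [[]]. Qed.
Let spL : spans Lam D. Proof. by case: hLam => [[]]. Qed.
Let sL : is_submod S Lam. Proof. exact (fin_gen_submod hS fgL). Qed.
Let LB f g : Lam f -> Lam g -> Lam (f - g). Proof. exact (submodB hS sL). Qed.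
Let LZ c f : S c -> Lam f -> Lam (c *: f). Proof. by case: sL => _ _; apply. Qed.

Hypothesis X_gt0 : (0 < dim X)%N.
Let R : nzRingType := lfun_comp_nzRingType X_gt0.
Let p : R := pi *: \1%VF.

Let pXE e (f : R) : p ^+ e * f = (pi ^+ e *: f : 'End(X)).
Proof.
elim: e => [|e IHe]; first by rewrite !expr0 mul1r scale1r.
rewrite exprS -mulrA IHe exprS -scalerA; change (((pi *: \1) \o (pi ^+ e *: f))%VF = pi *: (pi ^+ e *: f)).
by rewrite -comp_lfunZl comp_lfun1l.
Qed.

Let clear_L f : D f -> exists e, forall e', (e <= e')%N -> Lam (pi ^+ e' *: f).
Proof. exact: (spans_clear hS sL spL). Qed.

(** The length needed for [principal] is the drop in volume from the lattice of pi^e P, where P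
    describes Lam itself. *)
Lemma order_length e : exists mu : set R -> nat, forall M N : set R,
  @lsub R D Lam M -> @lsub R D Lam N -> @bounded R Lam p e M -> @bounded R Lam p e N ->
  M `<=` N -> ~ (N `<=` M) -> (mu M < mu N)%N.
Proof.
have [b hb] := hr.
have [P uP eL] := fin_gen_lat hS DD D0 DZ hb fgL sLD spL.
have H M : @lsub R D Lam M -> @bounded R Lam p e M -> exists Q l, [/\ Q \in unitmx,
    M = rowc b @` lat S Q, is_colength S (lat S (pi ^+ e *: P)) (lat S Q) l &
    vol v (pi ^+ e *: P) = vol v Q + l%:Z].
  move=> [sMD [M0 MB] LMm] [bM1 bM2]; apply: (lattice_bounds hS DD D0 DZ hb uP) => //.
  - split=> // [x y Mx My|c x Sc Mx].
      have <- : x - (0 - y) = x + y by rewrite sub0r opprK.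
      by apply: (MB) => //; apply: MB.
    have := LMm _ _ (LZ Sc L1) Mx.
    by change (M (c *: \1 \o x)%VF -> M (c *: x)); rewrite -comp_lfunZl comp_lfun1l.
  - move=> x Px; have := bM1 (rowc b x); rewrite pXE; apply.
    by rewrite eL; exists x.
  - by move=> f /bM2; rewrite pXE eL.
(* Outside the bounded left submodules the value is arbitrary and set to 0. *)
have Hex (M : set R) : exists l : nat, @lsub R D Lam M -> @bounded R Lam p e M ->
    exists Q, [/\ Q \in unitmx, M = rowc b @` lat S Q &
                  vol v (pi ^+ e *: P) = vol v Q + l%:Z].
  have [lM|nlM] := pselect (@lsub R D Lam M); last by exists 0%N.
  have [bM|nbM] := pselect (@bounded R Lam p e M); last by exists 0%N.
  have [Q [l [uQ eQ cl vl]]] := H M lM bM.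
  by exists l => _ _; exists Q.
have [mu Hmu] := choice Hex.
exists mu => M N lM lN bM bN sMN nNM.
have [Q [uQ eQ vQ]] := Hmu M lM bM.
have [Q' [uQ' eQ' vQ']] := Hmu N lN bN.
have : vol v Q' < vol v Q; last by lia.
apply: (lat_proper_val hS uQ uQ'); split=> [x Qx|s].
  have : N (rowc b x) by apply: sMN; rewrite eQ; exists x.
  by rewrite eQ' => -[y Qy /(rowc_inj DD D0 DZ hb) <-].
by apply: nNM => y; rewrite eQ' eQ => -[x Qx <-]; exists x => //; apply: s.
Qed.

(** Bounded denominators make the larger ring a lattice, hence finitely generated over S and an
    order, so that maximality of Lam applies. *)
Lemma order_max (O : set R) : O 1 -> (forall x y, O x -> O y -> O (x - y)) ->
  (forall x y, O x -> O y -> O (x * y)) -> Lam `<=` O -> O `<=` D ->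
  (exists e, forall x, O x -> Lam (p ^+ e * x)) -> O `<=` Lam.
Proof.
move=> O1 OB OM sLO sOD [e He].
have [b hb] := hr.
have [P uP eL] := fin_gen_lat hS DD D0 DZ hb fgL sLD spL.
have O0 : O 0 by rewrite -(subrr (1 : R)); apply: OB.
have sO : @is_submod K S 'End(X) O.
  split=> // [x y Ox Oy|c x Sc Ox].
    have <- : x - (0 - y) = x + y by rewrite sub0r opprK.
    by apply: (OB) => //; apply: OB.
  have := OM _ _ (sLO _ (LZ Sc L1)) Ox.
  by change (O (c *: \1 \o x)%VF -> O (c *: x)); rewrite -comp_lfunZl comp_lfun1l.
have [||Q [l [uQ eQ _ _]]] := lattice_bounds hS DD D0 DZ hb (e := e) uP sO sOD.
- move=> x Px; case: sO => _ _; apply; first exact: (dvr_piXS hS).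
  by apply: sLO; rewrite eL; exists x.
- by move=> f /He; rewrite pXE eL.
case: hLam => _ /(_ O) -> //; split=> //.
- by rewrite eQ; apply: (lat_fin_gen S b).
- by move=> f /spL[m [c [w [Lw ew]]]]; exists m, c, w; split=> // j; apply: sLO.
Qed.

Variables (n : nat) (u : 'I_n -> X).
Hypothesis hu : free_basis (fun (f : 'End(X)) w => f w) D setT u.
Variable V : set X.
Hypotheses (hV : is_submod S V) (LV : forall f w, Lam f -> V w -> V (f w)).
Hypotheses (fgV : fin_gen S V) (spV : spans V setT).

Lemma free_basis_coord_inj (b : 'I_n -> X) (c d : 'I_n -> 'End(X)) :
  free_basis (fun (f : 'End(X)) w => f w) D setT b ->
  (forall j, D (c j)) -> (forall j, D (d j)) ->
  \sum_j c j (b j) = \sum_j d j (b j) -> forall j, c j = d j.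
Proof.
move=> hb Dc Dd e j; have [_ /(_ (\sum_j c j (b j)) I)[a [_ aU]]] := hb.
have ac : a = finfun c.
  by apply: aU; split=> [k|]; rewrite ?ffunE //; apply: eq_bigr => k _; rewrite ffunE.
have ad : a = finfun d.
  apply: aU; split=> [k|]; rewrite ?ffunE // e.
  by apply: eq_bigr => k _; rewrite ffunE.
by have := erefl (a j); rewrite {1}ac ad !ffunE.
Qed.

(** Coordinates in the D-basis u turn V into a left Lam-submodule of D^n, to which
    [triangular_basis] applies; the triangular shape with nonzero diagonal entries gives
    independence over D. *)
Lemma free_lattice : exists w : 'I_n -> X,
  free_basis (fun (f : 'End(X)) w => f w) D setT w /\
  forall y, V y <-> exists2 c : 'I_n -> 'End(X), (forall j, Lam (c j)) &
                     y = \sum_j c j (w j).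
Proof.

have eB (f : 'End(X)) (x y : X) : f (x - y) = f x - f y by rewrite linearB.
pose ev (x : {ffun 'I_n -> R}) : X := \sum_k (x k : 'End(X)) (u k).
have evB x y : ev (x - y) = ev x - ev y.
  by rewrite -sumrB; apply: eq_bigr => k _; rewrite !ffunE add_lfunE opp_lfunE.
have evZ f x : ev (lscale f x) = (f : 'End(X)) (ev x).
  by rewrite linear_sum; apply: eq_bigr => k _; rewrite ffunE; rewrite comp_lfunE.
have ev0 : ev 0 = 0 by rewrite -(subrr 0) evB subrr.
have evD x y : ev (x + y) = ev x + ev y.
  by rewrite -big_split; apply: eq_bigr => k _; rewrite !ffunE add_lfunE.
have ev_sum (I : finType) (F : I -> {ffun 'I_n -> R}) : ev (\sum_i F i) = \sum_i ev (F i).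
  exact: (big_morph ev evD ev0).
have ev1 j (f : 'End(X)) : ev [ffun k => if k == j then (f : R) else 0] = f (u j).
  rewrite /ev (bigD1 j) //= ffunE eqxx big1 ?addr0 // => k /negbTE nkj.
  by rewrite ffunE nkj zero_lfunE.
have ev_inj (x y : {ffun 'I_n -> R}) : (forall k, D (x k)) -> (forall k, D (y k)) -> ev x = ev y -> x = y.
  by move=> Dx Dy exy; apply/ffunP; exact: (free_basis_coord_inj hu Dx Dy exy).
have ev_surj w : exists2 x : {ffun 'I_n -> R}, (forall k, D (x k)) & w = ev x.
  by case: hu => _ /(_ w I)[c [[Dc ->] _]]; exists c.
have [e0 He0] : exists e, forall e', (e <= e')%N -> forall j, V (pi ^+ e' *: u j).
  have /choice[f Hf] j := spans_clear hS hV spV (I : setT (u j)).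
  exists (\max_j f j)%N => e' le_e j; apply: Hf.
  exact: leq_trans (leq_bigmax j) le_e.
have [e1 He1] : exists e, forall e', (e <= e')%N -> forall (x : {ffun 'I_n -> R}) k, (forall k, D (x k)) ->
    V (ev x) -> Lam (pi ^+ e' *: (x k : 'End(X))).
  case: fgV => m [w eV].
  have /choice[xw Hxw] i : exists x : {ffun 'I_n -> R}, (forall k, D (x k)) /\ w i = ev x.
    by have [x] := ev_surj (w i); exists x.
  have /choice[f Hf] (ik : 'I_m * 'I_n) := clear_L ((Hxw ik.1).1 ik.2).
  exists (\max_ik f ik)%N => e' le_e x k Dx; rewrite {1}eV => -[c [Sc ex]].
  have -> : x = \sum_i lscale (c i *: \1%VF : R) (xw i).
    apply: ev_inj => //.
      move=> j; rewrite sum_ffunE; apply: (@big_ind R D); [exact: D0|exact: DD|].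
      by move=> i _; rewrite ffunE; apply: DM; [exact: DZ|case: (Hxw i)].
    rewrite ex ev_sum; apply: eq_bigr => i _; rewrite evZ scale_lfunE id_lfunE.
    by case: (Hxw i) => _ ->.
  rewrite sum_ffunE (scaler_sumr (V := 'End(X))); apply: (submod_sum _ sL) => i _.
  rewrite ffunE; change (Lam (pi ^+ e' *: (c i *: \1 \o (xw i k : 'End(X))))%VF).
  rewrite -comp_lfunZl comp_lfun1l scalerA mulrC -scalerA; apply: LZ => //.
  by apply: (Hf (i, k)); apply: leq_trans (leq_bigmax (i, k)) le_e.
(* The exponent e0 carries the basis vectors u j into V, and e1 carries the coordinates of elements
   of V into Lam. *)
pose e := maxn e0 e1.
pose V' := [set x : {ffun 'I_n -> R} | (forall k, D (x k)) /\ V (ev x)].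
have Dinv' : forall x : R, D x -> x != 0 -> exists y : R, [/\ D y, x * y = 1 & y * x = 1].
  exact: Dinv.
have pL : Lam p by apply: LZ => //; apply: (dvr_piS hS).
have p0 : p != 0.
  apply/eqP=> /(congr1 (fun f : 'End(X) => pi^-1 *: f)); rewrite scaler0 scalerA.
  by rewrite mulVf ?(dvr_pi0 hS) // scale1r; apply/eqP/(oner_neq0 R).
have pC (x : R) : D x -> p * x = x * p.
  move=> _; change ((pi *: \1 \o x)%VF = (x \o (pi *: \1))%VF :> 'End(X)).
  by rewrite -comp_lfunZl -comp_lfunZr comp_lfun1l comp_lfun1r.
have clear' (x : R) : D x -> exists e, Lam (p ^+ e * x).
  by move=> /clear_L[e' He']; exists e'; rewrite pXE; apply: He'.
have [||||||w' [Vw' w'tri w'0 w'V]] :=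
  @triangular_basis R D Lam p D1 DB DM Dinv' sLD L1 LB LM pL p0 pC clear' order_max order_length n V' e.
- by move=> x k [Dx _].
- by split=> [k|]; rewrite ?ev0 ?ffunE //; case: hV.
- move=> x y [Dx Vx] [Dy Vy]; split=> [k|]; first by rewrite !ffunE; apply: DB.
  by rewrite evB; apply: (submodB hS).
- move=> l x Ll [Dx Vx]; split=> [k|]; first by rewrite ffunE; apply: DM => //; apply: sLD.
  by rewrite evZ; apply: LV.
- move=> l j Ll; split=> [k|]; first by rewrite ffunE; case: eqP => // _; rewrite pXE; apply/DZ/sLD.
  rewrite ev1 pXE scale_lfunE -linearZ; apply: LV => //; apply: He0.
  exact: leq_maxl.
- by move=> x k [Dx Vx]; rewrite pXE; apply: He1 => //; exact: leq_maxr.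
pose w j := ev (w' j).
have wE (c : 'I_n -> 'End(X)) : \sum_j c j (w j) = ev (\sum_j lscale (c j : R) (w' j)).
  by rewrite ev_sum; apply: eq_bigr => j _; rewrite evZ.
have VE y : V y <-> exists2 c : 'I_n -> 'End(X), (forall j, Lam (c j)) & y = \sum_j c j (w j).
  split=> [Vy|[c Lc ->]]; last first.
    by apply: (submod_sum _ hV) => j _; apply: LV => //; case: (Vw' j).
  have [x Dx ey] := ev_surj y; have [|c Lc ex] := w'V x; first by split; rewrite -?ey.
  by exists c; rewrite // wE -ex.
exists w; split=> //; split=> // y _.
have [c Dc ec] : exists2 c : 'I_n -> 'End(X), (forall j, D (c j)) & y = \sum_j c j (w j).
  have [f /(_ f (leqnn f))/VE[c Lc ec]] := spans_clear hS hV spV (I : setT y).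
  exists (fun j => pi ^- f *: c j) => [j|]; first exact/DZ/sLD.
  apply: (scalerI (piX_neq0 hS f)); rewrite ec scaler_sumr; apply: eq_bigr => j _.
  by rewrite scale_lfunE scalerA divff ?(piX_neq0 hS) // scale1r.
exists (finfun c); split.
  by split=> [j|]; rewrite ?ffunE // ec; apply: eq_bigr => j _; rewrite ffunE.
move=> c' [Dc' ec']; apply/ffunP=> j; rewrite ffunE; apply/eqP.
rewrite -subr_eq0; apply/eqP.
pose d i : 'End(X) := c i - c' i.
have Dd i : D (d i) by apply: DB.
have d0 : \sum_i d i (w i) = 0.
  rewrite (eq_bigr (fun i => c i (w i) - c' i (w i))) ?sumrB -?ec -?ec' ?subrr //.
  by move=> i _; rewrite add_lfunE opp_lfunE.
have Dw i k : D (w' i k) by case: (Vw' i).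
have coord0 k : \sum_i (d i : R) * w' i k = 0.
  have e' : \sum_j lscale (d j : R) (w' j) = 0; first apply: ev_inj.
    - move=> l; rewrite sum_ffunE; apply: (@big_ind R D); [exact: D0|exact: DD|].
    by move=> i _; rewrite ffunE; apply: DM.
  - by move=> l; rewrite ffunE.
  - by rewrite ev0 -wE.
  have := congr1 (fun x : {ffun 'I_n -> R} => x k) e'.
  rewrite sum_ffunE ffunE => e''; apply: etrans e''.
  by apply: eq_bigr => i _; rewrite ffunE.
(* Descending induction: at coordinate i only the d l with l at least i contribute, and those with
   larger l vanish already. *)
have [m] := ubnP (n - j)%N; elim: m (j) => // m IHm i lt_m.
have := coord0 i; rewrite (bigD1 i) //= big1 => [|l nli]; last first.
  have [lt_li|lt_il|eli] := ltngtP l i.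
  - by rewrite w'tri ?mulr0.
  - suff -> : (d l : R) = 0 by rewrite mul0r.
    by apply: IHm; move: (ltn_ord l) (ltn_ord i) lt_m lt_il; clear; lia.
  - by rewrite (val_inj eli) eqxx in nli.
rewrite addr0 => di0; have [f [_ wf _]] := Dinv' (w' i i) (Dw i i) (w'0 i).
by have := congr1 (fun x : R => x * f) di0; rewrite -mulrA wf mulr1 mul0r.
Qed.

End FreeLattice.

(** * Density *)

Section Density.

Variables (I : Type) (W : I -> zmodType) (U : forall i, set (W i)).
Variables (B : Type) (act : forall i, B -> W i -> W i).
Hypothesis U0 : forall i, @U i 0.
Hypothesis UB : forall i x y, @U i x -> @U i y -> @U i (x - y).
Hypothesis actU : forall i b x, @U i x -> @U i (act b x).
Hypothesis actB : forall i b x y, @U i x -> @U i y -> act b (x - y) = act b x - act b y.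
Hypothesis subB : forall b c, exists d, forall i x, @U i x -> act d x = act b x - act c x.
Hypothesis mulB : forall b c, exists d, forall i x, @U i x -> act d x = act c (act b x).
Hypothesis oneB : exists d, forall i x, @U i x -> act d x = x.
Hypothesis irrB : forall i x y, @U i x -> x != 0 -> @U i y -> exists b, act b x = y.

Let act0 i b : act b (0 : W i) = 0.
Proof. by rewrite -[X in act _ X](subrr 0) actB ?subrr //; exact: U0. Qed.

Definition equivariant i j (f : W i -> W j) :=
  [/\ forall x, @U i x -> @U j (f x),
      forall x y, @U i x -> @U i y -> f (x - y) = f x - f y &
      forall b x, @U i x -> f (act b x) = act b (f x)].

(** Such families replace spans over endomorphism rings and also account for maps between different
    modules. *)
Definition hom_closed (P : forall i, set (W i)) :=
  [/\ forall i, P i 0, forall i x y, P i x -> P i y -> P i (x - y) &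
      forall i j (f : W i -> W j) x, equivariant f -> @U i x -> P i x -> P j (f x)].

(** Induction on s. If the elements b that annihilate the tail of s do not all kill the head z, they
    carry z to every vector by irreducibility. Then b z |-> b y, for such b, is a well-defined
    equivariant map f, and y - f z is killed by the annihilator of the tail, so the induction
    hypothesis covers it. *)
Lemma jacobson_density (J : eqType) (ix : J -> I) (x : forall k, W (ix k)) (s : seq J) :
  (forall k, U (x k)) -> forall i y, @U i y ->
  (forall b, all (fun k => act b (x k) == 0) s -> act b y = 0) ->
  forall P, hom_closed P -> (forall k, k \in s -> P (ix k) (x k)) -> P i y.
Proof.
move=> Ux; elim: s => [|k s IHs] i y Uy Hy P cP Px.
  have [d Hd] := oneB; rewrite -(Hd i y Uy) Hy //.
  by case: cP.
have [Hz|] := pselect (forall b, all (fun k => act b (x k) == 0) s -> act b (x k) = 0).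
  apply: IHs => // [b Hb|l ls]; last by apply: Px; rewrite inE ls orbT.
  by apply: Hy; rewrite /= Hb Hz ?eqxx.
move=> /existsNP[b0 /not_implyP[b0s /eqP b0z]].
pose z := x k; have Uz : @U _ z by [].
have reach w : @U _ w -> exists2 b, all (fun k => act b (x k) == 0) s & act b z = w.
  move=> Uw; have [c Hc] := irrB (actU b0 Uz) b0z Uw.
  have [d Hd] := mulB b0 c; exists d; last by rewrite Hd.
  elim: s b0s {IHs Hy Px} => //= l s IHs /andP[/eqP b0l /IHs ->].
  by rewrite Hd // b0l act0 eqxx.
have /choice[f Hf] w : exists fw : W i, @U _ w -> exists b,
    [/\ all (fun k => act b (x k) == 0) s, act b z = w & fw = act b y].
  have [Uw|nUw] := pselect (@U _ w); last by exists 0.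
  by have [b Hb bz] := reach w Uw; exists (act b y) => _; exists b.
have fE b : all (fun k => act b (x k) == 0) s -> f (act b z) = act b y.
  move=> Hb; have [c [Hc cz ->]] := Hf _ (actU b Uz).
  have [d Hd] := subB c b; apply/eqP; rewrite -subr_eq0 -Hd //; apply/eqP.
  apply: Hy; rewrite /= Hd // cz subrr eqxx /=.
  elim: s Hb Hc {IHs b0s reach Hf Px} => //= l s IHs /andP[/eqP bl Hb] /andP[/eqP cl Hc].
  by rewrite Hd // bl cl subrr eqxx IHs.
have fU w : @U _ w -> @U _ (f w).
  by move=> Uw; have [b [_ _ ->]] := Hf w Uw; apply: actU.
have equiv_f : equivariant f.
  split=> // [w w' Uw Uw'|c w Uw].
    have [b [bs bz ->]] := Hf w Uw; have [b' [b's b'z ->]] := Hf w' Uw'.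
    have [d Hd] := subB b b'.
    rewrite -Hd // -fE; last first.
      elim: s bs b's {IHs Hy b0s reach Hf fE Px} => //= l s IHs /andP[/eqP bl Hb] /andP[/eqP cl Hc].
      by rewrite Hd // bl cl subrr eqxx IHs.
    by rewrite Hd // bz b'z.
  have [b [bs bz ->]] := Hf w Uw; have [d Hd] := mulB b c.
  rewrite -Hd // -fE; first by rewrite Hd // bz.
  elim: s bs {IHs Hy b0s reach Hf fE Px} => //= l s IHs /andP[/eqP bl Hb].
  by rewrite IHs // andbT Hd // bl act0.
have Pyf : P i (y - f z).
  apply: IHs => //; first by apply: UB => //; apply: fU.
    move=> b Hb; rewrite actB //; last exact: fU.
  have [_ _ ef] := equiv_f; rewrite -ef // fE // subrr //.
  by move=> l ls; apply: Px; rewrite inE ls orbT.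
case: cP => P0 PB PH; have Pfz : P i (f z) by apply: PH => //; apply: Px; rewrite inE eqxx.
have <- : (y - f z) - (0 - f z) = y by rewrite sub0r opprK subrK.
by apply: (PB) => //; apply: PB.
Qed.

End Density.

(** A subspace of largest dimension among those inside M is all of M, because any further vector of
    M could be adjoined. *)
Lemma subspace_vspace (K : fieldType) (X : vectType K) (M : set X) :
  M 0 -> (forall x y, M x -> M y -> M (x + y)) -> (forall c x, M x -> M (c *: x)) ->
  exists U : {vspace X}, forall x, x \in U <-> M x.
Proof.
move=> M0 MD MZ.
have [|U sUM Umax] := @exists_minimizer {vspace X} (fun U => forall x, x \in U -> M x)
    (fun U => dim X - \dim U)%N.
  by exists 0%VS => x; rewrite memv0 => /eqP->.
exists U => x; split=> [/sUM//|Mx].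
have sM y : y \in (U + <[x]>)%VS -> M y.
  move=> /memv_addP[u Uu [w /vlineP[c ->] ->]]; apply: MD; first exact: sUM.
  exact: MZ.
have := Umax _ sM; have := dimvS (addvSl U <[x]>%VS).
have dX (V : {vspace X}) : (\dim V <= dim X)%N by rewrite -dimvf dimvS // subvf.
have := dX U; have := dX (U + <[x]>)%VS => h1 h2 h3 h4.
have /eqP eU : U == (U + <[x]>)%VS by rewrite eqEdim addvSl; lia.
by rewrite eU (subvP (addvSr U <[x]>)) ?memv_line.
Qed.

Lemma lfun_of_linear (K : fieldType) (X Y : vectType K) (f : X -> Y) :
  (forall c x y, f (c *: x + y) = c *: f x + f y) -> exists g : 'Hom(X, Y), g =1 f.
Proof.
move=> lf; pose F : {linear X -> Y} := HB.pack f (GRing.isLinear.Build _ _ _ _ f lf).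
by exists (linfun F) => x; rewrite lfunE.
Qed.

(** * Schur's lemma and density for simple modules *)

Section SimpleModules.

Variables (K : fieldType) (A : algType K).
Implicit Types X Y : rmod A.

Definition rm_hom X Y (f : 'Hom(X, Y)) :=
  forall a x, f (rm_act X a x) = rm_act Y a (f x).

Lemma rm_act_scal X c x : rm_act X (c%:A) x = c *: x.
Proof. by rewrite linearZ /= rm_act1 scale_lfunE id_lfunE. Qed.

Lemma rm_act_mul X a b x : rm_act X (a * b) x = rm_act X b (rm_act X a x).
Proof. by rewrite rm_actM comp_lfunE. Qed.

Lemma rm_simple_gen X x y : rm_simple X -> x != 0 -> exists a, rm_act X a x = y.
Proof.
move=> [_ simX] x0.
have [|||U HU] := @subspace_vspace _ X [set w | exists a, rm_act X a x = w].
- by exists 0; rewrite linear0 zero_lfunE.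
- by move=> _ _ [a <-] [b <-]; exists (a + b); rewrite linearD add_lfunE.
- by move=> c _ [a <-]; exists (c *: a); rewrite linearZ scale_lfunE.
have [a|U0|UT] := simX U.
- apply/subvP=> w /memv_imgP[z /HU[b <-] ->]; apply/HU.
  by exists (b * a); rewrite rm_act_mul.
- have : x \in U by apply/HU; exists 1; rewrite rm_act1 id_lfunE.
  by rewrite U0 memv0 (negbTE x0).
- by apply/HU; rewrite UT memvf.
Qed.

Lemma rm_hom_iso X Y (f : 'Hom(X, Y)) : rm_simple X -> rm_simple Y -> rm_hom f ->
  f != 0 -> bijective f.
Proof.
move=> [_ simX] [_ simY] hf f0.
have /eqP kf : lker f == 0%VS.
  have [a||ekf] := simX (lker f).
  - apply/subvP=> _ /memv_imgP[z + ->]; rewrite !memv_ker hf => /eqP->.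
    by rewrite linear0.
  - by move->.
  - case/eqP: f0; apply/lfunP=> x; rewrite zero_lfunE; apply/eqP.
    by rewrite -memv_ker ekf memvf.
have If : limg f = fullv.
  have [a||//] := simY (limg f).
  - apply/subvP=> _ /memv_imgP[_ /memv_imgP[z _ ->] ->].
    by rewrite -hf memv_img ?memvf.
  - move=> If0; case/eqP: f0; apply/lfunP=> x; rewrite zero_lfunE.
    by apply/eqP; rewrite -memv0 -If0 memv_img ?memvf.
exists (f^-1)%VF => x.
  by rewrite -comp_lfunE lker0_compVf ?kf ?id_lfunE.
by apply: limg_lfunVK; rewrite If memvf.
Qed.

Lemma rm_end_division X : rm_simple X -> division_set (rm_end X).
Proof.
move=> simX; split.
- by move=> a x; rewrite !id_lfunE.
- by move=> f g Df Dg a x; rewrite !add_lfunE !opp_lfunE Df Dg linearB.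
- by move=> f g Df Dg a x; rewrite !comp_lfunE Dg Df.
- by move=> c f Df a x; rewrite !scale_lfunE Df linearZ.
- move=> f Df f0; have bf := rm_hom_iso simX simX Df f0.
  have kf : lker f == 0%VS by apply/lker0P; exact: bij_inj.
  exists (f^-1)%VF; split; rewrite ?lker0_compfV ?lker0_compVf //.
  move=> a x; apply: (bij_inj bf).
  by rewrite Df !lker0_lfunVK.
Qed.

(** K acts through the scalars of A, so an additive A-equivariant map is automatically K-linear. *)
Lemma equivariant_hom X Y (f : X -> Y) :
  (forall x y, f (x - y) = f x - f y) -> (forall a x, f (rm_act X a x) = rm_act Y a (f x)) ->
  exists2 g : 'Hom(X, Y), rm_hom g & g =1 f.
Proof.
move=> fB fA; have f0 : f 0 = 0 by rewrite -(subrr 0) fB subrr.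
have [|g gf] := @lfun_of_linear _ X Y f; last by exists g => // a x; rewrite !gf.
have fN y : f (- y) = - f y by rewrite -sub0r fB f0 sub0r.
by move=> c x y; rewrite -{1}[y]opprK fB fN opprK -!rm_act_scal fA.
Qed.

Variables (I : finType) (X : I -> rmod A).
Hypothesis simX : forall i, rm_simple (X i).
Hypothesis distX : forall i j, rm_iso (X i) (X j) -> i = j.
Variables (n : I -> nat) (u : forall i, 'I_(n i) -> X i).
Hypothesis hu : forall i,
  free_basis (fun (f : 'End(X i)) w => f w) (rm_end (X i)) setT (@u i).

Lemma free_basis_nonzero i (d : 'I_(n i) -> 'End(X i)) j :
  (forall l, rm_end (X i) (d l)) -> d j = 0 -> u j <> \sum_l d l (u l).
Proof.
move=> Dd dj0 euj.
have [D1 DB _ _ _] := rm_end_division (simX i).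
have D0 : rm_end (X i) 0 by rewrite -(subrr \1%VF); apply: DB.
have e : \sum_l (if l == j then \1%VF else 0 : 'End(X i)) (u l) = \sum_l d l (u l).
  rewrite -euj (bigD1 j) //= eqxx id_lfunE big1 ?addr0 // => l /negbTE->.
  by rewrite zero_lfunE.
have /= := free_basis_coord_inj (hu i) _ Dd e j; rewrite eqxx dj0 => -/(_ _)/eqP.
have x0 : u j != 0.
  apply/eqP=> u0; have e' : \sum_l (if l == j then \1%VF else 0 : 'End(X i)) (u l)
      = \sum_l (0 : 'End(X i)) (u l).
    rewrite (bigD1 j) //= eqxx id_lfunE u0 add0r !big1 // => l; rewrite ?zero_lfunE //.
    by move=> /negbTE->; rewrite zero_lfunE.
  have /= := free_basis_coord_inj (hu i) _ _ e' j; rewrite eqxx => E.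
  have [[x xn0] _] := simX i; case/eqP: xn0.
  by rewrite -[x]id_lfunE E ?zero_lfunE // => l; case: eqP.
move=> H; case/eqP: x0; rewrite -[u j]id_lfunE (eqP (H _)) ?zero_lfunE // => l.
by case: eqP.
Qed.

(** By density, if every element killing all the other basis vectors also killed u j, then u j would
    be a combination of the other basis vectors of X_i, against freeness. Simplicity then moves the
    nonzero image of u j to any w. *)
Lemma dual_action i (j : 'I_(n i)) (w : X i) : exists a,
  [/\ rm_act (X i) a (u j) = w, forall l, l != j -> rm_act (X i) a (u l) = 0 &
      forall i', i' != i -> forall y, rm_act (X i') a y = 0].
Proof.
pose J := {i : I & 'I_(n i)}.
pose ij : J := Tagged (fun i => 'I_(n i)) j.
pose s := [seq k <- enum {: J} | k != ij].
pose uJ (k : J) : X (tag k) := u (tagged k).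
have [b0 Hb0 b0u] : exists2 b, all (fun k => rm_act (X (tag k)) b (uJ k) == 0) s &
    rm_act (X i) b (u j) <> 0.
  apply: contrapT => H.
  (* Vectors whose images in X_i under equivariant maps avoid the coordinate j. Basis vectors of the
     other modules qualify, since by Schur's lemma their images in X_i are zero. *)
  pose P i' (y : X i') := forall f : X i' -> X i,
    (forall x y, f (x - y) = f x - f y) ->
    (forall a x, f (rm_act (X i') a x) = rm_act (X i) a (f x)) ->
    exists2 d : 'I_(n i) -> 'End(X i), (forall l, rm_end (X i) (d l)) /\ d j = 0 &
      f y = \sum_l d l (u l).
  have [D1 DB _ _ _] := rm_end_division (simX i).
  have D0 : rm_end (X i) 0 by rewrite -(subrr \1%VF); apply: DB.
  have : P i (u j).
    apply: (@jacobson_density I X (fun=> setT) A (fun i a x => rm_act (X i) a x)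
      _ _ _ _ _ _ _ _ J (@tag _ _) uJ s) => //.
    - by move=> i' b x y _ _; rewrite linearB.
    - by move=> b c; exists (b - c) => i' x _; rewrite linearB /= add_lfunE opp_lfunE.
    - by move=> b c; exists (b * c) => i' x _; rewrite rm_act_mul.
    - by exists 1 => i' x _; rewrite rm_act1 id_lfunE.
    - by move=> i' x y _ x0 _; apply: rm_simple_gen.
    - by move=> b Hb; apply: contrapT => nb; apply: H; exists b.
    - split.
      + move=> i' f fB _; exists (fun=> 0); first by split.
        by rewrite -(subrr 0) fB subrr big1 // => l _; rewrite zero_lfunE.
      + move=> i' x y Px Py f fB fA; have [d [Dd dj] ed] := Px f fB fA.
        have [d' [Dd' dj'] ed'] := Py f fB fA.
        exists (fun l => d l - d' l); first by split=> [l|]; [exact: DB|rewrite dj dj' subrr].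
        rewrite fB ed ed' -sumrB; apply: eq_bigr => l _.
        by rewrite add_lfunE opp_lfunE.
      + move=> i1 i2 g x [_ gB gA] _ Px f fB fA; apply: (Px (f \o g)) => /=.
          by move=> y z; rewrite gB // fB.
        by move=> a y; rewrite gA // fA.
    - move=> [i' l]; rewrite mem_filter eq_sym => /andP[nl _] f fB fA.
      have [g hg gf] := equivariant_hom fB fA; rewrite -gf.
      have [g0|g0] := eqVneq g 0.
        exists (fun=> 0); first by split.
        by rewrite g0 zero_lfunE big1 // => l' _; rewrite zero_lfunE.
      have ei : i' = i by apply: distX; exists g; split=> //; exact: rm_hom_iso g0.
      subst i'.
      rewrite eq_Tagged /= in nl.
      exists (fun l' => if l' == l then g else 0).
        by split=> [l'|]; [case: eqP|rewrite (negbTE nl)].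
      rewrite (bigD1 l) //= eqxx big1 ?addr0 // => l' /negbTE->.
      by rewrite zero_lfunE.
  case/(_ id) => // d [Dd dj0]; exact: free_basis_nonzero.
have [c Hc] := @rm_simple_gen (X i) _ w (simX i) (introN eqP b0u).
exists (b0 * c); split=> [|l nlj|i' ni' y]; rewrite rm_act_mul //.
  have /(allP Hb0)/eqP e : Tagged (fun i => 'I_(n i)) l \in s.
    rewrite mem_filter mem_enum andbT; apply: contra nlj.
    by rewrite eq_sym eq_Tagged /= eq_sym.
  by have -> : rm_act (X i) b0 (u l) = 0 by []; rewrite linear0.
have Hu l : rm_act (X i') b0 (u l) = 0.
  apply/eqP/(allP Hb0 (Tagged (fun i => 'I_(n i)) l)).
  rewrite mem_filter mem_enum andbT; apply: contra ni' => /eqP e.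
  by rewrite -[i]/(tag ij) -e.
have [_ /(_ y Logic.I)[d [[Dd ->] _]]] := hu i'.
by rewrite linear_sum big1 ?linear0 // => l _ /=; rewrite -Dd Hu linear0.
Qed.

End SimpleModules.

(** * The trace form of the twisted group ring *)

Section GaloisAction.

Variables (K : fieldType) (L : fieldExtType K) (gT : finGroupType).
Variable to : galAction L gT.
Local Notation N := (kernel to).

Lemma gact_mulr s y z : to (y * z) s = to y s * to z s.
Proof. by have [_ ->] := Defs.gactM to s. Qed.

Lemma gact_one s : to 1 s = 1.
Proof. by have [-> _] := Defs.gactM to s. Qed.

Lemma gactVK s y : to (to y s) s^-1%g = y.
Proof. by rewrite -gact_mulg mulgV gact_id. Qed.

Lemma gactKV s y : to (to y s^-1%g) s = y.
Proof. by rewrite -gact_mulg mulVg gact_id. Qed.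

Lemma kernelP s : reflect (forall y, to y s = y) (s \in N).
Proof. by rewrite inE; apply: asboolP. Qed.

Lemma kernel_group_set : group_set N.
Proof.
apply/group_setP; split; first by apply/kernelP=> y; rewrite gact_id.
move=> s t /kernelP Hs /kernelP Ht; apply/kernelP=> y.
by rewrite gact_mulg Hs Ht.
Qed.

Definition kernel_group : {group gT} := Group kernel_group_set.
Local Notation NG := kernel_group.

Definition coset_rep (t : gT) : gT := repr (NG :* t)%g.
(** Representatives of the cosets of the kernel stand for the elements of Gal(L/K); their number is
    h by [dim_transversal]. *)
Definition transversal_pred : pred gT := [pred t | coset_rep t == t].
Local Notation r := coset_rep.
Local Notation Rp := transversal_pred.

Lemma coset_rep_mem t : exists2 s, s \in N & r t = (s * t)%g.
Proof. by rewrite /coset_rep; have /rcosetP[s Ns ->] := mem_repr_rcoset NG t; exists s. Qed.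

Lemma coset_repM s t : s \in N -> r (s * t)%g = r t.
Proof.
move=> Ns; rewrite /coset_rep; congr repr.
by apply/rcoset_eqP; rewrite mem_rcoset mulgK.
Qed.

Lemma coset_repK t : r (r t) = r t.
Proof. by have [s Ns e] := coset_rep_mem t; rewrite [in LHS]e coset_repM. Qed.

Lemma coset_rep_mulV t : (t * (r t)^-1)%g \in N.
Proof.
have [s Ns ->] := coset_rep_mem t.
by rewrite invMg mulgA mulgV mul1g; apply: (groupVr (G := NG)).
Qed.

Lemma sum_transversal (V : nmodType) (F : gT -> V) :
  \sum_s F s = \sum_(t | Rp t) \sum_(s in N) F (s * t)%g.
Proof.
rewrite (partition_big r Rp) => [|s _]; last exact/eqP/coset_repK.
apply: eq_bigr => t /eqP rt.
rewrite (reindex (fun s => s * t)%g); last first.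
  by exists (fun s => s * t^-1)%g => s _; rewrite ?mulgK ?mulgKV.
apply: eq_bigl => s /=; apply/eqP/idP => [rst|Ns]; last by rewrite coset_repM.
by have := coset_rep_mulV (s * t)%g; rewrite rst mulgK.
Qed.

Lemma card_transversal : (#|Rp| * #|N|)%N = #|gT|.
Proof.
have := sum_transversal (fun=> 1%N).
rewrite sum1_card => ->; rewrite -sum_nat_const; apply: eq_bigr => t _.
by rewrite sum1_card.
Qed.

Lemma transversal_inj s t : Rp s -> Rp t -> (forall y, to y s = to y t) -> s = t.
Proof.
move=> /eqP rs /eqP rt e.
have Nst : (s * t^-1)%g \in N.
  by apply/kernelP=> y; rewrite gact_mulg e gactVK.
by rewrite -rs -(mulgKV t s) coset_repM.
Qed.

(** Artin's argument: comparing the relation at z y with its multiple by the conjugate of z under t1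
    removes the term at t1 and keeps the one at t0, which gives a shorter relation. *)
Lemma dedekind (e : gT -> L) : (forall y, \sum_(t | Rp t) e t * to y t = 0) ->
  forall t, Rp t -> e t = 0.
Proof.
have [m] := ubnP #|[pred t | Rp t & e t != 0]|.
elim: m e => // m IHm e lt_m He t0 Rt0; apply/eqP/contraT => et0.
have [[t1 [Rt1 et1 ne]]|H] := pselect (exists t1, [/\ Rp t1, e t1 != 0 & t1 != t0]).
  have [z nz] : exists z, to z t0 != to z t1.
    apply: contrapT => /forallNP H; case/eqP: ne; apply: transversal_inj => // y.
    by apply/esym/eqP; apply: contraT => nz; case: (H y nz).
  pose e' t := e t * (to z t - to z t1).
  suff : e' t0 = 0 by move/eqP; rewrite mulf_eq0 (negbTE et0) subr_eq0 (negbTE nz).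
  apply: IHm => // [|y].
    rewrite -ltnS; apply: leq_trans lt_m; rewrite ltnS; apply: proper_card; apply/properP; split.
      apply/fintype.subsetP=> t; rewrite !inE => /andP[-> ]; apply: contraNN => /eqP e0.
      by rewrite /e' e0 mul0r.
    by exists t1; rewrite !inE ?Rt1 ?et1 // /e' subrr mulr0 eqxx andbF.
  have E : \sum_(t | Rp t) e t * to (z * y) t - to z t1 * (\sum_(t | Rp t) e t * to y t) = 0.
    by rewrite !He mulr0 subrr.
  rewrite -[RHS]E mulr_sumr -sumrB; apply: eq_bigr => t _.
  by rewrite /e' gact_mulr; ring.
have := He 1; rewrite (bigD1 t0) //= gact_one mulr1 big1 ?addr0 => [/eqP|t /andP[Rt nt]].
  by rewrite (negbTE et0).
have [->|et] := eqVneq (e t) 0; first by rewrite mul0r.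
by case: H; exists t.
Qed.

Lemma gact_fixedP y : (forall s, to y s = y) -> exists c, y = c%:A.
Proof. by move=> /(gact_fixed to y)/vlineP. Qed.

(** L is irreducible under the operators y |-> sum of the y^s a_s, and its endomorphisms are the
    multiplications by elements of the fixed field K. Density over K therefore isolates a single
    basis vector. *)
Lemma gact_density m (b : 'I_m -> L) : free_basis ( *:%R : K -> L -> L) setT setT b ->
  forall j, exists a : gT -> L, forall l, \sum_s to (b l) s * a s = (l == j)%:R.
Proof.
move=> hb j; pose act (_ : unit) (a : gT -> L) y := \sum_s to y s * a s.
have actB (i : unit) a y z : act i a (y - z) = act i a y - act i a z.
  by rewrite -sumrB; apply: eq_bigr => s _; rewrite gactB mulrBl.
have actM i a b' y : act i b' (act i a y) =
    act i (fun t => \sum_s to (a (t * s^-1)%g) s * b' s) y.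
  rewrite /act; under [RHS]eq_bigr => t _ do rewrite mulr_sumr.
  rewrite exchange_big /=; apply: eq_bigr => s _.
  rewrite [RHS](reindex_inj (mulIg s)) /= gact_sum mulr_suml; apply: eq_bigr => t _.
  by rewrite mulgK gact_mulr gact_mulg mulrA.
pose e1 (z : L) := fun s : gT => if s == 1%g then z else 0.
have act1 i z y : act i (e1 z) y = y * z.
  rewrite /act (bigD1 1%g) //= /e1 eqxx gact_id big1 ?addr0 // => s /negbTE->.
  by rewrite mulr0.
pose s0 := [seq l <- enum 'I_m | l != j].
have [a0 Ha0 nz] : exists2 a, all (fun k => act tt a (b k) == 0) s0 & act tt a (b j) != 0.
  apply: contrapT => H.
  pose P (_ : unit) := [set y : L | exists2 c : 'I_m -> K, c j = 0 & y = \sum_l c l *: b l].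
  have [c cj ej] : P tt (b j).
    apply: (@jacobson_density unit (fun=> L) (fun=> setT) (gT -> L) act
      _ _ _ _ _ _ _ _ 'I_m (fun=> tt) b s0) => //.
    - by move=> a c; exists (fun s => a s - c s) => i y _; rewrite /act -sumrB;
        apply: eq_bigr => s _; rewrite mulrBr.
    - by move=> a c; eexists => i y _; rewrite actM.
    - by exists (e1 1) => i y _; rewrite act1 mulr1.
    - by move=> i y z _ y0 _; exists (e1 (y^-1 * z)); rewrite act1 mulrA divff ?mul1r.
    - move=> a Ha; apply/eqP; apply: contraT => nz; case: H; by exists a.
    - split.
      + by move=> i; exists (fun=> 0) => //; rewrite big1 // => l _; rewrite scale0r.
      + move=> i y z [c cj ->] [c' c'j ->]; exists (fun l => c l - c' l).
          by rewrite cj c'j subrr.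
        by rewrite -sumrB; apply: eq_bigr => l _; rewrite scalerBl.
      + move=> [] [] f y [_ _ fA] _ [c cj ->].
        have fM z : f z = f 1 * z by rewrite -[in LHS](mul1r z) -(act1 tt) fA // act1.
        have [d ed] : exists d, f 1 = d%:A.
          apply: gact_fixedP => s.
          have := fA (fun t => if t == s then 1 else 0) 1 Logic.I.
          have aE z : act tt (fun t => if t == s then 1 else 0) z = to z s.
            rewrite /act (bigD1 s) //= eqxx mulr1 big1 ?addr0 // => t /negbTE->.
            by rewrite mulr0.
          by rewrite !aE gact_one.
        exists (fun l => d * c l); first by rewrite cj mulr0.
        rewrite fM ed mulr_algl scaler_sumr; apply: eq_bigr => l _.
        by rewrite scalerA.
    - move=> l; rewrite mem_filter => /andP[nlj _]; exists (fun k => (k == l)%:R).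
        by rewrite eq_sym (negbTE nlj).
      rewrite (bigD1 l) //= eqxx scale1r big1 ?addr0 // => k /negbTE->.
      by rewrite scale0r.
  have [_ /(_ (b j) Logic.I)[a [_ aU]]] := hb.
  have e' : a = finfun c.
    by apply: aU; split=> //; rewrite {1}ej; apply: eq_bigr => l _; rewrite ffunE.
  have e'' : a = [ffun l => (l == j)%:R].
    apply: aU; split=> //; rewrite (bigD1 j) //= ffunE eqxx scale1r big1 ?addr0 // => k /negbTE nk.
    by rewrite ffunE nk scale0r.
  have /ffunP/(_ j) := e'; rewrite e'' !ffunE eqxx cj => /eqP.
  by rewrite oner_eq0.
exists (fun t => \sum_s to (a0 (t * s^-1)%g) s * e1 (act tt a0 (b j))^-1 s) => l.
rewrite -[LHS]/(act tt _ (b l)) -actM act1.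
have [->|nlj] := eqVneq l j; first by rewrite divff.
rewrite (eqP (allP Ha0 l _)) ?mul0r // mem_filter nlj mem_enum //.
Qed.

End GaloisAction.

Lemma mxtrace_diagonalized (F : fieldType) m p (M : 'M[F]_m) (V : 'M_(m, p))
    (W : 'M_(p, m)) (D : 'M_p) :
  V *m W = 1%:M -> W *m V = 1%:M -> M *m V = V *m D -> \tr M = \tr D.
Proof.
move=> VW WV MV.
by rewrite -[M]mulmx1 -VW mulmxA MV -mulmxA mxtrace_mulC -mulmxA WV mulmx1.
Qed.

Lemma vspace_free_basis (K : fieldType) (X : vectType K) (U : {vspace X}) (M : set X) :
  (forall x, x \in U <-> M x) ->
  free_basis ( *:%R : K -> X -> X) setT M (fun j : 'I_(\dim U) => (vbasis U)`_j).
Proof.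
move=> HU; split=> [j|x /HU Ux].
  by apply/HU/vbasis_mem/memt_nth.
have fr := basis_free (vbasisP U).
have ex : x = \sum_j coord (vbasis U) j x *: (vbasis U)`_j.
  by apply: coord_span; rewrite (span_basis (vbasisP U)).
exists [ffun j => coord (vbasis U) j x]; split.
  by split=> //; rewrite {1}ex; apply: eq_bigr => j _; rewrite ffunE.
by move=> c [_ ->]; apply/ffunP=> j; rewrite ffunE coord_sum_free.
Qed.

(** * The trace of L over K as a sum of conjugates, and the trace form *)

Section GaloisTrace.

Variables (K : fieldType) (L : fieldExtType K) (gT : finGroupType).
Variable to : galAction L gT.
Local Notation N := (kernel to).
Local Notation Rp := (transversal_pred to).

Lemma big_transversal (V : nmodType) (F : gT -> V) :
  \sum_(t | Rp t) F t = \sum_(i < #|Rp|) F (enum_val i).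
Proof. by rewrite -(big_enum_val (A := Rp)). Qed.

Definition galois_mx m (b : 'I_m -> L) : 'M[L]_(m, #|Rp|) :=
  \matrix_(j, t) to (b j) (enum_val t).

(** Density supplies a right inverse W. Each column of [W *m V - 1%:M] is a relation between the
    conjugations, so it vanishes by [dedekind]. *)
Lemma galois_mx_inv m (b : 'I_m -> L) :
  free_basis ( *:%R : K -> L -> L) setT setT b ->
  exists W, galois_mx b *m W = 1%:M /\ W *m galois_mx b = 1%:M.
Proof.
move=> hb; set V := galois_mx b.
have [a Ha] := choice (gact_density to hb).
pose W : 'M[L]_(#|Rp|, m) := \matrix_(t, j) \sum_(s in N) a j (s * enum_val t)%g.
have VW : V *m W = 1%:M.
  apply/matrixP=> l j; rewrite !mxE -Ha (sum_transversal to) big_transversal.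
  apply: eq_bigr => t _; rewrite !mxE mulr_sumr; apply: eq_bigr => s /kernelP Ns.
  by rewrite gact_mulg Ns.
exists W; split=> //; apply/eqP; rewrite -subr_eq0; apply/eqP/matrixP=> t j.
rewrite [RHS]mxE; set Y := W *m V - 1%:M.
have VY : V *m Y = 0 by rewrite mulmxBr mulmxA VW mul1mx mulmx1 subrr.
pose e (s : gT) := if [pick t | enum_val t == s] is Some t then Y t j else 0.
have eE t' : e (enum_val t') = Y t' j.
  rewrite /e; case: pickP => [t'' /eqP/enum_val_inj-> //|/(_ t')].
  by rewrite eqxx.
rewrite -eE; apply: (@dedekind _ _ _ to); last by have := enum_valP t.
move=> y; have [_ /(_ y Logic.I)[c [[_ ->] _]]] := hb.
rewrite big_transversal.
under eq_bigr => t' _ do rewrite gact_sum mulr_sumr.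
rewrite exchange_big big1 //= => l _.
have E : \sum_k V l k * Y k j = 0.
  by have /matrixP/(_ l j) := VY; rewrite mxE [RHS]mxE.
transitivity (c l *: (\sum_k V l k * Y k j)); last by rewrite E scaler0.
rewrite scaler_sumr; apply: eq_bigr => t' _.
by rewrite gact_scale eE -scalerAr mulrC [V _ _]mxE.
Qed.

Lemma dim_transversal : \dim {:L} = #|Rp|.
Proof.
have [|W [VW WV]] := @galois_mx_inv _ (fun j : 'I_(\dim {:L}) => (vbasis {:L})`_j).
  by apply: vspace_free_basis => x; split=> // _; exact: memvf.
by apply/eqP; rewrite eqn_leq (mulmx1_min VW) (mulmx1_min WV).
Qed.

(** The Galois matrix diagonalises multiplication by y, with the conjugates of y on the diagonal. *)
Lemma is_trace_gact y c : is_trace setT ( *%R y) c -> c%:A = \sum_(t | Rp t) to y t.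
Proof.
case=> m [b [M [hb Mb ->]]]; have [W [VW WV]] := galois_mx_inv hb.
rewrite big_transversal -in_algE -trace_map_mx.
pose D : 'M[L]_#|Rp| := diag_mx (\row_t to y (enum_val t)).
rewrite (mxtrace_diagonalized (D := D) VW WV).
  by rewrite mxtrace_diag; apply: eq_bigr => t _; rewrite mxE.
apply/matrixP=> j t; rewrite mul_mx_diag !mxE mulrC -gact_mulr Mb gact_sum.
by apply: eq_bigr => l _; rewrite !mxE gact_scale mulr_algl.
Qed.

Lemma is_trace_exists y : exists c, is_trace setT ( *%R y : L -> L) c.
Proof.
have [|b0 b1] := @vspace_free_basis _ _ {:L} setT; first by split=> // _; exact: memvf.
have H j : exists c : {ffun 'I_(\dim {:L}) -> K},
    y * (vbasis {:L})`_j = \sum_l c l *: (vbasis {:L})`_l.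
  by have [c [[_ ec] _]] := b1 (y * (vbasis {:L})`_j) Logic.I; exists c.
have [c Hc] := choice H.
pose M : 'M[K]_(\dim {:L}) := \matrix_(j, l) c j l.
exists (\tr M), (\dim {:L}), (fun j => (vbasis {:L})`_j), M; split=> // j.
by rewrite Hc; apply: eq_bigr => l _; rewrite mxE.
Qed.

Definition gtrace (y : L) : K := projT1 (cid (is_trace_exists y)).

Lemma gtraceE y : (gtrace y)%:A = \sum_(t | Rp t) to y t.
Proof. by rewrite /gtrace; case: cid => c /= /is_trace_gact. Qed.

Let in_alg_inj : injective (fun c : K => c%:A : L).
Proof. exact: fmorph_inj (in_alg L). Qed.

Lemma is_trace_gtrace y c : is_trace setT ( *%R y : L -> L) c <-> c = gtrace y.
Proof.
split=> [/is_trace_gact e|->]; first by apply: in_alg_inj; rewrite e gtraceE.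
by rewrite /gtrace; case: cid.
Qed.

Lemma gtraceD : {morph gtrace : y z / y + z}.
Proof.
move=> y z; apply: in_alg_inj; rewrite scalerDl !gtraceE -big_split.
by apply: eq_bigr => t _; rewrite gactD.
Qed.

Lemma gtraceZ c y : gtrace (c *: y) = c * gtrace y.
Proof.
apply: in_alg_inj; rewrite -scalerA !gtraceE scaler_sumr.
by apply: eq_bigr => t _; rewrite gact_scale.
Qed.

Lemma gtrace_kernel y : (#|N|%:R * gtrace y)%:A = \sum_s to y s.
Proof.
rewrite -scalerA gtraceE (sum_transversal to) scaler_nat -sumrMnl.
apply: eq_bigr => t _; rewrite (eq_bigr (fun=> to y t)) ?sumr_const //.
by move=> s /kernelP Ns; rewrite gact_mulg Ns.
Qed.

Hypothesis hn : #|N|%:R != 0 :> K.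

Lemma gtrace_gact y s : gtrace (to y s) = gtrace y.
Proof.
apply: (mulfI hn); apply: in_alg_inj; rewrite !gtrace_kernel.
rewrite [RHS](reindex_inj (mulgI s)) /=; apply: eq_bigr => t _.
by rewrite gact_mulg.
Qed.

Lemma gtrace_nondeg y : (forall z, gtrace (y * z) = 0) -> y = 0.
Proof.
move=> Hy; apply/eqP/contraT => y0.
have /= := @dedekind _ _ _ to (fun=> 1) _ (coset_rep to 1%g).
rewrite /transversal_pred /= coset_repK eqxx => H.
have : (1 : L) = 0.
  apply: H => // z; rewrite -[RHS](scale0r (1 : L)) -(Hy (y^-1 * z)) gtraceE.
  by apply: eq_bigr => t _; rewrite mul1r mulrA divff ?mul1r.
by move/eqP; rewrite oner_eq0.
Qed.

Definition tform (a : twisted to) : K := gtrace (a 1%g).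

Lemma tformD : {morph tform : a b / a + b}.
Proof. by move=> a b; rewrite /tform ffunE gtraceD. Qed.

Lemma tformZ c a : tform (c *: a) = c * tform a.
Proof. by rewrite /tform ffunE gtraceZ. Qed.

Lemma tform_mul a b : tform (a * b) = \sum_s gtrace (to (a s^-1%g) s * b s).
Proof.
rewrite /tform ffunE (big_morph gtrace gtraceD (id1 := 0)); last first.
  by rewrite -(scale0r (0 : L)) gtraceZ mul0r.
by apply: eq_bigr => s _; rewrite mul1g.
Qed.

Lemma tform_mul_tw a s z : tform (a * tw to s z) = gtrace (to (a s^-1%g) s * z).
Proof.
rewrite tform_mul (bigD1 s) //= ffunE eqxx big1 ?addr0 // => t /negbTE nt.
by rewrite ffunE nt mulr0 -(scale0r (0 : L)) gtraceZ mul0r.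
Qed.

Lemma tform_nondeg a : (forall b, tform (a * b) = 0) -> a = 0.
Proof.
move=> Ha; apply/ffunP=> s; rewrite ffunE.
have : to (a s) s^-1%g = 0.
  by apply: gtrace_nondeg => z; rewrite -[s in a s]invgK -tform_mul_tw.
by move/(congr1 (fun y => to y s)); rewrite gactKV gact0.
Qed.

End GaloisTrace.

(** * Induced representations *)

Section FinMatrix.

Variables (F : fieldType) (J : finType).

Definition fin_mx (f : J -> J -> F) : 'M[F]_#|J| :=
  \matrix_(x, y) f (enum_val x) (enum_val y).

Lemma fin_mxM f g : fin_mx f *m fin_mx g = fin_mx (fun x z => \sum_y f x y * g y z).
Proof.
apply/matrixP=> x z; rewrite !mxE [RHS]big_enum_val /=.
by apply: eq_bigr => y _; rewrite !mxE.
Qed.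

Lemma fin_mx1 : fin_mx (fun x y => (x == y)%:R) = 1%:M.
Proof. by apply/matrixP=> x y; rewrite !mxE (inj_eq enum_val_inj). Qed.

Lemma mxtrace_fin_mx f : \tr (fin_mx f) = \sum_x f x x.
Proof. by rewrite big_enum_val; apply: eq_bigr => x _; rewrite mxE. Qed.

End FinMatrix.

Section InducedRepresentation.

Variables (K : fieldType) (L : fieldExtType K) (gT : finGroupType).
Variable to : galAction L gT.
Local Notation N := (kernel to).
Local Notation NG := (kernel_group to).
Local Notation Rp := (transversal_pred to).
Variables (E : fieldType) (iota : {rmorphism L -> E}).
Variables (n : nat) (chi : mx_representation E NG n).

Local Notation J := ('I_#|Rp| * 'I_n)%type.

(** The entry (p, q) of the block (s, t) of the representation induced from chi, where L acts on the
    block of t through iota composed with t^-1. *)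
Definition ind_coef (a : twisted to) (s t : gT) (p q : 'I_n) : E :=
  \sum_(x in N) chi x p q * iota (to (a (s^-1 * x * t)%g) t^-1%g).

Definition ind_mx (a : twisted to) : 'M[E]_#|{: J}| :=
  fin_mx (fun x y : J => ind_coef a (enum_val x.1) (enum_val y.1) x.2 y.2).

Lemma ind_mxD a b : ind_mx (a + b) = ind_mx a + ind_mx b.
Proof.
apply/matrixP=> x y; rewrite !mxE /ind_coef -big_split; apply: eq_bigr => z _.
by rewrite ffunE gactD rmorphD mulrDr.
Qed.

Lemma ind_mxZ c a : ind_mx (c *: a) = iota c%:A *: ind_mx a.
Proof.
apply/matrixP=> x y; rewrite !mxE /ind_coef mulr_sumr; apply: eq_bigr => z _.
by rewrite ffunE gact_scale mulrCA -rmorphM mulr_algl.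
Qed.

(** Every element of G is uniquely a product of an element of N and a representative t. The
    convolution product is resummed along this factorisation; chi is multiplicative on N, and N acts
    trivially on L. *)
Lemma ind_mxM a b : ind_mx (a * b) = ind_mx a *m ind_mx b.
Proof.
rewrite fin_mxM; apply/matrixP=> x y; rewrite !mxE.
move: (enum_val x) (enum_val y) => [s' p] [u' r'] /=.
set s := enum_val s'; set u := enum_val u'.
rewrite -(pair_bigA _ (fun t q => ind_coef a s (enum_val t) p q * ind_coef b (enum_val t) u q r')) /=.
rewrite -(big_transversal to (fun t => \sum_q ind_coef a s t p q * ind_coef b t u q r')).
pose F t x y := \sum_q chi x p q * iota (to (a (s^-1 * x * t)%g) t^-1%g) *
  (chi y q r' * iota (to (b (t^-1 * y * u)%g) u^-1%g)).
transitivity (\sum_(t | Rp t) \sum_(x in N) \sum_(y in N) F t x y); last first.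
  apply: eq_bigr => t _; rewrite [LHS](eq_bigr (fun x => \sum_q \sum_(y in N)
    chi x p q * iota (to (a (s^-1 * x * t)%g) t^-1%g) *
    (chi y q r' * iota (to (b (t^-1 * y * u)%g) u^-1%g)))); last first.
    by move=> x0 _; rewrite exchange_big.
  rewrite exchange_big; apply: eq_bigr => q _.
  by rewrite /ind_coef mulr_suml; apply: eq_bigr => x0 _; rewrite mulr_sumr.
have FE t x0 y0 : x0 \in N -> y0 \in N -> F t x0 y0 = chi (x0 * y0)%g p r' *
    iota (to (a (s^-1 * x0 * t)%g) t^-1%g * to (b (t^-1 * y0 * u)%g) u^-1%g).
  move=> Nx Ny; rewrite repr_mxM // mxE mulr_suml; apply: eq_bigr => q _.
  by rewrite rmorphM mulrACA.
have NM x0 y0 : y0 \in N -> ((x0 * y0)%g \in N) = (x0 \in N).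
  exact: (groupMr (G := NG)).
have NV x0 : (x0^-1%g \in N) = (x0 \in N) by exact: (groupV NG).
transitivity (\sum_(t | Rp t) \sum_(y0 in N) \sum_(x0 in N) chi x0 p r' *
    iota (to (a (s^-1 * x0 * y0 * t)%g) t^-1%g * to (b (t^-1 * y0^-1 * u)%g) u^-1%g)).
  transitivity (\sum_(x0 in N) \sum_(t | Rp t) \sum_(y0 in N) chi x0 p r' *
    iota (to (a (s^-1 * x0 * y0 * t)%g) t^-1%g * to (b (t^-1 * y0^-1 * u)%g) u^-1%g)).
    apply: eq_bigr => x0 Nx; rewrite ffunE gact_sum rmorph_sum mulr_sumr.
    rewrite (reindex (fun z => z^-1 * u)%g); last first.
      exists (fun z => u * z^-1)%g => z _; first by rewrite invMg invgK mulKVg.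
      by rewrite invMg invgK mulgKV.
    rewrite (sum_transversal to); apply: eq_bigr => t _; apply: eq_bigr => y0 Ny.
    rewrite gact_mulr; congr (_ * iota (_ * _)).
      have /kernelP Ny' : (y0^-1%g \in N) by rewrite NV.
      by rewrite !invMg !invgK !mulgA mulgK -gact_mulg mulgK gact_mulg Ny'.
    by rewrite invMg.
  rewrite exchange_big; apply: eq_bigr => t _; exact: exchange_big.
apply: eq_bigr => t _; rewrite (reindex_inj invg_inj) /=.
rewrite (eq_bigl (mem N)) => [|y0]; last exact: NV.
rewrite [RHS]exchange_big; apply: eq_bigr => y0 Ny /=.
rewrite (reindex_inj (mulIg y0)) /= (eq_bigl (mem N)) => [|x0]; last exact: NM.
apply: eq_bigr => x0 Nx; rewrite FE // invgK; congr (_ * iota (to (a _) _ * _)).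
by rewrite !mulgA mulgK.
Qed.

Lemma ind_mx1 : ind_mx 1 = 1%:M.
Proof.
rewrite -fin_mx1; apply/matrixP=> x y; rewrite !mxE.
move: (enum_val x) (enum_val y) => [s p] [t q] /=; rewrite /ind_coef.
have Rs := enum_valP s; have Rt := enum_valP t; rewrite -!topredE /= in Rs Rt.
have N1 : (1%g \in N) by exact: (group1 NG).
have [<-|nst] := eqVneq s t.
  rewrite (bigD1 1%g) //= mulg1 mulVg ffunE eqxx gact_one rmorph1 mulr1.
  have -> : chi 1%g = 1%:M by exact: repr_mx1.
  rewrite mxE xpair_eqE eqxx /= big1 ?addr0 // => z /andP[_ nz].
  rewrite ffunE ifN ?gact0 ?rmorph0 ?mulr0 //.
  by apply: contra nz => /eqP e; rewrite -(mulKVg (enum_val s) z) -(mulgK (enum_val s) (_ * z)%g) e mul1g mulgV.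
rewrite xpair_eqE (negbTE nst) /= big1 // => z Nz.
rewrite ffunE ifN ?gact0 ?rmorph0 ?mulr0 //; apply: contra nst => /eqP e.
apply/eqP/enum_val_inj; apply: (transversal_inj Rs Rt) => w.
have -> : enum_val s = (z * enum_val t)%g.
  by rewrite -[LHS]mulg1 -e !mulgA mulgV mul1g.
by rewrite gact_mulg; move/kernelP: Nz => ->.
Qed.

Lemma mxtrace_ind_mx a : \tr (ind_mx a) = \sum_(t | Rp t) \sum_(x in N)
  \tr (chi x) * iota (to (a (t^-1 * x * t)%g) t^-1%g).
Proof.
rewrite mxtrace_fin_mx -(pair_bigA _ (fun t p => ind_coef a (enum_val t) (enum_val t) p p)) /=.
rewrite big_transversal; apply: eq_bigr => t _; rewrite exchange_big /=.
by apply: eq_bigr => x _; rewrite mulr_suml.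
Qed.

End InducedRepresentation.

(** * The twisted group ring over a splitting field of the kernel *)

Section SplitTwisted.

Variables (K : fieldType) (L : fieldExtType K) (gT : finGroupType).
Variable to : galAction L gT.
Local Notation N := (kernel to).
Local Notation NG := (kernel_group to).
Local Notation Rp := (transversal_pred to).
Local Notation A := (twisted to).
Hypothesis hn : #|N|%:R != 0 :> K.
Variables (E : fieldType) (iota : {rmorphism L -> E}).
Hypothesis splitE : group_splitting_field E NG.
Variable sG : irrType E NG.

Local Notation deg i := (irr_degree (i : sG)).
Local Notation rho i := (ind_mx iota (irr_repr (i : sG))).
Local Notation mdim i := #|{: 'I_#|Rp| * 'I_(deg i)}|.

Definition iotaK (c : K) : E := iota c%:A.

Lemma iotaK_rmorph : zmod_morphism iotaK /\ monoid_morphism iotaK.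
Proof.
split; first by move=> c d; rewrite /iotaK scalerBl rmorphB.
split; first by rewrite /iotaK scale1r rmorph1.
by move=> c d; rewrite /iotaK -rmorphM mulr_algl scalerA.
Qed.

HB.instance Definition _ := GRing.isZmodMorphism.Build K E iotaK iotaK_rmorph.1.
HB.instance Definition _ := GRing.isMonoidMorphism.Build K E iotaK iotaK_rmorph.2.

Lemma splitting_pchar : ([pchar E]^'.-group NG)%g.
Proof.
rewrite /pgroup pcharf'_nat -(rmorph_nat iotaK) fmorph_eq0.
exact: hn.
Qed.

Lemma mxtrace_regular_repr x : x \in N ->
  \tr (regular_repr E NG x) = if x == 1%g then #|N|%:R else 0.
Proof.
move=> Nx; rewrite /mxtrace; transitivity (\sum_(i < #|NG|) (x == 1%g)%:R : E); last first.
  by rewrite sumr_const card_ord; case: eqP => _; rewrite ?mul0rn.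
apply: eq_bigr => i _; rewrite !mxE eqxx /=; congr (nat_of_bool _)%:R.
have Ni := enum_valP i; apply/eqP/eqP => [e|->].
  have NGx : x \in NG by [].
  have := @gring_indexK _ NG _ (groupM Ni NGx); rewrite -e.
  by move=> E1; apply: (mulgI (enum_val i)); rewrite mulg1 -E1.
by rewrite mulg1; apply: enum_val_inj; exact/esym/(@gring_indexK _ NG).
Qed.

(** The sum of the irreducible characters of N weighted by their degrees is the regular character, n
    at 1 and 0 elsewhere. So only the coefficient of a at 1 survives, summed over its conjugates. *)
Lemma ind_trace_formula a :
  \sum_i (deg i)%:R * \tr (rho i a) = iotaK (#|N|%:R * tform a).
Proof.
under eq_bigr => i _ do rewrite mxtrace_ind_mx mulr_sumr.
rewrite exchange_big /=.
transitivity (\sum_(t | Rp t) #|N|%:R * iota (to (a 1%g) t^-1%g)).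
  apply: eq_bigr => t _.
  under eq_bigr => i _ do rewrite mulr_sumr.
  rewrite exchange_big /=.
  have N1 : 1%g \in N by exact: (group1 NG).
  rewrite (bigD1 1%g) //= [X in _ + X]big1 ?addr0.
    rewrite mulg1 mulVg.
    under eq_bigr => i _ do rewrite mulrA.
    rewrite -mulr_suml; congr (_ * _).
    have := mxtrace_regular_repr N1; rewrite eqxx => <-.
    rewrite (mxtrace_regular_pchar sG splitting_pchar splitE) //.
    by apply: eq_bigr => i _; rewrite mulr_natl.
  move=> x /andP[Nx nx1].
  under eq_bigr => i _ do rewrite mulrA.
  rewrite -mulr_suml.
  have := mxtrace_regular_repr Nx; rewrite (negbTE nx1) => E0.
  rewrite (_ : \sum_i _ = 0) ?mul0r //; apply: etrans E0.
  rewrite (mxtrace_regular_pchar sG splitting_pchar splitE) //.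
  by apply: eq_bigr => i _; rewrite mulr_natl.
rewrite /iotaK gtrace_kernel [in RHS](reindex_inj invg_inj) /= [in RHS](sum_transversal to) [in RHS]rmorph_sum.
apply: eq_bigr => t _; rewrite rmorph_sum mulr_natl -sumr_const.
apply: eq_bigr => x Nx /=; rewrite invMg gact_mulg.
have /kernelP -> // : (x^-1%g \in N) by rewrite (groupV NG).
Qed.

Definition tbasis (k : 'I_(\dim {:A})) : A := (vbasis {:A})`_k.

Lemma tbasis_free : free_basis ( *:%R : K -> A -> A) setT setT tbasis.
Proof. by apply: vspace_free_basis => a; split=> // _; exact: memvf. Qed.

Definition gram_mx m (b : 'I_m -> A) : 'M[K]_m := \matrix_(k, l) tform (b k * b l).

Lemma tform_sum (I : finType) (F : I -> A) : tform (\sum_i F i) = \sum_i tform (F i).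
Proof.
apply: (big_morph _ (tformD (to := to))); rewrite -(scale0r (0 : A)) tformZ.
exact: mul0r.
Qed.

Lemma gram_unit m (b : 'I_m -> A) :
  free_basis ( *:%R : K -> A -> A) setT setT b -> gram_mx b \in unitmx.
Proof.
move=> hb; rewrite -row_free_unit -kermx_eq0; apply/eqP/row_matrixP=> i.
rewrite row0; set u := row i _.
have uG : u *m gram_mx b = 0 by rewrite -row_mul mulmx_ker row0.
have H0 : rowc b u = 0.
  apply: tform_nondeg => a.
  have [_ /(_ a Logic.I)[c [[_ ->] _]]] := hb.
  rewrite mulr_sumr tform_sum big1 // => l _.
  rewrite -scalerAr tformZ; have /rowP/(_ l) := uG; rewrite [RHS]mxE mxE => El.
  rewrite /rowc mulr_suml tform_sum -[X in _ * X](_ : \sum_k u 0 k * gram_mx b k l = _).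
    by rewrite El mulr0.
  by apply: eq_bigr => k _; rewrite -scalerAl tformZ [gram_mx _ _ _]mxE.
apply: (rowc_inj (U := setT) _ _ _ hb) => //.
by rewrite H0 /rowc big1 // => k _; rewrite mxE scale0r.
Qed.

Local Notation J := {i : sG & ('I_(mdim i) * 'I_(mdim i))%type}.

Definition rho_mx : 'M[E]_(\dim {:A}, #|{: J}|) := \matrix_(k, x)
  rho (tag (enum_val x)) (tbasis k) (tagged (enum_val x)).1 (tagged (enum_val x)).2.

(** Multiplied by its transpose weighted with the degrees, the matrix of all representation
    coefficients becomes n times the Gram matrix of [tform] by the trace formula, and that matrix is
    invertible. *)
Lemma rho_mx_free : row_free rho_mx.
Proof.
pose Y : 'M[E]_(#|{: J}|, \dim {:A}) := \matrix_(x, k) ((deg (tag (enum_val x)))%:R *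
  rho (tag (enum_val x)) (tbasis k) (tagged (enum_val x)).2 (tagged (enum_val x)).1).
have XY : rho_mx *m Y = #|N|%:R *: map_mx iotaK (gram_mx tbasis).
  apply/matrixP=> k l; rewrite mxE.
  under eq_bigr => x _ do rewrite [rho_mx _ _]mxE [Y _ _]mxE.
  rewrite [RHS]mxE [map_mx _ _ _ _]mxE [gram_mx _ _ _]mxE.
  transitivity (iotaK (#|N|%:R * tform (tbasis k * tbasis l))); last first.
    by rewrite rmorphM rmorph_nat.
  rewrite -ind_trace_formula.
  pose F i (pq : 'I_(mdim i) * 'I_(mdim i)) := rho i (tbasis k) pq.1 pq.2 *
    ((deg i)%:R * rho i (tbasis l) pq.2 pq.1).
  transitivity (\sum_(x : J) F (tag x) (tagged x)); first by rewrite [RHS]big_enum_val.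
  transitivity (\sum_i \sum_pq F i pq); first by rewrite sig_big_dep.
  apply: eq_bigr => i _; rewrite ind_mxM /mxtrace mulr_sumr.
  rewrite -(pair_bigA _ (fun p q => rho i (tbasis k) p q * ((deg i)%:R * rho i (tbasis l) q p))) /=.
  apply: eq_bigr => p _; rewrite mxE mulr_sumr; apply: eq_bigr => q _.
  by rewrite mulrCA.
have uXY : rho_mx *m Y \in unitmx.
  rewrite XY unitmxZ ?map_unitmx ?(gram_unit tbasis_free) // unitfE -(rmorph_nat iotaK) fmorph_eq0.
  exact: hn.
by apply/row_freeP; exists (Y *m invmx (rho_mx *m Y)); rewrite mulmxA mulmxV.
Qed.

Lemma dim_twisted : \dim {:A} = (#|gT| * \dim {:L})%N.
Proof.
by rewrite !dimvf.
Qed.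

(** Each induced degree is h times the inducing one, and the squares of the latter add up to n; the
    total is h^2 n = g h. *)
Lemma sum_mdim_sq : (\sum_i mdim i ^ 2 = \dim {:A})%N.
Proof.
under eq_bigr => i _ do rewrite card_prod !card_ord expnMn.
rewrite -big_distrr /= (sum_irr_degree_pchar sG splitting_pchar splitE) dim_twisted.
by rewrite (dim_transversal to) -(card_transversal to) expnS expn1; ring.
Qed.

Lemma rho_mx_full : row_full rho_mx.
Proof.
have cJ : #|{: J}| = \dim {:A}.
  rewrite card_tagged sumnE big_map big_enum /= -sum_mdim_sq.
  by apply: eq_bigr => i _; rewrite card_prod card_ord.
by have /eqP rk := rho_mx_free; rewrite /row_full rk; apply/eqP/esym.
Qed.

(** The coefficient matrix [rho_mx] is square and invertible: over E the representations together
    map onto a product of full matrix rings, so their values can be prescribed simultaneously. *)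
Lemma rho_span (M : forall i : sG, 'M[E]_(mdim i)) :
  exists e : 'I_(\dim {:A}) -> E, forall i, M i = \sum_k e k *: rho i (tbasis k).
Proof.
pose w : 'rV[E]_#|{: J}| := \row_x M (tag (enum_val x)) (tagged (enum_val x)).1 (tagged (enum_val x)).2.
have /submxP[e ew] : (w <= rho_mx)%MS by apply: submx_full; exact: rho_mx_full.
exists (fun k => e 0 k) => i; apply/matrixP=> p q.
have /rowP/(_ (enum_rank (Tagged (fun i => ('I_(mdim i) * 'I_(mdim i))%type) (p, q) : J))) := ew.
rewrite !mxE !enum_rankK /= => ->; rewrite summxE; apply: eq_bigr => k _.
by rewrite !mxE enum_rankK.
Qed.

End SplitTwisted.

(** * Splittings and reduced traces *)

Lemma mx_comm_scalar (F : fieldType) m (M : 'M[F]_m.+1) :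
  (forall P : 'M_m.+1, M *m P = P *m M) -> is_scalar_mx M.
Proof.
move=> HM; apply/is_scalar_mxP; exists (M 0 0); apply/matrixP=> i j.
have /matrixP/(_ i 0) := HM (delta_mx j 0).
rewrite !mxE (bigD1 j) //= mxE !eqxx mulr1 big1 => [|k /negbTE nk]; last first.
  by rewrite mxE nk mulr0.
rewrite addr0 => ->; rewrite (bigD1 0) //= mxE eqxx andbT big1 ?addr0 => [|k /negbTE nk].
  by case: eqP => _; rewrite ?mul1r ?mul0r ?mulr1n ?mulr0n.
by rewrite mxE nk andbF mul0r.
Qed.

Section LfunSums.

Variables (K : fieldType) (X : vectType K) (I : Type) (r : seq I) (P : pred I).

Lemma comp_lfun_suml (F : I -> 'End(X)) (g : 'End(X)) :
  ((\sum_(i <- r | P i) F i) \o g = \sum_(i <- r | P i) (F i \o g))%VF.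
Proof.
by apply: (big_morph (fun f => f \o g)%VF) => [f h|]; [exact: comp_lfunDl|exact: comp_lfun0l].
Qed.

Lemma comp_lfun_sumr (F : I -> 'End(X)) (g : 'End(X)) :
  (g \o (\sum_(i <- r | P i) F i) = \sum_(i <- r | P i) (g \o F i))%VF.
Proof.
by apply: (big_morph (fun f => g \o f)%VF) => [f h|]; [exact: comp_lfunDr|exact: comp_lfun0r].
Qed.

End LfunSums.

Section CenterDual.

Variables (K : fieldType) (X : vectType K) (D : set 'End(X)).
Hypothesis hD : division_set D.
Hypothesis X1 : \1%VF != 0 :> 'End(X).

Let D1 : D \1%VF. Proof. by case: hD. Qed.
Let DB f g : D f -> D g -> D (f - g). Proof. by case: hD => _ H _ _ _; apply: H. Qed.
Let DM f g : D f -> D g -> D (f \o g)%VF. Proof. by case: hD => _ _ H _ _; apply: H. Qed.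
Let DZ c f : D f -> D (c *: f). Proof. by case: hD => _ _ _ H _; apply: H. Qed.
Let Dinv f : D f -> f != 0 -> exists g, [/\ D g, (f \o g)%VF = \1%VF & (g \o f)%VF = \1%VF].
Proof. by case: hD => _ _ _ _; apply. Qed.
Let D0 : D 0. Proof. exact: division_set0. Qed.
Let DN f : D f -> D (- f). Proof. by move=> Df; rewrite -sub0r; apply: DB. Qed.
Let DD f g : D f -> D g -> D (f + g). Proof. exact: division_setD. Qed.
Local Notation Z := (end_center D).

Lemma end_centerB f g : Z f -> Z g -> Z (f - g).
Proof.
move=> [Df Zf] [Dg Zg]; split; first exact: DB.
by move=> y Dy; rewrite comp_lfunDl comp_lfunDr comp_lfunNl comp_lfunNr Zf ?Zg.
Qed.

Lemma end_center0 : Z 0.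
Proof. by split=> // y _; rewrite comp_lfun0l comp_lfun0r. Qed.

Lemma end_center1 : Z \1%VF.
Proof. by split=> // y _; rewrite comp_lfun1l comp_lfun1r. Qed.

Lemma end_centerD f g : Z f -> Z g -> Z (f + g).
Proof.
move=> Zf Zg; rewrite -[g]opprK -[- g]sub0r; apply: end_centerB => //.
by apply: end_centerB => //; exact: end_center0.
Qed.

Lemma end_centerM f g : Z f -> Z g -> Z (f \o g)%VF.
Proof.
move=> [Df Zf] [Dg Zg]; split; first exact: DM.
by move=> y Dy; rewrite -comp_lfunA Zg // comp_lfunA Zf // -comp_lfunA.
Qed.

Lemma end_centerZ c f : Z f -> Z (c *: f).
Proof.
move=> [Df Zf]; split; first exact: DZ.
by move=> y Dy; rewrite -comp_lfunZl -comp_lfunZr Zf.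
Qed.

Variables (q : nat) (y : 'I_q -> 'End(X)).
Hypothesis hy : free_basis (@comp_lfun _ X X X) Z D y.

Lemma center_coord_inj (c d : 'I_q -> 'End(X)) :
  (forall j, Z (c j)) -> (forall j, Z (d j)) ->
  (\sum_j (c j \o y j) = \sum_j (d j \o y j))%VF -> forall j, c j = d j.
Proof.
move=> Zc Zd e j; have Dy : D (\sum_j (c j \o y j)%VF).
  apply: big_ind => // k _; apply: DM; [by case: (Zc k)|by case: hy].
have [_ /(_ _ Dy)[a [_ aU]]] := hy.
have ac : a = finfun c.
  by apply: aU; split=> [k|]; rewrite ?ffunE //; apply: eq_bigr => k _; rewrite ffunE.
have ad : a = finfun d.
  apply: aU; split=> [k|]; rewrite ?ffunE // e.
  by apply: eq_bigr => k _; rewrite ffunE.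
by have := erefl (a j); rewrite {1}ac ad !ffunE.
Qed.

Definition sandwich (s : seq ('End(X) * 'End(X))) (f : 'End(X)) : 'End(X) :=
  \sum_(p <- s) (p.1 \o f \o p.2)%VF.

Lemma sandwichB s f g : sandwich s (f - g) = sandwich s f - sandwich s g.
Proof.
rewrite /sandwich -sumrB; apply: eq_bigr => p _.
by rewrite comp_lfunDr comp_lfunNr comp_lfunDl comp_lfunNl.
Qed.

(* D is simple as a bimodule over itself, with endomorphisms the center, so   *)
(* the coordinate forms on a basis over the center are sums of maps           *)
(* y |-> a y b.                                                               *)
Lemma center_dual l : exists2 s, (forall p, p \in s -> D p.1 /\ D p.2) &
  forall j, sandwich s (y j) = if j == l then \1%VF else 0.
Proof.
pose B := {s : seq ('End(X) * 'End(X)) | forall p, p \in s -> D p.1 /\ D p.2}.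
pose act (_ : unit) (b : B) f := sandwich (projT1 b) f.
have actD i b f : D f -> D (act i b f).
  case: b => s Hs Df; rewrite /act /sandwich /= big_seq.
  by apply: big_ind => // p /Hs[]; move=> D1p D2p; do 2?apply: DM.
have mulB : forall b c : B, exists d : B, forall i f, D f -> act i d f = act i c (act i b f).
  move=> [s Hs] [t Ht].
  have Hst p : p \in [seq (x.1 \o z.1, z.2 \o x.2)%VF | x <- t, z <- s] -> D p.1 /\ D p.2.
    move=> /allpairsP[[x z] /= [/Ht[Dx1 Dx2] /Hs[Dz1 Dz2] ->]] /=.
    by split; apply: DM.
  exists (exist _ _ Hst) => i f _; rewrite /act /sandwich /= big_allpairs_dep.
  apply: eq_bigr => x _; rewrite comp_lfun_sumr comp_lfun_suml; apply: eq_bigr => z _ /=.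
  by rewrite !comp_lfunA.
have subB : forall b c : B, exists d : B, forall i f, D f -> act i d f = act i b f - act i c f.
  move=> [s Hs] [t Ht].
  have Hst p : p \in s ++ [seq (- x.1, x.2) | x <- t] -> D p.1 /\ D p.2.
    rewrite mem_cat => /orP[/Hs //|/mapP[x /Ht[Dx1 Dx2] ->]] /=.
    by split=> //; apply: DN.
  exists (exist _ _ Hst) => i f _; rewrite /act /sandwich /= big_cat big_map /=.
  congr (_ + _); rewrite -sumrN; apply: eq_bigr => x _.
  by rewrite !comp_lfunNl.
have single a b : D a -> D b -> exists c : B, forall i f, act i c f = (a \o f \o b)%VF.
  move=> Da Db; have Hs p : p \in [:: (a, b)] -> D p.1 /\ D p.2.
    by rewrite inE => /eqP->.
  by exists (exist _ _ Hs) => i f; rewrite /act /sandwich big_seq1.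
pose s0 := [seq j <- enum 'I_q | j != l].
have [b0 Hb0 nz] : exists2 b, all (fun j => act tt b (y j) == 0) s0 & act tt b (y l) != 0.
  apply: contrapT => H.
  pose P (_ : unit) := [set f | exists2 c : 'I_q -> 'End(X),
    (forall j, Z (c j)) /\ c l = 0 & f = \sum_j (c j \o y j)%VF].
  have Dyl j : D (y j) by case: hy.
  have [c [Zc cl] el] : P tt (y l).
    apply: (@jacobson_density unit (fun=> 'End(X)) (fun=> D) B act
      _ _ _ _ _ _ _ _ 'I_q (fun=> tt) y s0) => //.
    - by move=> i b f g _ _; exact: sandwichB.
    - have [c Hc] := single _ _ D1 D1; exists c => i f _.
      by rewrite Hc comp_lfun1l comp_lfun1r.
    - move=> i f g Df f0 Dg; have [f' [Df' ff' f'f]] := Dinv Df f0.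
      have [c Hc] := single _ _ (DM Dg Df') D1; exists c.
      by rewrite Hc comp_lfun1r -comp_lfunA f'f comp_lfun1r.
    - by move=> b Hb; apply/eqP; apply: contraT => nz; case: H; exists b.
    - split.
      + move=> i; exists (fun=> 0); first by split=> // j; exact: end_center0.
        by rewrite big1 // => j _; rewrite comp_lfun0l.
      + move=> i f g [c [Zc cl] ->] [d [Zd dl] ->]; exists (fun j => c j - d j).
          by split=> [j|]; [exact: end_centerB|rewrite cl dl subrr].
        by rewrite -sumrB; apply: eq_bigr => j _; rewrite comp_lfunDl comp_lfunNl.
      + move=> [] [] F f [FD _ Fact] Df [c [Zc cl] ->].
        have Fl a : D a -> F a = (a \o F \1)%VF.
          move=> Da; have [b Hb] := single _ _ Da D1.
          have := Fact b \1%VF D1; rewrite !(Hb tt) !comp_lfun1r => -> //.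
        have Fr a : D a -> F a = (F \1 \o a)%VF.
          move=> Da; have [b Hb] := single _ _ D1 Da.
          have := Fact b \1%VF D1; rewrite !(Hb tt) !comp_lfun1l => -> //.
        have ZF : Z (F \1%VF) by split; [exact: FD|move=> a Da; rewrite -Fl // -Fr].
        exists (fun j => F \1 \o c j)%VF.
          by split=> [j|]; [exact: end_centerM|rewrite cl comp_lfun0r].
        rewrite Fr; last first.
          by apply: big_ind => // j _; apply: DM => //; case: (Zc j).
        by rewrite comp_lfun_sumr; apply: eq_bigr => j _; rewrite comp_lfunA.
    - move=> j; rewrite mem_filter => /andP[njl _].
      exists (fun k => if k == j then \1%VF else 0).
        split=> [k|]; last by rewrite eq_sym (negbTE njl).
        by case: eqP => _; [exact: end_center1|exact: end_center0].
      rewrite (bigD1 j) //= eqxx comp_lfun1l big1 ?addr0 // => k /negbTE->.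
      by rewrite comp_lfun0l.
  have e1 : (\sum_j (c j \o y j) = \sum_j ((if j == l then \1 else 0) \o y j))%VF.
    rewrite -el (bigD1 l) //= eqxx comp_lfun1l big1 ?addr0 // => k /negbTE->.
    by rewrite comp_lfun0l.
  have /= := center_coord_inj Zc _ e1 l; rewrite eqxx cl => E.
  case/eqP: X1; rewrite E // => j.
  by case: eqP => _; [exact: end_center1|exact: end_center0].
have [g [Dg gf fg]] := Dinv (actD tt b0 _ (proj1 hy l)) nz.
have [c Hc] := single _ _ Dg D1; have [d Hd] := mulB b0 c.
exists (projT1 d) => [p|j]; first exact: (projT2 d).
rewrite -[LHS]/(act tt d (y j)) Hd ?Hc ?comp_lfun1r; last by case: hy.
have [->|njl] := eqVneq j l; first by [].
by rewrite (eqP (allP Hb0 j _)) ?comp_lfun0r // mem_filter njl mem_enum.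
Qed.

Section Splitting.

Variables (E : fieldType) (m : nat) (phi : 'End(X) -> 'M[E]_m.+1).
Hypothesis hphi : is_splitting D phi.

Lemma splittingD f g : D f -> D g -> phi (f + g) = phi f + phi g.
Proof. by case: hphi => H _ _ _ _; apply: H. Qed.

Lemma splittingM f g : D f -> D g -> phi (f \o g)%VF = phi f *m phi g.
Proof. by case: hphi => _ H _ _ _; apply: H. Qed.

Lemma splitting1 : phi \1%VF = 1%:M. Proof. by case: hphi. Qed.

Lemma splitting0 : phi 0 = 0.
Proof. by apply: (addrI (phi 0)); rewrite -splittingD // !addr0. Qed.

Lemma splittingN f : D f -> phi (- f) = - phi f.
Proof.
move=> Df; apply: (addrI (phi f)); rewrite subrr -splittingD ?subrr ?splitting0 //.
exact: DN.
Qed.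

Lemma splitting_sum (I : eqType) (r : seq I) (F : I -> 'End(X)) :
  (forall i, i \in r -> D (F i)) -> phi (\sum_(i <- r) F i) = \sum_(i <- r) phi (F i).
Proof.
elim: r => [|i r IHr] DF; first by rewrite !big_nil splitting0.
have DFi : D (F i) by apply: DF; rewrite inE eqxx.
have DFr j : j \in r -> D (F j) by move=> jr; apply: DF; rewrite inE jr orbT.
rewrite !big_cons splittingD // ?IHr //.
by rewrite big_seq; apply: big_ind.
Qed.

Lemma splitting_sandwich s f : (forall p, p \in s -> D p.1 /\ D p.2) -> D f ->
  phi (sandwich s f) = \sum_(p <- s) phi p.1 *m phi f *m phi p.2.
Proof.
move=> Ds Df; rewrite splitting_sum => [|p /Ds[D1p D2p]]; last by do 2?apply: DM.
rewrite big_seq [RHS]big_seq; apply: eq_bigr => p /Ds[D1p D2p].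
by rewrite !splittingM //; apply: DM.
Qed.

Lemma splitting_inj f : D f -> phi f = 0 -> f = 0.
Proof.
move=> Df f0; apply/eqP; apply: contraT => /(Dinv Df)[g [Dg fg _]].
have := splittingM Df Dg; rewrite fg splitting1 f0 mul0mx => /matrixP/(_ 0 0)/eqP.
by rewrite !mxE oner_eq0.
Qed.

Definition central_val (z : 'End(X)) : E := phi z 0 0.

Lemma central_valE z : Z z -> phi z = (central_val z)%:M.
Proof.
case: hphi => _ _ _ H _ /H/is_scalar_mxP[c ec].
by rewrite /central_val ec mxE eqxx mulr1n.
Qed.

Definition splitting_mx : 'M[E]_(q, m.+1 * m.+1) := \matrix_j mxvec (phi (y j)).

Lemma splitting_mx_full : row_full splitting_mx.
Proof.
rewrite -sub1mx; apply/row_subP=> k; rewrite row1.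
rewrite -[delta_mx 0 k]vec_mxK; move: (vec_mx _) => M.
case: hphi => _ _ _ _ /(_ M)[l [e [d [Dd ->]]]].
rewrite linear_sum; apply: summx_sub => j _; rewrite linearZ; apply: scalemx_sub.
have [_ /(_ _ (Dd j))[c [[Zc ->] _]]] := hy.
rewrite splitting_sum => [|i _]; last by apply: DM; [case: (Zc i)|case: hy].
rewrite linear_sum; apply: summx_sub => i _.
rewrite splittingM; [|by case: (Zc i)|by case: hy].
rewrite central_valE // mul_scalar_mx linearZ /=; apply: scalemx_sub.
by have <- : row i splitting_mx = mxvec (phi (y i)); [rewrite rowK|rewrite row_sub].
Qed.

(** The maps of [center_dual], transported by phi, isolate each coefficient of a relation between
    the [phi (y j)]. *)
Lemma splitting_mx_free : row_free splitting_mx.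
Proof.
rewrite -kermx_eq0; apply/eqP/row_matrixP=> i; rewrite row0.
set u := row i _; have uF : u *m splitting_mx = 0 by rewrite -row_mul mulmx_ker row0.
have Hu : \sum_j u 0 j *: phi (y j) = 0.
  apply: (can_inj mxvecK); rewrite linear0; apply: etrans uF.
  rewrite linear_sum mulmx_sum_row.
  by apply: eq_bigr => j _; rewrite linearZ rowK.
apply/rowP=> l; rewrite [RHS]mxE.
have [s Ds Hs] := center_dual l.
have Dyj j : D (y j) by case: hy.
have : \sum_(p <- s) phi p.1 *m (\sum_j u 0 j *: phi (y j)) *m phi p.2 = 0.
  by rewrite Hu big1 // => p _; rewrite mulmx0 mul0mx.
rewrite (eq_bigr (fun p => \sum_j u 0 j *: (phi p.1 *m phi (y j) *m phi p.2))); last first.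
  move=> p _; rewrite mulmx_sumr mulmx_suml; apply: eq_bigr => j _.
  by rewrite -scalemxAr -scalemxAl.
rewrite exchange_big (bigD1 l) //= [X in _ + X]big1.
  by rewrite -scaler_sumr -splitting_sandwich // Hs eqxx splitting1 addr0 scalemx1
    => /matrixP/(_ 0 0); rewrite !mxE mulr1n.
move=> j njl; rewrite -scaler_sumr -splitting_sandwich // Hs (negbTE njl).
by rewrite splitting0 scaler0.
Qed.

Lemma splitting_degree : q = (m.+1 * m.+1)%N.
Proof.
have /eqP r1 := splitting_mx_free; have /eqP r2 := splitting_mx_full.
by rewrite -{1}r1 r2.
Qed.

(* The Z-linear map y |-> x y x of D becomes M |-> phi x M phi x, of trace    *)
(* (tr (phi x))^2.                                                            *)
Lemma splitting_trace_sq x (c : 'I_q -> 'I_q -> 'End(X)) : D x ->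
  (forall j l, Z (c j l)) -> (forall j, x \o y j \o x = \sum_l (c j l \o y l))%VF ->
  phi (\sum_j c j j) = (\tr (phi x) ^+ 2)%:M.
Proof.
move=> Dx Zc Hc; set B := phi x; have Dyj j : D (y j) by case: hy.
pose C : 'M[E]_q := \matrix_(j, l) central_val (c j l).
pose G : 'M[E]_(m.+1 * m.+1) := lin_mx (mulmxr B \o mulmx B).
have CF : C *m splitting_mx = splitting_mx *m G.
  apply/row_matrixP=> j; rewrite !row_mul rowK mul_vec_lin /=.
  have <- : phi (x \o y j \o x)%VF = B *m phi (y j) *m B.
    by rewrite !splittingM //; apply: DM.
  rewrite Hc splitting_sum => [|l _]; last by apply: DM => //; case: (Zc j l).
  rewrite linear_sum mulmx_sum_row; apply: eq_bigr => l _.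
  rewrite splittingM //; last by case: (Zc j l).
  by rewrite central_valE // mul_scalar_mx linearZ /= !mxE rowK.
have /row_freeP[W FW] := splitting_mx_free.
have /row_fullP[W' W'F] := splitting_mx_full.
have WF : W *m splitting_mx = 1%:M.
  by rewrite -[W]mul1mx -W'F -[W' *m _ *m W]mulmxA FW mulmx1.
have trC : \tr C = \tr G.
  by rewrite -[C]mulmx1 -FW mulmxA CF -mulmxA mxtrace_mulC -mulmxA WF mulmx1.
have -> : phi (\sum_j c j j) = (\tr C)%:M.
  rewrite splitting_sum => [|j _]; last by case: (Zc j j).
  rewrite (eq_bigr (fun j => (central_val (c j j))%:M)); last by move=> j _; exact: central_valE.
  rewrite -raddf_sum /=; congr _%:M; apply: eq_bigr => j _; by rewrite mxE.
rewrite trC; congr _%:M; rewrite /mxtrace.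
transitivity (\sum_i \sum_j B i i * B j j); last first.
  by rewrite expr2 mulr_suml; apply: eq_bigr => i _; rewrite mulr_sumr.
rewrite (reindex _ (curry_mxvec_bij _ _)) /= pair_bigA /=.
apply: eq_bigr => [[i j]] _ /=; rewrite mxE /= mxvecE.
rewrite (_ : vec_mx _ = delta_mx i j); last first.
  by rewrite -[delta_mx i j]mxvecK mxvec_delta.
rewrite mxE (bigD1 j) //= big1 ?addr0 => [|k /negbTE nk].
  rewrite mxE (bigD1 i) //= mxE !eqxx mulr1 big1 ?addr0 // => k /negbTE nk.
  by rewrite mxE nk mulr0.
by rewrite mxE big1 ?mul0r // => l _; rewrite mxE nk andbF mulr0.
Qed.

End Splitting.

Lemma sandwich_coords x : D x -> exists2 c : 'I_q -> 'I_q -> 'End(X),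
  (forall j l, Z (c j l)) & (forall j, x \o y j \o x = \sum_l (c j l \o y l))%VF.
Proof.
move=> Dx; have Dyj j : D (y j) by case: hy.
have H j : exists c : {ffun 'I_q -> 'End(X)}, (forall l, Z (c l)) /\
    (x \o y j \o x = \sum_l (c l \o y l))%VF.
  have [_ /(_ (x \o y j \o x)%VF)[|c [Hc _]]] := hy; first by do 2?apply: DM.
  by exists c.
have [c Hc] := choice H.
by exists (fun j l => c j l) => [j l|j]; case: (Hc j).
Qed.

(* Dual lattices do not see the remaining sign. *)
Lemma reduced_trace_sign x z z' : D x -> is_reduced_trace D x z ->
  is_reduced_trace D x z' -> z' = z \/ z' = - z.
Proof.
move=> Dx [Zz [E [m [phi [hphi ez]]]]] [Zz' [E' [m' [phi' [hphi' ez']]]]].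
have [c Zc Hc] := sandwich_coords Dx.
have [Dz Cz] := Zz; have [Dz' Cz'] := Zz'.
have Zw : D (\sum_j c j j) by apply: big_ind => // j _; case: (Zc j j).
(* Both z and z' square to the trace over the center of y |-> x y x, which does not depend on the
   splitting; a skew field has no zero divisors, so they agree up to sign. *)
have sq1 : (z \o z)%VF = \sum_j c j j.
  apply/eqP; rewrite -subr_eq0; apply/eqP; apply: (splitting_inj hphi).
    by apply: DB => //; apply: DM.
  rewrite (splittingD hphi) ?(splittingN hphi) ?(splittingM hphi) //; [|exact: DM|exact: DN].
  rewrite (splitting_trace_sq hphi Dx Zc Hc) ez -scalar_mxM expr2 subrr //.
have sq2 : (z' \o z')%VF = \sum_j c j j.
  apply/eqP; rewrite -subr_eq0; apply/eqP; apply: (splitting_inj hphi').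
    by apply: DB => //; apply: DM.
  rewrite (splittingD hphi') ?(splittingN hphi') ?(splittingM hphi') //; [|exact: DM|exact: DN].
  by rewrite (splitting_trace_sq hphi' Dx Zc Hc) ez' -scalar_mxM expr2 subrr.
have [->|nz] := eqVneq z' z; [by left | right].
have nz0 : z' - z != 0 by rewrite subr_eq0.
have [g [Dg _ gz]] := Dinv (DB Dz' Dz) nz0.
have : ((z' - z) \o (z' + z) = 0)%VF.
  rewrite comp_lfunDl !comp_lfunDr !comp_lfunNl sq1 sq2 (Cz z' Dz').
  by move: (z' \o z)%VF (\sum_j c j j) => a w; rewrite -opprD [a + w]addrC subrr.
move=> e; have : (g \o ((z' - z) \o (z' + z)) = 0)%VF by rewrite e comp_lfun0r.
rewrite comp_lfunA gz comp_lfun1l => /eqP.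
by rewrite addr_eq0 => /eqP.
Qed.

End CenterDual.

(** * The Wedderburn isomorphism *)

Lemma rank_factor (F : fieldType) m (Q : 'M[F]_m) :
  exists n (C : 'M_(m, n)) (R : 'M_(n, m)) (C' : 'M_(n, m)) (R' : 'M_(m, n)),
    [/\ C *m R = Q, C' *m C = 1%:M & R *m R' = 1%:M].
Proof.
have /row_fullP[C' C'C] := col_base_full Q.
have /row_freeP[R' RR'] := row_base_free Q.
by exists (\rank Q), (col_base Q), (row_base Q), C', R'; rewrite mulmx_base.
Qed.

Lemma idempotent_factor (F : fieldType) m (Q : 'M[F]_m) : Q *m Q = Q ->
  exists n (C : 'M_(m, n)) (R : 'M_(n, m)), C *m R = Q /\ R *m C = 1%:M.
Proof.
have [n [C [R [C' [R' [CR C'C RR']]]]]] := rank_factor Q; move=> QQ.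
exists n, C, R; split=> //.
have : C' *m (Q *m Q) *m R' = C' *m Q *m R' by rewrite QQ.
by rewrite -CR !mulmxA C'C mul1mx -!mulmxA RR' mulmx1.
Qed.

Lemma nilpotent_mxtrace (F : fieldType) m (Q : 'M[F]_m) : Q *m Q = 0 -> \tr Q = 0.
Proof.
have [n [C [R [C' [R' [CR C'C RR']]]]]] := rank_factor Q; move=> QQ.
have : C' *m (Q *m Q) *m R' = 0 by rewrite QQ mulmx0 mul0mx.
rewrite -CR !mulmxA C'C mul1mx -!mulmxA RR' mulmx1 => RC.
by rewrite mxtrace_mulC RC mxtrace0.
Qed.

Section Wedderburn.

Variables (K : fieldType) (L : fieldExtType K) (gT : finGroupType).
Variable to : galAction L gT.
Local Notation N := (kernel to).
Local Notation NG := (kernel_group to).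
Local Notation A := (twisted to).
Hypothesis hn : #|N|%:R != 0 :> K.
Variables (E : fieldType) (iota : {rmorphism L -> E}).
Hypothesis splitE : group_splitting_field E NG.
Variable sG : irrType E NG.
Variables (I : finType) (X : I -> rmod A).
Hypothesis simX : forall i, rm_simple (X i).
Hypothesis distX : forall i j, rm_iso (X i) (X j) -> i = j.
Hypothesis allX : forall Y : rmod A, rm_simple Y -> exists i, rm_iso Y (X i).

Section RightIdeal.

Variable C : {vspace A}.
Hypothesis idC : forall c a, c \in C -> c * a \in C.

Let ract (a : A) (c : subvs_of C) : subvs_of C := vsproj C (vsval c * a).

Let ractE a c : vsval (ract a c) = vsval c * a.
Proof. by rewrite /ract vsprojK // idC ?subvsP. Qed.

Let ract_lin a : linear (ract a).
Proof.
move=> c x y; apply: val_inj; rewrite -![val _]/(vsval _) ractE.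
by rewrite !(linearD, linearZ) /= !ractE mulrDl -scalerAl.
Qed.

HB.instance Definition _ a := GRing.isLinear.Build K (subvs_of C) (subvs_of C) _ (ract a) (ract_lin a).

Let ract_act (a : A) : 'End(subvs_of C) := linfun (ract a).

Let ract_act_lin : linear ract_act.
Proof.
move=> c a b; apply/lfunP=> x; rewrite add_lfunE scale_lfunE !lfunE /=.
apply: val_inj; rewrite -![val _]/(vsval _) !(linearD, linearZ) /= !ractE.
by rewrite mulrDr -scalerAr.
Qed.

HB.instance Definition _ := GRing.isLinear.Build K A 'End(subvs_of C) _ ract_act ract_act_lin.

Fact ract1 : ract_act 1 = \1%VF.
Proof. by apply/lfunP=> x; rewrite id_lfunE lfunE /=; apply: val_inj; rewrite /= ractE mulr1. Qed.

Fact ractM a b : ract_act (a * b) = (ract_act b \o ract_act a)%VF.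
Proof.
apply/lfunP=> x; rewrite comp_lfunE !lfunE /=; apply: val_inj.
by rewrite /= !ractE mulrA.
Qed.

Definition right_ideal_rmod : rmod A := RMod (rm_act := ract_act) ract1 ractM.

Lemma right_ideal_actE a (c : right_ideal_rmod) :
  vsval (rm_act right_ideal_rmod a c : subvs_of C) = vsval (c : subvs_of C) * a.
Proof. by rewrite /= lfunE /= ractE. Qed.

Lemma right_ideal_simple : C != 0%VS ->
  (forall U : {vspace A}, (U <= C)%VS -> (forall c a, c \in U -> c * a \in U) ->
     U = 0%VS \/ U = C) -> rm_simple right_ideal_rmod.
Proof.
move=> C0 minC; split.
  have [c Cc c0] : exists2 c, c \in C & c != 0.
    by exists (vpick C); [exact: memv_pick|rewrite vpick0].
  exists (vsproj C c : subvs_of C); apply: contra c0 => /eqP e.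
  by rewrite -(vsprojK Cc) e linear0.
move=> U HU.
pose f : 'Hom(subvs_of C, A) := linfun vsval.
pose W := (f @: U)%VS.
have Wmem x : x \in U -> vsval (x : subvs_of C) \in W.
  by move=> Ux; have := memv_img f Ux; rewrite lfunE.
have Wex c : c \in W -> exists2 x : subvs_of C, x \in U & c = vsval x.
  by move=> /memv_imgP[x Ux ->]; exists x => //; rewrite lfunE.
have [||W0|WC] := minC W.
- by apply/subvP=> c /Wex[x _ ->]; exact: subvsP.
- move=> c a /Wex[x Ux ->]; rewrite -right_ideal_actE; apply: Wmem.
  by have /subvP := HU a; apply; exact: memv_img.
- left; apply/eqP; rewrite -subv0; apply/subvP=> x Ux.
  have := Wmem x Ux; rewrite W0 !memv0 => /eqP e.
  by apply/eqP/val_inj; rewrite -![val _]/(vsval _) e linear0.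
- right; apply/eqP; rewrite eqEsubv subvf; apply/subvP=> x _.
  have : vsval (x : subvs_of C) \in W by rewrite WC subvsP.
  by move=> /Wex[z Uz /val_inj ->].
Qed.

End RightIdeal.

(** The elements that kill all X_i form a right ideal. If it is nonzero, it contains a minimal right
    ideal C, which is isomorphic to some X_i, so C C = 0. Then c b squares to zero for every c in C
    and every b, all its induced traces vanish, and the trace formula with nondegeneracy of the form
    gives c = 0. *)
Lemma wedderburn_inj a : (forall i x, rm_act (X i) a x = 0) -> a = 0.
Proof.
move=> Ha; apply/eqP; apply: contraT => a0.
pose rid (U : {vspace A}) := [/\ U != 0%VS, forall c b, c \in U -> c * b \in U &
   forall c, c \in U -> forall i x, rm_act (X i) c x = 0].
have [C [C0 idC kC] minC] : exists2 C, rid C & forall U, rid U -> (\dim C <= \dim U)%N.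
  apply: (@exists_minimizer _ rid (fun U => \dim U)).
  have [|||U HU] := @subspace_vspace _ A [set c | forall i x, rm_act (X i) c x = 0].
  - by move=> i x; rewrite linear0 zero_lfunE.
  - by move=> x y Hx Hy i z; rewrite linearD add_lfunE Hx Hy addr0.
  - by move=> c x Hx i z; rewrite linearZ scale_lfunE Hx scaler0.
  exists U; split.
  - by apply: contra a0 => /eqP U0; rewrite -memv0 -U0; apply/HU.
  - by move=> c b /HU Hc; apply/HU => i x; rewrite rm_act_mul Hc linear0.
  - by move=> c /HU.
have simC : rm_simple (right_ideal_rmod idC).
  apply: right_ideal_simple => // U sUC idU.
  have [->|U0] := eqVneq U 0%VS; [by left | right].
  apply/eqP; rewrite eqEdim sUC; apply: minC; split=> // c /(subvP sUC); exact: kC.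
have [i [f [bf hf]]] := allX simC.
have CC c d : c \in C -> d \in C -> c * d = 0.
  move=> Cc Cd; have := hf d (vsproj C c : subvs_of C); rewrite kC //.
  rewrite -(linear0 f) => /(bij_inj bf) e.
  have := @right_ideal_actE C idC d (vsproj C c : subvs_of C).
  have e0 : vsval (0 : subvs_of C) = 0 by rewrite linear0.
  by rewrite e [vsval 0]e0 vsprojK // => <-.
have [c Cc c0] : exists2 c, c \in C & c != 0.
  by exists (vpick C); [exact: memv_pick|rewrite vpick0].
case/eqP: c0; apply: tform_nondeg => b; apply: (mulfI hn); rewrite mulr0.
apply: (fmorph_inj (iotaK iota)); rewrite rmorph0 /=.
rewrite -(ind_trace_formula hn iota splitE sG) big1 // => j _.
rewrite nilpotent_mxtrace ?mulr0 // -ind_mxM CC ?idC //.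
by apply/matrixP=> p q; rewrite !mxE /ind_coef big1 // => x _; rewrite ffunE gact0 rmorph0 mulr0.
Qed.

Variables (n : I -> nat) (u : forall i, 'I_(n i) -> X i).
Hypothesis hu : forall i,
  free_basis (fun (f : 'End(X i)) w => f w) (rm_end (X i)) setT (@u i).

(** The sum, over all basis vectors of all X_i, of the elements from [dual_action] that send this
    vector to its prescribed image and kill all the others. *)
Lemma wedderburn_surj (f : forall i, 'End(X i)) :
  (forall i d x, rm_end (X i) d -> f i (d x) = d (f i x)) ->
  exists a, forall i x, rm_act (X i) a x = f i x.
Proof.
move=> Hf.
have H (k : {i : I & 'I_(n i)}) : exists a : A,
  [/\ rm_act (X (tag k)) a (u (tagged k)) = f (tag k) (u (tagged k)),
      forall l, l != tagged k -> rm_act (X (tag k)) a (u l) = 0 &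
      forall i', i' != tag k -> forall y, rm_act (X i') a y = 0].
  exact: dual_action.
have [a Ha] := choice H.
exists (\sum_k a k) => i x.
have [_ /(_ x Logic.I)[c [[Dc ->] _]]] := hu i.
rewrite [rm_act (X i) _]linear_sum /= sum_lfunE.
rewrite [RHS]linear_sum /= [LHS](eq_bigr (fun k => \sum_j c j (rm_act (X i) (a k) (u j)))).
  rewrite exchange_big; apply: eq_bigr => j _ /=.
  rewrite -linear_sum Hf //; congr (c j _).
  rewrite (bigD1 (Tagged (fun i => 'I_(n i)) j)) //= big1 ?addr0.
    by case: (Ha (Tagged (fun i => 'I_(n i)) j)).
  move=> [i' l] nk /=; have [_ H1 H2] := Ha (Tagged (fun i => 'I_(n i)) l).
  have [ei|ni] := eqVneq i i'; last by apply: H2.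
  subst i'; apply: H1; apply: contra nk => /eqP ->; exact: eqxx.
move=> k _; rewrite linear_sum; apply: eq_bigr => j _ /=.
by rewrite -Dc.
Qed.

End Wedderburn.

Lemma free_basis_dim (K : fieldType) (X : vectType K) (U : {vspace X}) (M : set X) m
    (b : 'I_m -> X) : (forall x, x \in U <-> M x) ->
  free_basis ( *:%R : K -> X -> X) setT M b -> m = \dim U.
Proof.
move=> HU [Mb hb]; pose t := [tuple b i | i < m].
have tE (j : 'I_m) : t`_j = b j by rewrite -tnth_nth tnth_mktuple.
have ft : free t.
  apply/freeP=> c; rewrite (eq_bigr (fun j => c j *: b j)) => [E j|j _]; last by rewrite tE.
  have M0 : M 0 by apply/HU/mem0v.
  have [a [_ aU]] := hb 0 M0.
  have a1 : a = finfun c.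
    by apply: aU; split=> //; rewrite -{1}E; apply: eq_bigr => k _; rewrite ffunE.
  have a2 : a = [ffun=> 0].
    by apply: aU; split=> //; rewrite big1 // => k _; rewrite ffunE scale0r.
  by have := congr1 (fun f : {ffun 'I_m -> K} => f j) a1; rewrite a2 !ffunE.
have -> : U = <<t>>%VS.
  apply/eqP; rewrite eqEsubv; apply/andP; split.
    apply/subvP=> x /HU Mx; have [c [[_ ->] _]] := hb x Mx.
    apply: memv_suml => j _; apply: memvZ; rewrite -tE; apply: memv_span.
    by rewrite mem_nth ?size_tuple.
  by apply/span_subvP=> _ /tnthP[j ->]; rewrite tnth_mktuple; apply/HU.
by move/eqP: ft => ->; rewrite size_tuple.
Qed.

(** * Matrix units and a K-basis adapted to the Wedderburn blocks *)

Section MatrixUnits.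

Variables (K : fieldType) (A : algType K) (I : finType) (X : I -> rmod A).
Hypothesis simX : forall i, rm_simple (X i).
Hypothesis distX : forall i j, rm_iso (X i) (X j) -> i = j.
Hypothesis injX : forall a, (forall i x, rm_act (X i) a x = 0) -> a = 0.
Variables (n : I -> nat) (u : forall i, 'I_(n i) -> X i).
Hypothesis hu : forall i,
  free_basis (fun (f : 'End(X i)) w => f w) (rm_end (X i)) setT (@u i).
Local Notation D i := (rm_end (X i)).

Lemma rm_act_ext a b :
  (forall i j, rm_act (X i) a (@u i j) = rm_act (X i) b (@u i j)) -> a = b.
Proof.
move=> H; apply/eqP; rewrite -subr_eq0; apply/eqP/injX => i x.
have [_ /(_ x Logic.I)[c [[Dc ->] _]]] := hu i.
rewrite linear_sum big1 // => j _ /=; rewrite -Dc linearB /=.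
by rewrite add_lfunE opp_lfunE H subrr linear0.
Qed.

Fact theta_subproof i (j l : 'I_(n i)) (c : 'End(X i)) : exists a,
  [/\ rm_act (X i) a (u j) = c (u l), forall k, k != j -> rm_act (X i) a (u k) = 0 &
      forall i', i' != i -> forall y, rm_act (X i') a y = 0].
Proof. exact: dual_action. Qed.

(** A generalised matrix unit with entry c at (j, l) in block i. The elements act from the right, so
    units compose in reading order, as in [thetaM]. *)
Definition theta i j l c : A := projT1 (cid (@theta_subproof i j l c)).

Lemma theta_id i (j l : 'I_(n i)) (c : 'End(X i)) : rm_act (X i) (@theta i j l c) (u j) = c (u l).
Proof. by rewrite /theta; case: cid => a /= []. Qed.

Lemma theta_neq i j l c k : k != j -> rm_act (X i) (@theta i j l c) (u k) = 0.
Proof. by rewrite /theta; case: cid => a /= [_ H _]; apply: H. Qed.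

Lemma theta_other i j l c i' y : i' != i -> rm_act (X i') (@theta i j l c) y = 0.
Proof. by rewrite /theta; case: cid => a /= [_ _ H] /H. Qed.

Lemma thetaP i (j l : 'I_(n i)) (c : 'End(X i)) a : rm_act (X i) a (u j) = c (u l) ->
  (forall k, k != j -> rm_act (X i) a (u k) = 0) ->
  (forall i', i' != i -> forall y, rm_act (X i') a y = 0) -> a = @theta i j l c.
Proof.
move=> H1 H2 H3; apply: rm_act_ext => i' k.
have [ei|ni] := eqVneq i' i; last by rewrite H3 // theta_other.
by subst i'; have [->|nk] := eqVneq k j; rewrite ?H1 ?theta_id // H2 // theta_neq.
Qed.

Lemma thetaD i j l (c c' : 'End(X i)) : @theta i j l (c + c') = theta j l c + theta j l c'.
Proof.
apply/esym/thetaP => [|k nk|i' ni y]; rewrite linearD /= !add_lfunE.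
- by rewrite !theta_id.
- by rewrite !theta_neq // addr0.
- by rewrite !theta_other // addr0.
Qed.

Lemma thetaZ i j l a c : @theta i j l (a *: c) = a *: theta j l c.
Proof.
apply/esym/thetaP => [|k nk|i' ni y]; rewrite linearZ /= !scale_lfunE.
- by rewrite !theta_id.
- by rewrite !theta_neq // scaler0.
- by rewrite !theta_other // scaler0.
Qed.

Lemma theta0 i j l : @theta i j l 0 = 0.
Proof. by rewrite -(scale0r (0 : 'End(X i))) thetaZ scale0r. Qed.

Lemma thetaM i j l l' c c' : D i c ->
  @theta i j l c * theta l l' c' = theta j l' (c \o c')%VF.
Proof.
move=> Dc; apply: thetaP => [|k nk|i' ni y]; rewrite rm_act_mul.
- by rewrite theta_id -Dc theta_id comp_lfunE.
- by rewrite theta_neq // linear0.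
- by rewrite theta_other // linear0.
Qed.

Lemma thetaM0 i j l k l' c c' : D i c -> l != k -> @theta i j l c * theta k l' c' = 0.
Proof.
move=> Dc nlk; rewrite -(theta0 j j); apply: thetaP => [|k' nk|i' ni y]; rewrite rm_act_mul.
- by rewrite theta_id -Dc theta_neq // linear0 zero_lfunE.
- by rewrite theta_neq // linear0.
- by rewrite theta_other // linear0.
Qed.

Lemma thetaM_other i i' j l k l' c a c' : i != i' ->
  @theta i j l c * a * @theta i' k l' c' = 0.
Proof.
move=> ni; apply: injX => i2 x; rewrite !rm_act_mul.
have [ei|ni2] := eqVneq i2 i; first by subst i2; exact: theta_other.
by rewrite (@theta_other i j l c i2 x ni2) !linear0.
Qed.

Fact coef_subproof i (a : A) (j : 'I_(n i)) : exists c : {ffun 'I_(n i) -> 'End(X i)},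
  (forall l, D i (c l)) /\ rm_act (X i) a (u j) = \sum_l c l (u l).
Proof.
by have [_ /(_ (rm_act (X i) a (u j)) Logic.I)[c [Hc _]]] := hu i; exists c.
Qed.

(** The entries, in K_i, of the matrix of a on X_i with respect to the basis u; products in A become
    matrix products in the same order ([coefM]). *)
Definition coef i a j : 'I_(n i) -> 'End(X i) := projT1 (cid (@coef_subproof i a j)).

Lemma coef_end i a j l : D i (@coef i a j l).
Proof. by rewrite /coef; case: cid => c /= []. Qed.

Lemma coef_sum i a j : rm_act (X i) a (u j) = \sum_l @coef i a j l (u l).
Proof. by rewrite /coef; case: cid => c /= []. Qed.

Lemma coefP i a j (c : 'I_(n i) -> 'End(X i)) : (forall l, D i (c l)) ->
  rm_act (X i) a (u j) = \sum_l c l (u l) -> forall l, coef a j l = c l.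
Proof.
move=> Dc ec; apply: (free_basis_coord_inj (hu i)) => // [l|]; first exact: coef_end.
by rewrite -coef_sum.
Qed.

Lemma theta_sandwich i j l k l' a :
  @theta i j k \1%VF * a * theta l l' \1%VF = theta j l' (coef a k l).
Proof.
have [D1 _ _ _ _] := rm_end_division (simX i).
apply: thetaP => [|k' nk|i' ni y]; rewrite !rm_act_mul.
- rewrite theta_id id_lfunE coef_sum linear_sum (bigD1 l) //= big1 => [|l0 nl].
    by rewrite addr0 -(coef_end a k l) theta_id id_lfunE.
  by rewrite -(coef_end a k l0) theta_neq // linear0.
- by rewrite theta_neq // !linear0.
- by rewrite theta_other // !linear0.
Qed.

Lemma coef_theta i j l c (Dc : D i c) j' l' :
  coef (@theta i j l c) j' l' = if (j' == j) && (l' == l) then c else 0.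
Proof.
have [D1 DB _ _ _] := rm_end_division (simX i).
have D0 := division_set0 (rm_end_division (simX i)).
apply: (coefP (c := fun l' => if (j' == j) && (l' == l) then c else 0)) => [k|].
  by case: ifP.
have [->|nj] := eqVneq j' j; last first.
  by rewrite theta_neq // big1 // => k _; rewrite zero_lfunE.
rewrite theta_id (bigD1 l) //= eqxx big1 ?addr0 // => k /negbTE->.
by rewrite zero_lfunE.
Qed.

Lemma coef_theta_other i i' j l c j' l' : i != i' -> @coef i' (@theta i j l c) j' l' = 0.
Proof.
have [D1 DB _ _ _] := rm_end_division (simX i').
have D0 := division_set0 (rm_end_division (simX i')).
move=> ni; apply: (coefP (c := fun=> 0)) => //.
by rewrite theta_other 1?eq_sym // big1 // => k _; rewrite zero_lfunE.
Qed.

Lemma coefD i a b j l : @coef i (a + b) j l = coef a j l + coef b j l.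
Proof.
have [D1 DB _ _ _] := rm_end_division (simX i).
have DD := division_setD (rm_end_division (simX i)).
apply: (coefP (c := fun l => coef a j l + coef b j l)) => [k|].
  by apply: DD; exact: coef_end.
rewrite linearD /= add_lfunE !coef_sum -big_split; apply: eq_bigr => k _.
by rewrite add_lfunE.
Qed.

Lemma coefZ i c a j l : @coef i (c *: a) j l = c *: coef a j l.
Proof.
have [_ _ _ DZ _] := rm_end_division (simX i).
apply: (coefP (c := fun l => c *: coef a j l)) => [k|].
  by apply: DZ; exact: coef_end.
rewrite linearZ /= scale_lfunE coef_sum scaler_sumr; apply: eq_bigr => k _.
by rewrite scale_lfunE.
Qed.

Lemma coefM i a b j l : @coef i (a * b) j l = \sum_k (coef a j k \o coef b k l)%VF.
Proof.
have [D1 DB DM _ _] := rm_end_division (simX i).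
have D0 := division_set0 (rm_end_division (simX i)).
have DD := division_setD (rm_end_division (simX i)).
apply: (coefP (c := fun l => \sum_k (coef a j k \o coef b k l)%VF)) => [m|].
  by apply: big_ind => // k _; apply: DM; exact: coef_end.
rewrite rm_act_mul coef_sum linear_sum.
under [RHS]eq_bigr => m _ do rewrite sum_lfunE.
rewrite exchange_big; apply: eq_bigr => k _ /=.
rewrite -(coef_end a j k) coef_sum linear_sum; apply: eq_bigr => m _.
by rewrite comp_lfunE.
Qed.

Lemma theta_expand a : a = \sum_i \sum_j \sum_l @theta i j l (coef a j l).
Proof.
apply: rm_act_ext => i j.
rewrite linear_sum /= sum_lfunE (bigD1 i) //= [X in _ + X]big1 ?addr0 => [|i' ni].
  rewrite linear_sum /= sum_lfunE (bigD1 j) //= [X in _ + X]big1 ?addr0 => [|k nk].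
    rewrite linear_sum /= sum_lfunE coef_sum; apply: eq_bigr => l _ /=.
    by rewrite theta_id.
  by rewrite linear_sum /= sum_lfunE big1 // => l _ /=; rewrite theta_neq // eq_sym.
rewrite linear_sum /= sum_lfunE big1 // => k _ /=.
rewrite linear_sum /= sum_lfunE big1 // => l _ /=.
by rewrite theta_other // eq_sym.
Qed.

Variables (r : I -> nat) (b : forall i, 'I_(r i) -> 'End(X i)).
Hypothesis hb : forall i,
  free_basis ( *:%R : K -> 'End(X i) -> 'End(X i)) setT (D i) (@b i).

Definition unit_index := {i : I & ('I_(n i) * 'I_(n i) * 'I_(r i))%type}.

Definition unit_basis (x : 'I_#|{: unit_index}|) : A :=
  let t := enum_val x in
  theta (tagged t).1.1 (tagged t).1.2 (b (tagged t).2).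

Lemma unit_basis_sum (c : {ffun 'I_#|{: unit_index}| -> K}) :
  \sum_x c x *: unit_basis x = \sum_i \sum_j \sum_l @theta i j l
    (\sum_m c (enum_rank (Tagged (fun i => ('I_(n i) * 'I_(n i) * 'I_(r i))%type) (j, l, m))) *: b m).
Proof.
pose F i (t : 'I_(n i) * 'I_(n i) * 'I_(r i)) : A :=
  c (enum_rank (Tagged (fun i => ('I_(n i) * 'I_(n i) * 'I_(r i))%type) t)) *: theta t.1.1 t.1.2 (b t.2).
transitivity (\sum_(t : unit_index) F (tag t) (tagged t)).
  rewrite [RHS]big_enum_val; apply: eq_bigr => x _.
  rewrite /F /unit_basis; congr (c _ *: _).
  by rewrite -[LHS]enum_valK; congr enum_rank; case: (enum_val x).
transitivity (\sum_i \sum_t F i t); first by rewrite sig_big_dep.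
apply: eq_bigr => i _; transitivity (\sum_t F i ((t.1.1, t.1.2), t.2)); first by apply: eq_bigr => -[[]].
rewrite -(pair_bigA _ (fun jl m => F i ((jl.1, jl.2), m))) /=.
rewrite -(pair_bigA _ (fun j l => \sum_m F i (j, l, m))) /=.
apply: eq_bigr => j _; apply: eq_bigr => l _.
rewrite [RHS](big_morph (theta j l) (thetaD j l) (theta0 j l)).
by apply: eq_bigr => m _; rewrite thetaZ.
Qed.

Lemma coef_unit (c : {ffun 'I_#|{: unit_index}| -> K}) i j l :
  coef (\sum_x c x *: unit_basis x) j l =
  \sum_m c (enum_rank (Tagged (fun i => ('I_(n i) * 'I_(n i) * 'I_(r i))%type) (j, l, m))) *: @b i m.
Proof.
pose f i j l := \sum_m c (enum_rank (Tagged (fun i => ('I_(n i) * 'I_(n i) * 'I_(r i))%type) (j, l, m))) *: @b i m.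
have Df i' j' l' : D i' (f i' j' l').
  have [D1 DB _ DZ _] := rm_end_division (simX i').
  have D0 := division_set0 (rm_end_division (simX i')).
  have DD := division_setD (rm_end_division (simX i')).
  by apply: big_ind => // m' _; apply: DZ; case: (hb i').
apply: (coefP (c := f i j)) => //.
have -> : \sum_x c x *: unit_basis x = \sum_i \sum_j \sum_l @theta i j l (f i j l).
  exact: unit_basis_sum.
rewrite linear_sum /= sum_lfunE (bigD1 i) //= [X in _ + X]big1 ?addr0 => [|i' ni].
  rewrite linear_sum /= sum_lfunE (bigD1 j) //= [X in _ + X]big1 ?addr0 => [|k nk].
    rewrite linear_sum /= sum_lfunE; apply: eq_bigr => l' _ /=.
    by rewrite theta_id.
  by rewrite linear_sum /= sum_lfunE big1 // => l' _ /=; rewrite theta_neq // eq_sym.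
rewrite linear_sum /= sum_lfunE big1 // => k _ /=.
rewrite linear_sum /= sum_lfunE big1 // => l' _ /=.
by rewrite theta_other // eq_sym.
Qed.

Lemma unit_basis_free : free_basis ( *:%R : K -> A -> A) setT setT unit_basis.
Proof.
split=> // a _.
have Hc i j l : exists c : {ffun 'I_(r i) -> K}, @coef i a j l = \sum_m c m *: b m.
  by have [_ /(_ _ (coef_end a j l))[c [[_ ec] _]]] := hb i; exists c.
pose c i j l := projT1 (cid (Hc i j l)).
have cE i j l : @coef i a j l = \sum_m c i j l m *: b m by rewrite /c; case: cid.
exists [ffun x => let t := enum_val x in c (tag t) (tagged t).1.1 (tagged t).1.2 (tagged t).2].
split.
  split=> //; rewrite unit_basis_sum {1}(theta_expand a).
  apply: eq_bigr => i _; apply: eq_bigr => j _; apply: eq_bigr => l _.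
  by rewrite cE; congr theta; apply: eq_bigr => m _; rewrite ffunE enum_rankK.
move=> c' [_ ec']; apply/ffunP=> x; rewrite ffunE.
rewrite -[in RHS](enum_valK x); case: (enum_val x) => i [[j l] m] /=.
have [_ /(_ _ (coef_end a j l))[c0 [_ c0U]]] := hb i.
have e1 : c0 = c i j l by apply: c0U; split=> //; exact: cE.
have e2 : c0 = [ffun m => c' (enum_rank (Tagged (fun i => ('I_(n i) * 'I_(n i) * 'I_(r i))%type) (j, l, m)))].
  apply: c0U; split=> //; rewrite ec' coef_unit.
  by apply: eq_bigr => m' _; rewrite ffunE.
by have := congr1 (fun g : {ffun 'I_(r i) -> K} => g m) e2; rewrite e1 ffunE.
Qed.

Lemma card_unit_index : #|{: unit_index}| = (\sum_i n i ^ 2 * r i)%N.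
Proof.
rewrite card_tagged sumnE big_map big_enum /=; apply: eq_bigr => i _.
by rewrite !card_prod !card_ord mulnn.
Qed.

End MatrixUnits.

(** * Blocks, central characters and the trace form *)

Lemma mulmx_prime (F : fieldType) m n p q (P : 'M[F]_(m, n)) (Q : 'M_(p, q)) :
  (forall M : 'M_(n, p), P *m M *m Q = 0) -> P != 0 -> Q = 0.
Proof.
move=> H P0; have [x [y Pxy]] : exists x y, P x y != 0.
  apply: contrapT => H0; case/eqP: P0; apply/matrixP=> x y; rewrite mxE.
  by apply/eqP; apply: contrapT => /negP Pxy; apply: H0; exists x, y.
apply/matrixP=> k l; rewrite [RHS]mxE; have /matrixP/(_ x l) := H (delta_mx y k).
rewrite mxE (bigD1 k) //= big1 => [|k' nk]; last first.
  rewrite mxE big1 ?mul0r // => z _; rewrite mxE (negbTE nk) andbF mulr0 //.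
rewrite addr0 mxE (bigD1 y) //= big1 => [|z nz]; last first.
  by rewrite mxE (negbTE nz) mulr0.
rewrite addr0 !mxE !eqxx mulr1 => /eqP.
by rewrite mulf_eq0 (negbTE Pxy) => /eqP.
Qed.

Section SplitCorner.

Variables (K : fieldType) (A : algType K) (I : finType) (X : I -> rmod A).
Hypothesis simX : forall i, rm_simple (X i).
Hypothesis distX : forall i j, rm_iso (X i) (X j) -> i = j.
Hypothesis injX : forall a, (forall i x, rm_act (X i) a x = 0) -> a = 0.
Variables (n : I -> nat) (u : forall i, 'I_(n i) -> X i).
Hypothesis hu : forall i,
  free_basis (fun (f : 'End(X i)) w => f w) (rm_end (X i)) setT (@u i).
Variables (E : fieldType) (iota : {rmorphism K -> E}) (Xi : finType) (md : Xi -> nat).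
Variable rho : forall chi, A -> 'M[E]_(md chi).
Hypothesis rhoD : forall chi a b, rho chi (a + b) = rho chi a + rho chi b.
Hypothesis rhoZ : forall chi c a, rho chi (c *: a) = iota c *: rho chi a.
Hypothesis rhoM : forall chi a b, rho chi (a * b) = rho chi a *m rho chi b.
Hypothesis rho1 : forall chi, rho chi 1 = 1%:M.
Hypothesis md_gt0 : forall chi, (0 < md chi)%N.
Hypothesis rho_spans : forall chi (M : 'M[E]_(md chi)),
  exists l (e : 'I_l -> E) (a : 'I_l -> A), M = \sum_k e k *: rho chi (a k).
Variable j0 : forall i, 'I_(n i).

Local Notation D i := (rm_end (X i)).
Local Notation Z i := (end_center (D i)).
Local Notation th i j l c := (@theta K A I X simX distX n u hu i j l c).
Local Notation e0 i c := (th i (j0 i) (j0 i) c).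

Let D1 i : D i \1%VF. Proof. by case: (rm_end_division (simX i)). Qed.

Lemma rho0 chi : rho chi 0 = 0.
Proof. by rewrite -(scale0r (0 : A)) rhoZ rmorph0 scale0r. Qed.

Lemma rho_sum chi (J : finType) (F : J -> A) : rho chi (\sum_j F j) = \sum_j rho chi (F j).
Proof. exact: (big_morph _ (rhoD chi) (rho0 chi)). Qed.

Lemma sum_unit : 1 = \sum_i \sum_j th i j j \1%VF.
Proof.
apply: (rm_act_ext injX hu) => i j; rewrite rm_act1 id_lfunE.
rewrite linear_sum /= sum_lfunE (bigD1 i) //= [X in _ + X]big1 ?addr0 => [|i' ni].
  rewrite linear_sum /= sum_lfunE (bigD1 j) //= [X in _ + X]big1 ?addr0 => [|k nk].
    by rewrite theta_id id_lfunE.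
  by rewrite theta_neq // eq_sym.
rewrite linear_sum /= sum_lfunE big1 // => k _ /=.
by rewrite theta_other // eq_sym.
Qed.

Lemma theta_corner i j l c : th i j l c = th i j (j0 i) \1%VF * e0 i \1%VF * th i (j0 i) l c.
Proof. by rewrite !(thetaM simX distX injX) ?comp_lfun1l //; exact: D1. Qed.

Lemma corner_exists chi : exists i, rho chi (e0 i \1%VF) != 0.
Proof.
apply: contrapT => H; have H0 i : rho chi (e0 i \1%VF) = 0.
  by apply/eqP; apply: contrapT => /negP Hi; apply: H; exists i.
have : rho chi 1 = 0.
  rewrite sum_unit rho_sum big1 // => i _; rewrite rho_sum big1 // => j _.
  by rewrite theta_corner !rhoM H0 mulmx0 mul0mx.
rewrite rho1 => /matrixP/(_ (Ordinal (md_gt0 chi)) (Ordinal (md_gt0 chi)))/eqP.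
by rewrite !mxE eqxx oner_eq0.
Qed.

Definition block chi : I := projT1 (cid (corner_exists chi)).

Lemma block_neq0 chi : rho chi (e0 (block chi) \1%VF) != 0.
Proof. by rewrite /block; case: cid. Qed.

(** Different blocks of A annihilate each other, while full matrix rings are prime ([mulmx_prime]),
    so a representation whose values span all matrices is nonzero on one block only. *)
Lemma rho_theta_other chi i j l c : i != block chi -> rho chi (th i j l c) = 0.
Proof.
move=> ni; have H : rho chi (e0 i \1%VF) = 0.
  apply: mulmx_prime (block_neq0 chi) => M.
  have [m [e [a ->]]] := rho_spans M.
  rewrite mulmx_sumr mulmx_suml big1 // => k _.
  by rewrite -scalemxAr -scalemxAl -!rhoM thetaM_other 1?eq_sym // rho0 scaler0.
by rewrite theta_corner !rhoM H mulmx0 mul0mx.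
Qed.

(** For z in the center of K_i this element acts as z on X_i and as 0 on the other modules
    ([central_elt_act], [central_elt_other]), hence is central in A. *)
Definition central_elt i (z : 'End(X i)) : A := \sum_j th i j j z.

Lemma central_elt_act i z x : Z i z -> rm_act (X i) (central_elt z) x = z x.
Proof.
move=> [Dz Cz]; have [_ /(_ x Logic.I)[c [[Dc ->] _]]] := hu i.
rewrite [LHS](linear_sum (rm_act (X i) (central_elt z))) [RHS]linear_sum.
apply: eq_bigr => j _ /=; rewrite -Dc -[RHS]comp_lfunE Cz //.
rewrite comp_lfunE; congr (c j _).
rewrite linear_sum /= sum_lfunE (bigD1 j) //= big1 ?addr0 => [|k nk].
  by rewrite theta_id.
by rewrite theta_neq // eq_sym.
Qed.

Lemma central_elt_other i z i' x : i' != i -> rm_act (X i') (@central_elt i z) x = 0.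
Proof.
by move=> ni; rewrite linear_sum /= sum_lfunE big1 // => j _; rewrite theta_other.
Qed.

Lemma central_eltC i z a : Z i z -> central_elt z * a = a * central_elt z.
Proof.
move=> Zz; apply/eqP; rewrite -subr_eq0; apply/eqP/injX => i' x.
rewrite linearB /= add_lfunE opp_lfunE !rm_act_mul.
have [ei|ni] := eqVneq i' i; last by rewrite !central_elt_other // linear0 subrr.
by subst i'; rewrite !central_elt_act //; case: Zz => Dz _; rewrite Dz subrr.
Qed.

Lemma theta_central i j l c z : D i c -> th i j l c * central_elt z = th i j l (c \o z)%VF.
Proof.
move=> Dc; rewrite mulr_sumr (bigD1 l) //= big1 ?addr0 => [|k nk].
  by rewrite (thetaM simX distX injX).
by rewrite (thetaM0 simX distX injX) // eq_sym.
Qed.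

Lemma rho_central chi i z : Z i z -> is_scalar_mx (rho chi (central_elt z)).
Proof.
move=> Zz; have H M : rho chi (central_elt z) *m M = M *m rho chi (central_elt z).
  have [m [e [a ->]]] := rho_spans M.
  rewrite mulmx_sumr mulmx_suml; apply: eq_bigr => k _.
  by rewrite -scalemxAr -scalemxAl -!rhoM central_eltC.
move: (rho chi (central_elt z)) H; move: (md_gt0 chi); case: (md chi) => // m _.
exact: mx_comm_scalar.
Qed.

Definition central_char chi i z : E :=
  rho chi (@central_elt i z) (Ordinal (md_gt0 chi)) (Ordinal (md_gt0 chi)).

Lemma rho_centralE chi i z : Z i z -> rho chi (central_elt z) = (central_char chi z)%:M.
Proof.
by move=> /rho_central-/(_ chi)/is_scalar_mxP[c ec]; rewrite /central_char ec mxE eqxx.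
Qed.

(** The corner cut out by the primitive idempotent [e0 i \1%VF] is a copy of K_i. Its image under
    [rho chi], compressed along a factorisation C R of the image of the idempotent with R C = 1, is
    a matrix representation whose values span. *)
Lemma corner_splitting chi : exists m (C : 'M_(md chi, m.+1)) (R : 'M_(m.+1, md chi)),
  [/\ C *m R = rho chi (e0 (block chi) \1%VF), R *m C = 1%:M &
      is_splitting (D (block chi)) (fun c => R *m rho chi (e0 (block chi) c) *m C)].
Proof.
set i := block chi.
have e0M c c' : D i c -> e0 i c * e0 i c' = e0 i (c \o c')%VF by move=> Dc; rewrite (thetaM simX distX injX).
have QQ : rho chi (e0 i \1%VF) *m rho chi (e0 i \1%VF) = rho chi (e0 i \1%VF).
  by rewrite -rhoM e0M ?comp_lfun1l //; exact: D1.
have [[|m] [C [R [CR RC]]]] := idempotent_factor QQ.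
  by case/eqP: (block_neq0 chi); rewrite -/i -CR thinmx0 mul0mx.
exists m, C, R; split=> //.
have Qr c : rho chi (e0 i \1%VF) *m rho chi (e0 i c) = rho chi (e0 i c).
  by rewrite -rhoM e0M ?comp_lfun1l //; exact: D1.
split.
- by move=> x y Dx Dy; rewrite (thetaD simX distX injX) rhoD mulmxDr mulmxDl.
- move=> x y Dx Dy; rewrite -e0M // rhoM.
  rewrite !mulmxA -[R *m _ *m C *m R]mulmxA CR -[_ *m rho chi (e0 i \1%VF) *m _]mulmxA.
  by rewrite Qr.
- by rewrite -CR !mulmxA RC mul1mx RC.
- move=> z Zz; have Dz : D i z by case: Zz.
  have -> : e0 i z = e0 i \1%VF * central_elt z.
    by rewrite theta_central ?comp_lfun1l //; exact: D1.
  rewrite -central_eltC // rhoM rho_centralE // mul_scalar_mx -scalemxAr -scalemxAl.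
  by rewrite -CR !mulmxA RC mul1mx RC scalemx1; apply/is_scalar_mxP; exists (central_char chi z).
- move=> M; have [l [e [a ea]]] := rho_spans (C *m M *m R).
  exists l, e, (fun k => coef hu (a k) (j0 i) (j0 i)).
  split=> [k|]; first exact: coef_end.
  have -> : M = R *m (rho chi (e0 i \1%VF) *m (C *m M *m R) *m rho chi (e0 i \1%VF)) *m C.
    by rewrite -CR !mulmxA RC mul1mx RC mul1mx -!mulmxA RC mulmx1 RC mulmx1.
  rewrite ea mulmx_sumr mulmx_suml mulmx_sumr mulmx_suml; apply: eq_bigr => k _.
  rewrite -!(scalemxAr, scalemxAl) -!rhoM (theta_sandwich simX distX injX).
  by [].
Qed.

Lemma corner_central chi z : Z (block chi) z ->
  rho chi (e0 (block chi) z) = central_char chi z *: rho chi (e0 (block chi) \1%VF).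
Proof.
move=> Zz; have Dz : D (block chi) z by case: Zz.
have -> : e0 (block chi) z = e0 (block chi) \1%VF * central_elt z.
  by rewrite theta_central ?comp_lfun1l //; exact: D1.
by rewrite -central_eltC // rhoM rho_centralE // mul_scalar_mx.
Qed.

(** The diagonal matrix units decompose the identity into n idempotents equivalent to the corner,
    each of rank m. P and Q are the resulting mutually inverse changes of basis. *)
Lemma corner_degree chi m (C : 'M_(md chi, m)) (R : 'M_(m, md chi)) :
  C *m R = rho chi (e0 (block chi) \1%VF) -> R *m C = 1%:M ->
  md chi = (n (block chi) * m)%N.
Proof.
set i := block chi => CR RC.
pose J : finType := ('I_(n i) * 'I_m)%type.
pose P : 'M[E]_(md chi, #|J|) := \matrix_(x, y)
  (rho chi (th i (enum_val y).1 (j0 i) \1%VF) *m C) x (enum_val y).2.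
pose Q : 'M[E]_(#|J|, md chi) := \matrix_(y, x)
  (R *m rho chi (th i (j0 i) (enum_val y).1 \1%VF)) (enum_val y).2 x.
have PQ : P *m Q = 1%:M.
  rewrite -rho1 sum_unit rho_sum (bigD1 i) //= [X in _ + X]big1 ?addr0 => [|i' ni]; last first.
    by rewrite rho_sum big1 // => j _; rewrite rho_theta_other.
  rewrite rho_sum; apply/matrixP=> x y; rewrite mxE summxE.
  pose F (t : J) := (rho chi (th i t.1 (j0 i) \1%VF) *m C) x t.2
    * (R *m rho chi (th i (j0 i) t.1 \1%VF)) t.2 y.
  transitivity (\sum_t F t).
    rewrite [RHS]big_enum_val; apply: eq_bigr => z _; by rewrite [P _ _]mxE [Q _ _]mxE.
  rewrite -(pair_bigA _ (fun j k => F (j, k))) /=; apply: eq_bigr => j _.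
  by rewrite theta_corner !rhoM -CR -!mulmxA mulmxA [RHS]mxE.
have QP : Q *m P = 1%:M.
  apply/matrixP=> x y; rewrite mxE [RHS]mxE -(inj_eq enum_val_inj).
  under eq_bigr => z _ do rewrite [P _ _]mxE [Q _ _]mxE.
  move: (enum_val x) (enum_val y) => [j k] [j' k'] /=.
  transitivity ((R *m (rho chi (th i (j0 i) j \1%VF) *m rho chi (th i j' (j0 i) \1%VF)) *m C) k k').
    by rewrite -!mulmxA mulmxA [RHS]mxE.
  rewrite -rhoM; have [->|nj] := eqVneq j j'.
    rewrite (thetaM simX distX injX) ?comp_lfun1l -?CR; try exact: D1.
    by rewrite !mulmxA RC mul1mx RC mxE -pair_eqE /= eqxx.
  rewrite (thetaM0 simX distX injX) // ?rho0 ?mulmx0 ?mul0mx ?mxE.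
  by rewrite -pair_eqE /= (negbTE nj).
have := mulmx1_min PQ; have := mulmx1_min QP; rewrite card_prod !card_ord; lia.
Qed.

Lemma mxtrace_corner chi m (C : 'M_(md chi, m)) (R : 'M_(m, md chi)) c :
  C *m R = rho chi (e0 (block chi) \1%VF) -> R *m C = 1%:M -> D (block chi) c ->
  \tr (R *m rho chi (e0 (block chi) c) *m C) = \tr (rho chi (e0 (block chi) c)).
Proof.
move=> CR RC Dc; rewrite mxtrace_mulC mulmxA CR -rhoM (thetaM simX distX injX) ?comp_lfun1l //.
Qed.

End SplitCorner.

(** * Reduced traces of the K_i from the induced representations *)

Section SplitTrace.

Variables (K : fieldType) (A : algType K) (I : finType) (X : I -> rmod A).
Hypothesis simX : forall i, rm_simple (X i).
Hypothesis distX : forall i j, rm_iso (X i) (X j) -> i = j.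
Hypothesis injX : forall a, (forall i x, rm_act (X i) a x = 0) -> a = 0.
Variables (n : I -> nat) (u : forall i, 'I_(n i) -> X i).
Hypothesis hu : forall i,
  free_basis (fun (f : 'End(X i)) w => f w) (rm_end (X i)) setT (@u i).
Variables (E : fieldType) (iota : {rmorphism K -> E}) (Xi : finType) (md : Xi -> nat).
Variable rho : forall chi, A -> 'M[E]_(md chi).
Hypothesis rhoD : forall chi a b, rho chi (a + b) = rho chi a + rho chi b.
Hypothesis rhoZ : forall chi c a, rho chi (c *: a) = iota c *: rho chi a.
Hypothesis rhoM : forall chi a b, rho chi (a * b) = rho chi a *m rho chi b.
Hypothesis rho1 : forall chi, rho chi 1 = 1%:M.
Hypothesis md_gt0 : forall chi, (0 < md chi)%N.
Hypothesis rho_spans : forall chi (M : 'M[E]_(md chi)),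
  exists l (e : 'I_l -> E) (a : 'I_l -> A), M = \sum_k e k *: rho chi (a k).
Variable j0 : forall i, 'I_(n i).
Variables (r : I -> nat) (b : forall i, 'I_(r i) -> 'End(X i)).
Hypothesis hb : forall i,
  free_basis ( *:%R : K -> 'End(X i) -> 'End(X i)) setT (rm_end (X i)) (@b i).
Variables (d : I -> nat) (y : forall i, 'I_(d i ^ 2)%N -> 'End(X i)).
Hypothesis hy : forall i,
  free_basis (@comp_lfun _ (X i) (X i) (X i)) (end_center (rm_end (X i))) (rm_end (X i)) (@y i).
Hypothesis sum_md : (\sum_chi md chi ^ 2 = \sum_i n i ^ 2 * r i)%N.
Variables (tf : A -> K) (nn : K) (w : Xi -> nat) (h : nat).
Hypothesis tfD : forall a b, tf (a + b) = tf a + tf b.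
Hypothesis tfZ : forall c a, tf (c *: a) = c * tf a.
Hypothesis tf_nondeg : forall a, (forall b, tf (a * b) = 0) -> a = 0.
Hypothesis nn_neq0 : nn != 0.
Hypothesis trace_formula :
  forall a, \sum_chi (w chi)%:R * \tr (rho chi a) = iota (nn * tf a).
Hypothesis h_gt0 : (0 < h)%N.
Hypothesis mdE : forall chi, md chi = (h * w chi)%N.

Local Notation D i := (rm_end (X i)).
Local Notation Z i := (end_center (D i)).
Local Notation th i j l c := (@theta K A I X simX distX n u hu i j l c).
Local Notation e0 i c := (th i (j0 i) (j0 i) c).
Local Notation blk chi := (block simX distX injX hu rhoD rhoZ rhoM rho1 md_gt0 j0 chi).
Local Notation ct z := (central_elt simX distX hu z).
Local Notation cc chi z := (central_char simX distX hu rho md_gt0 chi z).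
Local Notation rhoS := (rho_sum rhoD rhoZ).
Local Notation rhoct chi := (rho_centralE simX distX injX hu rhoM md_gt0 rho_spans chi).

Let DIV i : division_set (D i). Proof. exact: rm_end_division. Qed.

Let D1 i : D i \1%VF. Proof. by case: (DIV i). Qed.

Lemma end_neq0 i : \1%VF != 0 :> 'End(X i).
Proof.
have [[x x0] _] := simX i; apply: contra x0 => /eqP/lfunP/(_ x).
by rewrite id_lfunE zero_lfunE => ->.
Qed.

Let X1 i : \1%VF != 0 :> 'End(X i). Proof. exact: end_neq0. Qed.

Lemma block_degree chi : md chi = (n (blk chi) * d (blk chi))%N.
Proof.
have [m [C [R [CR RC sp]]]] := corner_splitting simX distX injX hu rhoD rhoZ rhoM rho1 md_gt0 rho_spans j0 chi.
rewrite (corner_degree rho_spans CR RC); congr muln.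
have := splitting_degree (DIV _) (@X1 _) (@hy _) sp; rewrite mulnn => /eqP.
by rewrite eqn_sqr => /eqP.
Qed.

Lemma rho_ct_other chi i z : i != blk chi -> rho chi (@central_elt _ _ _ _ simX distX _ _ hu i z) = 0.
Proof.
by move=> ni; rewrite rhoS big1 // => j _; exact: (rho_theta_other rho_spans _ _ _ ni).
Qed.

Lemma central_eltD i (z z' : 'End(X i)) : ct (z + z') = ct z + ct z'.
Proof. by rewrite -big_split; apply: eq_bigr => j _; rewrite (thetaD simX distX injX). Qed.

Lemma central_eltZ i c (z : 'End(X i)) : ct (c *: z) = c *: ct z.
Proof. by rewrite scaler_sumr; apply: eq_bigr => j _; rewrite (thetaZ simX distX injX). Qed.

Lemma central_elt_sum i m (c : 'I_m -> K) (z : 'I_m -> 'End(X i)) :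
  ct (\sum_k c k *: z k) = \sum_k c k *: ct (z k).
Proof.
have ct0 : ct (0 : 'End(X i)) = 0 by rewrite -(scale0r (0 : 'End(X i))) central_eltZ scale0r.
rewrite (big_morph _ (@central_eltD i) ct0).
by apply: eq_bigr => k _; rewrite central_eltZ.
Qed.

Lemma central_eltM i (z z' : 'End(X i)) : Z i z -> ct z * ct z' = ct (z \o z')%VF.
Proof.
move=> [Dz _]; rewrite mulr_suml; apply: eq_bigr => j _.
by rewrite (theta_central simX distX injX).
Qed.

Lemma central_charZ chi i c (z : 'End(X i)) : cc chi (c *: z) = iota c * cc chi z.
Proof. by rewrite /central_char central_eltZ rhoZ mxE. Qed.

Lemma central_char_sum chi i m (c : 'I_m -> K) (z : 'I_m -> 'End(X i)) :
  cc chi (\sum_k c k *: z k) = \sum_k iota (c k) * cc chi (z k).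
Proof.
rewrite /central_char central_elt_sum rhoS summxE.
by apply: eq_bigr => k _; rewrite rhoZ mxE.
Qed.

Lemma central_charM chi i (z z' : 'End(X i)) : Z i z -> Z i z' ->
  cc chi (z \o z')%VF = cc chi z * cc chi z'.
Proof.
move=> Zz Zz'; rewrite [LHS]/central_char -central_eltM // rhoM !(rhoct chi) //.
by rewrite mul_scalar_mx !mxE eqxx mulr1n.
Qed.

Lemma tf_sum (J : finType) (F : J -> A) : tf (\sum_j F j) = \sum_j tf (F j).
Proof. by apply: (big_morph _ tfD); rewrite -(scale0r (0 : A)) tfZ mul0r. Qed.

Let ub := unit_basis simX distX hu b.
Let ubP := unit_basis_free simX distX injX hu hb.

(** The form is nondegenerate over K, so independence over K survives over E: by the trace formula,
    pairing a relation over E with a basis gives a relation between the rows of a matrix over K of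
    full row rank. *)
Lemma rho_indep m (a : 'I_m -> A) (e : 'I_m -> E) :
  (forall c : 'I_m -> K, \sum_k c k *: a k = 0 -> forall k, c k = 0) ->
  (forall chi, \sum_k e k *: rho chi (a k) = 0) -> forall k, e k = 0.
Proof.
move=> fr He k.
pose G := \matrix_(k < m, l < #|{: unit_index n r}|) tf (a k * ub l).
have frG : row_free G.
  rewrite -kermx_eq0; apply/eqP/row_matrixP=> i; rewrite row0.
  have : row i (kermx G) *m G = 0 by rewrite -row_mul mulmx_ker row0.
  move: (row i _) => c cG; apply/rowP=> k'; rewrite [RHS]mxE.
  apply: (fr (fun k => c 0 k)); apply: tf_nondeg => x.
  have [_ /(_ x Logic.I)[g [[_ ->] _]]] := ubP.
  rewrite mulr_sumr tf_sum big1 // => l _.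
  rewrite -scalerAr tfZ mulr_suml tf_sum.
  have := congr1 (fun M : 'rV_ _ => M 0 l) cG; rewrite !mxE => e0; apply: etrans (mulr0 (g l)).
  congr (_ * _); apply: etrans e0; apply: eq_bigr => k1 _.
  by rewrite -scalerAl tfZ mxE.
have frG' : row_free (map_mx iota G) by rewrite row_free_map.
suff : (\row_k e k) *m map_mx iota G = 0.
  rewrite -(mul0mx _ (map_mx iota G)) => /(row_free_inj frG')/rowP/(_ k).
  by rewrite !mxE.
apply/rowP=> l; rewrite mxE [RHS]mxE; apply: (mulfI (x := iota nn)); first by rewrite fmorph_eq0.
rewrite mulr0 mulr_sumr.
transitivity (\sum_chi (w chi)%:R * \tr ((\sum_k e k *: rho chi (a k)) *m rho chi (ub l))).
  under [RHS]eq_bigr => chi _ do rewrite mulmx_suml raddf_sum mulr_sumr.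
  rewrite exchange_big; apply: eq_bigr => k1 _ /=.
  rewrite !mxE mulrCA -rmorphM -trace_formula mulr_sumr; apply: eq_bigr => chi _.
  by rewrite -scalemxAl mxtraceZ rhoM; ring.
by rewrite big1 // => chi _; rewrite He mul0mx mxtrace0 mulr0.
Qed.

Section Center.

Variables (i : I) (q : nat) (zb : 'I_q -> 'End(X i)).
Hypothesis hz : free_basis ( *:%R : K -> 'End(X i) -> 'End(X i)) setT (Z i) zb.

Local Notation Xi_i := [pred chi | blk chi == i].

Definition char_mx : 'M[E]_(q, #|Xi_i|) := \matrix_(k, x) cc (enum_val x) (zb k).

Let Zzb k : Z i (zb k). Proof. by case: hz. Qed.

Lemma zb_indep (c : 'I_q -> K) : \sum_k c k *: zb k = 0 -> forall k, c k = 0.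
Proof.
move=> Hc k; have Z0 : Z i 0 by exact: end_center0.
have [_ /(_ _ Z0)[g [_ gU]]] := hz.
have e1 : g = finfun c.
  by apply: gU; split=> //; rewrite -{1}Hc; apply: eq_bigr => l _; rewrite ffunE.
have e2 : g = [ffun=> 0].
  by apply: gU; split=> //; rewrite big1 // => l _; rewrite ffunE scale0r.
by have := congr1 (fun f : {ffun 'I_q -> K} => f k) e1; rewrite e2 !ffunE.
Qed.

Lemma char_mx_free : row_free char_mx.
Proof.
rewrite -kermx_eq0; apply/eqP/row_matrixP=> t; rewrite row0.
have : row t (kermx char_mx) *m char_mx = 0 by rewrite -row_mul mulmx_ker row0.
move: (row t _) => c cV; apply/rowP=> k; rewrite [RHS]mxE.
apply: (rho_indep (a := fun k => ct (zb k)) (e := fun k => c 0 k)).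
  move=> g; rewrite -central_elt_sum => Hg; apply: zb_indep; apply/lfunP=> x.
  rewrite zero_lfunE -(central_elt_act simX distX hu) ?Hg ?linear0 ?zero_lfunE //.
  apply: (big_ind (Z i)); first exact: end_center0.
    by move=> ? ?; apply: end_centerD.
  by move=> l _; apply: end_centerZ.
move=> chi; have [ec|nc] := eqVneq i (blk chi); last first.
  by rewrite big1 // => l _; rewrite rho_ct_other ?scaler0.
under eq_bigr => l _ do rewrite (rhoct chi) // scale_scalar_mx.
have cx : chi \in Xi_i by rewrite inE ec.
have := congr1 (fun M : 'rV_ _ => M 0 (enum_rank_in cx chi)) cV; rewrite !mxE => H0.
rewrite -raddf_sum -[RHS](raddf0 scalar_mx) /=; congr (_%:M); apply: etrans H0.
by apply: eq_bigr => l _; rewrite mxE enum_rankK_in.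
Qed.

Lemma center_card_le : (q <= #|Xi_i|)%N.
Proof. by have /eqP <- := char_mx_free; exact: rank_leq_col. Qed.

Lemma rank_center : r i = (q * d i ^ 2)%N.
Proof.
have [_ DB DM DZ _] := DIV i.
have D0 := division_set0 (rm_end_division (simX i)).
have DD := division_setD (rm_end_division (simX i)).
have [U HU] := subspace_vspace D0 DD DZ.
rewrite (free_basis_dim HU (hb i)) -[in q](card_ord q) -[in (d i ^ 2)%N](card_ord (d i ^ 2)%N) -card_prod.
apply/esym.
pose J : finType := ('I_q * 'I_(d i ^ 2)%N)%type.
apply: (free_basis_dim HU (b := fun x : 'I_#|J| => (zb (enum_val x).1 \o @y i (enum_val x).2)%VF)).
have sumE (g : 'I_#|J| -> K) : \sum_x g x *: (zb (enum_val x).1 \o @y i (enum_val x).2)%VF =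
    \sum_j ((\sum_k g (enum_rank (k, j)) *: zb k) \o @y i j)%VF.
  pose F (t : J) := g (enum_rank t) *: (zb t.1 \o @y i t.2)%VF.
  transitivity (\sum_t F t).
    by rewrite [RHS]big_enum_val; apply: eq_bigr => x _; rewrite /F enum_valK.
  rewrite (eq_bigr (fun t => F (t.1, t.2))) => [|[]//].
  rewrite -(pair_bigA _ (fun k j => F (k, j))) exchange_big; apply: eq_bigr => j _ /=.
  by rewrite comp_lfun_suml; apply: eq_bigr => k _; rewrite /F /= comp_lfunZl.
have Zs (c : 'I_q -> K) : Z i (\sum_k c k *: zb k).
  apply: (big_ind (Z i)); first exact: end_center0.
    by move=> ? ?; apply: end_centerD.
  by move=> l _; apply: end_centerZ.
split=> [x|f Df].
  by apply: DM; [case: (Zzb (enum_val x).1) | case: (hy i)].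
have [_ /(_ f Df)[c [[Zc ef] _]]] := hy i.
have Hc j : exists g : {ffun 'I_q -> K}, c j = \sum_k g k *: zb k.
  by have [_ /(_ _ (Zc j))[g [[_ eg] _]]] := hz; exists g.
have [g Hg] := choice Hc.
exists [ffun x => g (enum_val x).2 (enum_val x).1]; split.
  split=> //; rewrite ef sumE; apply: eq_bigr => j _; congr (_ \o _)%VF.
  by rewrite Hg; apply: eq_bigr => k _; rewrite ffunE enum_rankK.
move=> g' [_]; rewrite ef sumE => eg'; apply/ffunP=> x; rewrite ffunE.
have /(_ (enum_val x).2) := center_coord_inj (DIV i) (hy i) Zc (fun j => Zs _) eg'.
rewrite Hg => e2; apply/eqP; rewrite -subr_eq0; apply/eqP.
have := @zb_indep (fun k => g (enum_val x).2 k - g' (enum_rank (k, (enum_val x).2))).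
move=> /(_ _ (enum_val x).1); rewrite -surjective_pairing enum_valK; apply.
by under eq_bigr => k _ do rewrite scalerBl; rewrite sumrB e2 subrr.
Qed.

End Center.

Lemma center_basis i : exists q (zb : 'I_q -> 'End(X i)),
  free_basis ( *:%R : K -> 'End(X i) -> 'End(X i)) setT (Z i) zb.
Proof.
have [U HU] := subspace_vspace (end_center0 (DIV i)) (@end_centerD _ _ _ (DIV i)) (@end_centerZ _ _ _ (DIV i)).
by exists (\dim U), (fun j => (vbasis U)`_j); apply: vspace_free_basis.
Qed.

(** In each block the number of representations is at least the rank of the center
    ([center_card_le]). Weighted with (x_i d_i)^2 and summed over the blocks, both counts give the
    sum of the x_i^2 r_i, so equality holds in every block. *)
Lemma card_center i q (zb : 'I_q -> 'End(X i)) :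
  free_basis ( *:%R : K -> 'End(X i) -> 'End(X i)) setT (Z i) zb ->
  #|[pred chi | blk chi == i]| = q.
Proof.
have Hq j : exists q, exists zb : 'I_q -> 'End(X j),
    free_basis ( *:%R : K -> 'End(X j) -> 'End(X j)) setT (Z j) zb := center_basis j.
have [Q HQ] := choice Hq; move=> hz.
have rQ j : r j = (Q j * d j ^ 2)%N by have [zb' /rank_center] := HQ j.
have leQ j : (Q j <= #|[pred chi | blk chi == j]|)%N by have [zb' /center_card_le] := HQ j.
have n0 j : (0 < n j)%N by exact: leq_ltn_trans (ltn_ord (j0 j)).
have d0 j : (0 < d j)%N.
  have [_ /(_ _ (@D1 j))[c [[_ e1] _]]] := hy j; case: (posnP (d j)) => // dj0.
  have := X1 j; rewrite e1 big1 ?eqxx // => k; exfalso; by case: (k) => m; rewrite dj0 //.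
have eS : (\sum_j Q j * (n j * d j) ^ 2 = \sum_j #|[pred chi | blk chi == j]| * (n j * d j) ^ 2)%N.
  transitivity (\sum_chi md chi ^ 2)%N.
    by rewrite sum_md; apply: eq_bigr => j _; rewrite rQ expnMn; ring.
  rewrite (partition_big (fun chi => blk chi) predT) //=; apply: eq_bigr => j _.
  rewrite (eq_bigr (fun=> (n j * d j) ^ 2)%N) => [|chi /eqP <-]; last by rewrite block_degree.
  by rewrite sum_nat_const.
have leif j : (predT j : bool) -> (Q j * (n j * d j) ^ 2 <= #|[pred chi | blk chi == j]| * (n j * d j) ^ 2 ?= iff (Q j == #|[pred chi | blk chi == j]|))%N.
  move=> _; split; first by rewrite leq_mul2r leQ orbT.
  by rewrite eqn_pmul2r // expn_gt0 muln_gt0 n0 d0.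
have [_] := leqif_sum leif; rewrite eS eqxx => /esym/forallP/(_ i)/eqP <-.
apply/eqP; rewrite -(eqn_pmul2r (_ : 0 < d i ^ 2)%N) ?expn_gt0 ?d0 //.
by rewrite -rQ (rank_center hz).
Qed.

Lemma block_onto i : exists chi, blk chi = i.
Proof.
have [q [zb hz]] := center_basis i.
have q0 : (0 < q)%N.
  have [_ /(_ _ (end_center1 (DIV i)))[c [[_ e1] _]]] := hz; case: (posnP q) => // q0.
  have := X1 i; rewrite e1 big1 ?eqxx // => k; exfalso; by case: (k) => m; rewrite q0.
move: q0; rewrite -(card_center hz) => /card_gt0P[chi /eqP e]; by exists chi.
Qed.

(** The matrix of central characters of the block is square and invertible, and it diagonalises
    multiplication by z on the center. *)
Lemma center_trace i z t : Z i z -> is_trace (Z i) (fun f => (z \o f)%VF) t ->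
  iota t = \sum_(chi | blk chi == i) cc chi z.
Proof.
move=> Zz [q [zb [M [hz HM ->]]]].
have Zzb k : Z i (zb k) by case: hz.
rewrite -trace_map_mx.
have eV := card_center hz; have fV := char_mx_free hz.
have [W VW] := row_freeP fV.
have /row_fullP[W' WV'] : row_full (char_mx zb) by rewrite /row_full (eqP fV) eV.
have eW : W' = W by rewrite -[W']mulmx1 -VW mulmxA WV' mul1mx.
rewrite eW in WV'.
rewrite (mxtrace_diagonalized (D := diag_mx (\row_x cc (enum_val x) z)) VW WV').
  by rewrite mxtrace_diag [RHS]big_enum_val; apply: eq_bigr => x _; rewrite mxE.
apply/matrixP=> k x; rewrite mul_mx_diag !mxE -central_charM //.
have -> : (zb k \o z = z \o zb k)%VF by case: Zz => Dz Cz; rewrite Cz //; case: (Zzb k).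
rewrite HM central_char_sum; apply: eq_bigr => l _.
by rewrite !mxE.
Qed.

(** By [weight_mult], the common weight in the trace formula of all representations in block i, that
    is, the degree of the inducing representations of N. *)
Definition mult i := (n i * d i %/ h)%N.

Lemma weight_mult chi : w chi = mult (blk chi).
Proof. by rewrite /mult -block_degree mdE mulKn. Qed.

Lemma block_dvd i : (h %| n i * d i)%N.
Proof. by have [chi <-] := block_onto i; rewrite -block_degree mdE dvdn_mulr. Qed.

Lemma trace_form_sym a c : tf (a * c) = tf (c * a).
Proof.
apply: (mulfI nn_neq0); apply: (fmorph_inj iota); rewrite -!trace_formula.
by apply: eq_bigr => chi _; rewrite !rhoM mxtrace_mulC.
Qed.

Lemma trace_block i a : (forall chi, i != blk chi -> rho chi a = 0) ->
  iota (nn * tf a) = (mult i)%:R * \sum_(chi | blk chi == i) \tr (rho chi a).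
Proof.
move=> Ha; rewrite -trace_formula (bigID (fun chi => blk chi == i)) /= [X in _ + X]big1.
  by rewrite addr0 mulr_sumr; apply: eq_bigr => chi /eqP <-; rewrite weight_mult.
by move=> chi nc; rewrite Ha 1?eq_sym // mxtrace0 mulr0.
Qed.

(** If this weight vanished in K, the trace formula would make the form vanish on the right ideal
    generated by [e0 i \1%VF], against nondegeneracy. *)
Lemma mult_neq0 i : (mult i)%:R != 0 :> K.
Proof.
apply/negP => /eqP m0; have [chi echi] := block_onto i.
have : e0 i \1%VF = 0.
  apply: tf_nondeg => a; apply: (mulfI nn_neq0); apply: (fmorph_inj iota).
  rewrite (trace_block (i := i)) => [|chi' nc].
    by rewrite -(rmorph_nat iota) m0 rmorph0 mul0r mulr0 rmorph0.
  by rewrite rhoM (rho_theta_other rho_spans _ _ _ nc) mul0mx.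
move=> e00; have := block_neq0 simX distX injX hu rhoD rhoZ rhoM rho1 md_gt0 j0 chi.
by rewrite echi e00 (rho0 rhoZ) eqxx.
Qed.

Lemma center_sum i q (zb : 'I_q -> 'End(X i)) (c : 'I_q -> K) :
  (forall k, Z i (zb k)) -> Z i (\sum_k c k *: zb k).
Proof.
move=> Zzb; apply: (big_ind (Z i)); first exact: end_center0.
  by move=> ? ?; apply: end_centerD.
by move=> l _; apply: end_centerZ.
Qed.

(* The values tr(rho (e0 c)) on the block are the values of a central element *)
(* because both sides pair with the center through K-rational forms.          *)
Lemma reduced_trace_element i c : D i c -> exists2 z, Z i z &
  forall chi, blk chi = i -> cc chi z = \tr (rho chi (e0 i c)).
Proof.
move=> Dc; have [q [zb hz]] := center_basis i.
have Zzb k : Z i (zb k) by case: hz.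
set V := char_mx zb; have eV := card_center hz; have fV := char_mx_free hz.
have [W VW] := row_freeP fV.
have /row_fullP[W' WV'] : row_full V by rewrite /row_full (eqP fV) eV.
have eW : W' = W by rewrite -[W']mulmx1 -VW mulmxA WV' mul1mx.
rewrite eW in WV'.
pose tau : 'rV[E]_(#|[pred chi | blk chi == i]|) := \row_x \tr (rho (enum_val x) (e0 i c)).
have Ht k l : exists t, is_trace (Z i) (fun f => ((zb k \o zb l) \o f)%VF) t.
  have Zkl : Z i (zb k \o zb l)%VF by apply: end_centerM.
  have Hj j : exists g : {ffun 'I_q -> K}, ((zb k \o zb l) \o zb j)%VF = \sum_l g l *: zb l.
    have [_ /(_ ((zb k \o zb l) \o zb j)%VF)[|g [[_ eg] _]]] := hz; last by exists g.
    exact: end_centerM.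
  have [g Hg] := choice Hj.
  exists (\tr (\matrix_(j, l) g j l)), q, zb, (\matrix_(j, l) g j l); split=> // j.
  by rewrite Hg; apply: eq_bigr => l' _; rewrite mxE.
have /choice[f0 Hf0] k : exists g, forall l, is_trace (Z i) (fun f => ((zb k \o zb l) \o f)%VF) (g l).
  by have [g Hg] := choice (Ht k); exists g.
(* The Gram matrix of the trace form on the center; over E it factors as V V^T, so it is invertible
   and the coordinates xx of the central element are defined over K. *)
pose T : 'M[K]_q := \matrix_(k, l) f0 k l.
have TV : map_mx iota T = V *m V^T.
  apply/matrixP=> k l; rewrite !mxE (center_trace _ (Hf0 k l)); last exact: end_centerM.
  rewrite [LHS]big_enum_val; apply: eq_bigr => x _.
  by rewrite !mxE central_charM.
pose s : 'rV[K]_q := \row_l (nn * tf (e0 i (c \o zb l)%VF) / (mult i)%:R).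
have sV : map_mx iota s = tau *m V^T.
  apply/rowP=> l; rewrite !mxE rmorphM (trace_block (i := i)) => [|chi nc]; last first.
    exact: (rho_theta_other rho_spans _ _ _ nc).
  rewrite fmorphV rmorph_nat mulrAC mulfV; last by rewrite -(rmorph_nat iota) fmorph_eq0 mult_neq0.
  rewrite mul1r [LHS]big_enum_val; apply: eq_bigr => x _.
  rewrite !mxE -(theta_central simX distX injX hu) // rhoM (rhoct _) //.
  by rewrite mul_mx_scalar mxtraceZ mulrC.
have VTu : V^T *m W^T = 1%:M by rewrite -trmx_mul WV' trmx1.
have WTu : W^T *m V^T = 1%:M by rewrite -trmx_mul VW trmx1.
have Tu : T \in unitmx.
  rewrite -(map_unitmx iota) TV; apply/(@mulmx1_unit _ _ _ (W^T *m W) _).1.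
  by rewrite mulmxA -[V *m V^T *m W^T]mulmxA VTu mulmx1 VW.
pose xx := s *m invmx T.
exists (\sum_k xx 0 k *: zb k); first exact: center_sum.
move=> chi echi.
have : map_mx iota xx *m V = tau.
  rewrite -[LHS]mulmx1 -VTu mulmxA -[_ *m V *m _]mulmxA -TV -map_mxM /=.
  by rewrite mulmxKV // sV -mulmxA VTu mulmx1.
have cx : chi \in [pred chi | blk chi == i] by rewrite inE echi.
move/rowP/(_ (enum_rank_in cx chi)); rewrite !mxE enum_rankK_in // => <-.
rewrite central_char_sum; apply: eq_bigr => k _.
by rewrite !mxE enum_rankK_in.
Qed.

Lemma reduced_trace_corner i c z : D i c -> Z i z ->
  (forall chi, blk chi = i -> cc chi z = \tr (rho chi (e0 i c))) -> is_reduced_trace (D i) c z.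
Proof.
move=> Dc Zz Hz; split=> //; have [chi echi] := block_onto i.
have [m [C [R [CR RC sp]]]] := corner_splitting simX distX injX hu rhoD rhoZ rhoM rho1 md_gt0 rho_spans j0 chi.
subst i; exists E, m, (fun c => R *m rho chi (e0 (blk chi) c) *m C); split=> //.
rewrite (mxtrace_corner CR RC) // -Hz //.
by rewrite (corner_central rho_spans Zz) -CR -scalemxAr -scalemxAl !mulmxA RC mul1mx RC scalemx1.
Qed.

(** Over E the trace of the reduced trace is the sum of its central characters over the block, that
    is, of the traces of the [rho chi (e0 i c)], which the trace formula evaluates. Any other
    witness differs by a sign, by [reduced_trace_sign]. *)
Lemma total_trace_corner i c : D i c ->
  is_total_trace (D i) c (nn * tf (e0 i c) / (mult i)%:R) /\
  forall t, is_total_trace (D i) c t ->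
    t = nn * tf (e0 i c) / (mult i)%:R \/ t = - (nn * tf (e0 i c) / (mult i)%:R).
Proof.
move=> Dc; have [z Zz Hz] := reduced_trace_element Dc.
have rz := reduced_trace_corner Dc Zz Hz.
have val z' t : Z i z' -> is_trace (Z i) (fun f => (z' \o f)%VF) t -> forall e : E,
    \sum_(chi | blk chi == i) cc chi z' = e * iota (nn * tf (e0 i c) / (mult i)%:R) ->
    iota t = e * iota (nn * tf (e0 i c) / (mult i)%:R).
  by move=> Zz' ht e <-; exact: center_trace.
have sz : \sum_(chi | blk chi == i) cc chi z = 1 * iota (nn * tf (e0 i c) / (mult i)%:R).
  rewrite mul1r rmorphM (trace_block (i := i)) => [|chi nc]; last first.
    exact: (rho_theta_other rho_spans _ _ _ nc).
  rewrite fmorphV rmorph_nat mulrAC mulfV; last by rewrite -(rmorph_nat iota) fmorph_eq0 mult_neq0.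
  by rewrite mul1r; apply: eq_bigr => chi /eqP; apply: Hz.
split.
  exists z; split=> //; have [q [zb hz]] := center_basis i.
  have Hj j : exists g : {ffun 'I_q -> K}, (z \o zb j)%VF = \sum_l g l *: zb l.
    have [_ /(_ (z \o zb j)%VF)[|g [[_ eg] _]]] := hz; last by exists g.
    by apply: end_centerM => //; case: hz.
  have [g Hg] := choice Hj.
  have tr : is_trace (Z i) (fun f => (z \o f)%VF) (\tr (\matrix_(j, l) g j l)).
    exists q, zb, (\matrix_(j, l) g j l); split=> // j.
    by rewrite Hg; apply: eq_bigr => l' _; rewrite mxE.
  have := val _ _ Zz tr _ sz; rewrite mul1r => /(fmorph_inj iota) <-.
  exact: tr.
move=> t [z' [rz' tr]]; have Zz' : Z i z' by case: rz'.
have [e|e] := reduced_trace_sign (DIV i) (@X1 i) (hy i) Dc rz rz'; [left|right].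
  by move: tr; rewrite e => tr; have := val _ _ Zz tr _ sz; rewrite mul1r => /(fmorph_inj iota).
have := val _ _ Zz' tr (-1); rewrite mulN1r -rmorphN => H; apply: (fmorph_inj iota); apply: H.
rewrite e rmorphN -[in RHS](mul1r (iota _)) -sz -sumrN; apply: eq_bigr => chi _.
by rewrite -scaleN1r central_charZ rmorphN rmorph1 mulN1r.
Qed.

(** By symmetry of the form, an off-diagonal unit has the same value as a vanishing product, and a
    diagonal unit has the same value as its conjugate in the corner. *)
Lemma trace_form_coef a : tf a = \sum_i \sum_j tf (e0 i (coef hu a j j)).
Proof.
rewrite {1}(theta_expand simX distX injX hu a) tf_sum; apply: eq_bigr => i _.
rewrite tf_sum; apply: eq_bigr => j _.
rewrite tf_sum (bigD1 j) //= [X in _ + X]big1 ?addr0 => [|l nl]; last first.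
  have -> : th i j l (coef hu a j l) = th i j j \1%VF * th i j l (coef hu a j l).
    by rewrite (thetaM simX distX injX) ?comp_lfun1l //; exact: D1.
  rewrite trace_form_sym (thetaM0 simX distX injX) //; last exact: coef_end.
  by rewrite -(scale0r (0 : A)) tfZ mul0r.
have -> : th i j j (coef hu a j j) = th i j (j0 i) \1%VF * th i (j0 i) j (coef hu a j j).
  by rewrite (thetaM simX distX injX) ?comp_lfun1l //; exact: D1.
rewrite trace_form_sym (thetaM simX distX injX) ?comp_lfun1r //; exact: coef_end.
Qed.

End SplitTrace.

Lemma classicallyE (P : Type) : classically P -> inhabited P.
Proof.
move=> cP; have [//|nP] := pselect (inhabited P).
by have := cP false; case/(_ _)/notF => // p; case: nP.
Qed.

Lemma splitting_exists (L : fieldType) (gT : finGroupType) (G : {group gT}) :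
  exists (E : fieldType) (iota : {rmorphism L -> E}),
    group_splitting_field E G /\ inhabited (irrType E G).
Proof.
have [[E iota splitE]] := classicallyE (@group_splitting_field_exists _ G L).
have sg := classicallyE (@socle_exists _ _ _ _ (regular_repr E G)).
by exists E, iota.
Qed.

(** * The trace form on the blocks of the twisted group ring *)

Section TwistedSplit.

Variables (K : fieldType) (L : fieldExtType K) (gT : finGroupType).
Variable to : galAction L gT.
Local Notation N := (kernel to).
Local Notation A := (twisted to).
Hypothesis hn : #|N|%:R != 0 :> K.
Variables (I : finType) (X : I -> rmod A).
Hypothesis simX : forall i, rm_simple (X i).
Hypothesis distX : forall i j, rm_iso (X i) (X j) -> i = j.
Hypothesis allX : forall Y : rmod A, rm_simple Y -> exists i, rm_iso Y (X i).

Lemma twisted_inj a : (forall i x, rm_act (X i) a x = 0) -> a = 0.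
Proof.
have [E [iota [splitE [sG]]]] := splitting_exists L (kernel_group to).
exact: (wedderburn_inj hn iota splitE sG allX).
Qed.

Variables (n : I -> nat) (u : forall i, 'I_(n i) -> X i).
Hypothesis hu : forall i,
  free_basis (fun (f : 'End(X i)) w => f w) (rm_end (X i)) setT (@u i).
Variables (r : I -> nat) (b : forall i, 'I_(r i) -> 'End(X i)).
Hypothesis hb : forall i,
  free_basis ( *:%R : K -> 'End(X i) -> 'End(X i)) setT (rm_end (X i)) (@b i).
Variables (d : I -> nat) (y : forall i, 'I_(d i ^ 2)%N -> 'End(X i)).
Hypothesis hy : forall i,
  free_basis (@comp_lfun _ (X i) (X i) (X i)) (end_center (rm_end (X i))) (rm_end (X i)) (@y i).

Lemma sum_rank : (\sum_i n i ^ 2 * r i = #|gT| * \dim {:L})%N.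
Proof.
rewrite -(dim_twisted to) -card_unit_index.
apply: (free_basis_dim (M := setT) (b := unit_basis simX distX hu b)).
  by move=> a; split=> // _; exact: memvf.
exact: (unit_basis_free simX distX twisted_inj hu hb).
Qed.

Lemma twisted_split : [/\ forall i, (\dim {:L} %| n i * d i)%N,
  forall i, (n i * d i %/ \dim {:L})%:R != 0 :> K &
  exists tau : forall i, 'End(X i) -> K,
   (forall i c, rm_end (X i) c -> is_total_trace (rm_end (X i)) c (tau i c) /\
     forall t, is_total_trace (rm_end (X i)) c t -> t = tau i c \/ t = - tau i c) /\
   (forall i, (forall c c', tau i (c + c') = tau i c + tau i c') /\
      forall e c, tau i (e *: c) = e * tau i c) /\
   forall a, tform a = \sum_i (n i * d i %/ \dim {:L})%:R / #|N|%:R *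
     \sum_j tau i (coef hu a j j)].
Proof.
have [E [iota [splitE [sG]]]] := splitting_exists L (kernel_group to).
have n0 i : (0 < n i)%N.
  have [[x x0] _] := simX i; case: (posnP (n i)) => // ni.
  have [_ /(_ x Logic.I)[c [[_ ex] _]]] := hu i; case/eqP: x0; rewrite ex big1 // => k.
  by exfalso; case: (k) => m; rewrite ni.
pose j0 i := Ordinal (n0 i).
pose Rp := transversal_pred to.
pose md (chi : sG) := #|{: 'I_#|Rp| * 'I_(irr_degree chi)}|.
pose rho (chi : sG) a := ind_mx iota (irr_repr chi) a.
have rhoD chi a a' : rho chi (a + a') = rho chi a + rho chi a' by exact: ind_mxD.
have rhoZ chi c a : rho chi (c *: a) = iotaK iota c *: rho chi a by exact: ind_mxZ.
have rhoM chi a a' : rho chi (a * a') = rho chi a *m rho chi a' by exact: ind_mxM.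
have rho1 chi : rho chi 1 = 1%:M by exact: ind_mx1.
have mdE chi : md chi = (\dim {:L} * irr_degree chi)%N.
  by rewrite /md card_prod !card_ord (dim_transversal to).
have h0 : (0 < \dim {:L})%N by exact: adim_gt0.
have md0 chi : (0 < md chi)%N by rewrite mdE muln_gt0 h0 irr_degree_gt0.
have rhoS chi (M : 'M[E]_(md chi)) :
    exists l (e : 'I_l -> E) (a : 'I_l -> A), M = \sum_k e k *: rho chi (a k).
  (* The family that is M at chi and zero elsewhere; the size of the matrices depends on the index,
     hence the transport along the equality. *)
  pose F (j : sG) : 'M[E]_(md j) :=
    if eqP is ReflectT ej then eq_rect chi (fun j => 'M[E]_(md j)) M j ej else 0.
  have [e He] := rho_span hn iota splitE F.
  exists _, e, (tbasis (to := to)); rewrite -He /F.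
  by case: eqP => // ej; rewrite eq_axiomK.
have sumd : (\sum_chi md chi ^ 2 = \sum_i n i ^ 2 * r i)%N.
  by rewrite sum_rank -(dim_twisted to) -(sum_mdim_sq hn iota splitE sG).
have tfD := tformD (to := to).
have tfZ := tformZ (to := to).
have tfN := tform_nondeg (to := to).
have tr a : \sum_chi (irr_degree (chi : sG))%:R * \tr (rho chi a) = iotaK iota (#|N|%:R * tform a).
  exact: ind_trace_formula.
split.
- move=> i; exact: (block_dvd simX distX twisted_inj hu rhoD rhoZ rhoM rho1 md0 rhoS j0 hb hy sumd tfD tfZ tfN hn tr mdE i).
- move=> i; exact: (mult_neq0 simX distX twisted_inj hu rhoD rhoZ rhoM rho1 md0 rhoS j0 hb hy sumd tfD tfZ tfN hn tr h0 mdE i).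
- exists (fun i c => #|N|%:R * tform (theta simX distX hu (j0 i) (j0 i) c) / (n i * d i %/ \dim {:L})%:R).
  split; [move=> i c Dc|split=> [i|a]]; last 2 first.
    split=> [c c'|e c]; first by rewrite (thetaD simX distX twisted_inj) tformD mulrDr mulrDl.
    by rewrite (thetaZ simX distX twisted_inj) tformZ mulrCA -!mulrA.
  rewrite (trace_form_coef simX distX twisted_inj hu rhoM j0 tfD tfZ hn tr); apply: eq_bigr => i _.
  have m0 : (n i * d i %/ \dim {:L})%:R != 0 :> K by exact: (mult_neq0 simX distX twisted_inj hu rhoD rhoZ rhoM rho1 md0 rhoS j0 hb hy sumd tfD tfZ tfN hn tr h0 mdE i).
  rewrite mulr_sumr; apply: eq_bigr => j _.
  move: m0 hn; set m := (_ %/ _)%:R; set c := #|N|%:R; set t := tform _ => m0 c0.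
  by rewrite mulrC mulrA divfK // mulrAC mulfV ?mul1r.
  exact: (total_trace_corner simX distX twisted_inj hu rhoD rhoZ rhoM rho1 md0 rhoS j0 hb hy sumd tfD tfZ tfN hn tr h0 mdE Dc).
Qed.

End TwistedSplit.

(** * Colengths *)

(* Lengths add up over a direct sum; the coordinates p and the embeddings e   *)
(* need to be inverse to each other only on M.                                *)
Lemma colength_prod (K : fieldType) (S : set K) (pi : K) (v : K -> int) (hS : is_dvr S pi v)
    (W : lmodType K) (J : finType)
    (Wj : J -> lmodType K) (p : forall j, W -> Wj j) (e : forall j, Wj j -> W)
    (N M : forall j, set (Wj j)) (l : J -> nat) :
  (forall j x y, p j (x + y) = p j x + p j y) -> (forall j c x, p j (c *: x) = c *: p j x) ->
  (forall j x y, e j (x + y) = e j x + e j y) -> (forall j c x, e j (c *: x) = c *: e j x) ->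
  (forall j y, M j y -> p j (e j y) = y) ->
  (forall j j' y, M j y -> j' != j -> p j' (e j y) = 0) ->
  (forall j, is_colength S (N j) (M j) (l j)) ->
  is_colength S [set x | forall j, N j (p j x)] [set x | forall j, M j (p j x)] (\sum_j l j).
Proof.
move=> pD pZ eD eZ pe pe0 cl.
pose C (s : pred J) : set W := [set x | forall j, if s j then M j (p j x) else N j (p j x)].
have p0 j : p j 0 = 0 by rewrite -(scale0r (0 : W)) pZ scale0r.
have pB j x y : p j (x - y) = p j x - p j y by rewrite -scaleN1r pD pZ scaleN1r.
have subm (F : forall j, set (Wj j)) : (forall j, is_submod S (F j)) ->
    is_submod S [set x | forall j, F j (p j x)].
  move=> HF; split.
  - by move=> j; rewrite p0; case: (HF j).
  - by move=> x y Fx Fy j; rewrite pD; case: (HF j) => _ FD _; apply: FD.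
  - by move=> c x Sc Fx j; rewrite pZ; case: (HF j) => _ _ FZ; apply: FZ.
have hN j : is_submod S (N j) by case: (colength_submod (cl j)).
have hM j : is_submod S (M j) by case: (colength_submod (cl j)).
suff H (s : seq J) : uniq s -> is_colength S (C pred0) (C (mem s)) (\sum_(j <- s) l j).
  have := H (index_enum J) (index_enum_uniq J); congr is_colength.
  by apply/seteqP; split=> x Hx j; have := Hx j; rewrite inE mem_index_enum.
elim: s => [_|k s IHs /=/andP[ks us]].
  rewrite big_nil; have -> : C (mem [::]) = C pred0 by [].
  by apply: colength0; apply: (subm (fun j => if pred0 j then M j else N j)).
rewrite big_cons addnC; apply: colength_cat (IHs us) _.
have [D [D0 Dl hD stepD]] := cl k.
pose Q j := if j \in s then M j else N j.
have hQ j : is_submod S (Q j) by rewrite /Q; case: ifP.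
pose F t : set W := [set x | D t (p k x) /\ forall j, j != k -> Q j (p j x)].
have DM t : (t <= l k)%N -> D t `<=` M k.
  move=> tl; apply: (@colength_sub _ S _ _ _ (l k - t)).
  exists (fun j => D (t + j)%N); split; rewrite ?addn0 ?subnKC //.
    by move=> j jl; apply: hD; lia.
  by move=> j jl; rewrite addnS; apply: stepD; lia.
have hF t : (t <= l k)%N -> is_submod S (F t).
  move=> /hD[DO DD DZ]; split.
  - by split=> [|j _]; rewrite p0 //; case: (hQ j).
  - move=> x y [Dx Qx] [Dy Qy]; split=> [|j nj]; rewrite pD; first exact: DD.
    by case: (hQ j) => _ QD _; apply: QD; [exact: Qx|exact: Qy].
  - move=> c x Sc [Dx Qx]; split=> [|j nj]; rewrite pZ; first exact: DZ.
    by case: (hQ j) => _ _ QZ; apply: QZ => //; exact: Qx.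
have Fe t y : (t <= l k)%N -> D t y -> F t (e k y).
  move=> tl Dy; split=> [|j nj]; first by rewrite pe //; exact: DM Dy.
  by rewrite pe0 //; [case: (hQ j)|exact: DM Dy].
exists F; split=> //.
- apply/seteqP; split=> x.
    move=> [Dx Qx] j; have [->|nj] := eqVneq j k; first by rewrite /= (negbTE ks) -D0.
    by have := Qx _ nj; rewrite /Q /=; case: ifP.
  move=> Cx; split=> [|j nj]; first by have := Cx k; rewrite /= (negbTE ks) -D0.
  by have := Cx j; rewrite /Q /=; case: ifP.
- apply/seteqP; split=> x.
    move=> [Dx Qx] j; have [->|nj] := eqVneq j k; first by rewrite /= inE eqxx /= -Dl.
    by have := Qx _ nj; rewrite /Q /= inE (negbTE nj) /=; case: ifP.
  move=> Cx; split=> [|j nj]; first by have := Cx k; rewrite /= inE eqxx /= -Dl.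
  by have := Cx j; rewrite /Q /= inE (negbTE nj) /=; case: ifP.
- move=> t tl; have [[sD nsD] sim] := stepD t tl; split.
    split=> [x [Dx Qx]|sF]; first by split=> //; exact: sD.
    apply: nsD => y Dy; have [] := sF _ (Fe _ _ tl Dy).
    by rewrite pe //; exact: DM Dy.
  move=> P hP sFP sPF; have [P0 PD PZ] := hP.
  pose P' := [set y | D t.+1 y /\ P (e k y)].
  (* Membership in P is decided by the coordinate k alone, because x minus its component at k
     already lies in F t. *)
  have PE x : F t.+1 x -> P x <-> P' (p k x).
    move=> [Dx Qx]; have Mx := DM _ tl _ Dx.
    have Frest : F t (x - e k (p k x)).
      split=> [|j nj]; rewrite pB; first by rewrite pe // subrr; case: (hD _ (ltnW tl)).
      by rewrite pe0 // subr0; exact: Qx.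
    have rest := sFP _ Frest.
    split=> [Px|[_ Pe]].
      by split=> //; rewrite -[e k _](subKr x); exact: (submodB hS hP).
    by rewrite -(subrK (e k (p k x)) x); apply: PD.
  have hP' : is_submod S P'.
    have [DO DD DZ] := hD _ tl; split.
    - by split=> //; rewrite -(scale0r (0 : Wj k)) eZ scale0r.
    - by move=> x y [Dx Px] [Dy Py]; split; [exact: DD|rewrite eD; exact: PD].
    - by move=> c x Sc [Dx Px]; split; [exact: DZ|rewrite eZ; exact: PZ].
  have [||PD0|PD1] := sim P' hP'.
  - move=> y Dy; split; first exact: sD.
    exact: sFP (Fe _ _ (ltnW tl) Dy).
  - by move=> y [].
  - left; apply/seteqP; split=> // x Px; have Fx := sPF _ Px.
    by have /(PE _ Fx) := Px; rewrite PD0; case: Fx => _ Qx Dx; split.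
  - right; apply/seteqP; split=> // x Fx; apply/(PE _ Fx).
    by rewrite PD1; case: Fx.
Qed.

(** The valuation ring is turned into a ring type [dvr_sub], to which the theory of integral
    elements applies; the proof argument keeps hS recoverable from the predicate. *)
Definition dvr_pred (K : fieldType) (S : set K) (pi : K) (v : K -> int)
  (_ : is_dvr S pi v) : {pred K} := fun x => `[< S x >].

Fact dvr_pred_subring (K : fieldType) (S : set K) (pi : K) (v : K -> int) (hS : is_dvr S pi v) :
  subring_closed (dvr_pred hS).
Proof.
split=> [|x y|x y]; rewrite ?unfold_in; first exact/asboolP/(dvr1 hS).
  by move=> /asboolP Sx /asboolP Sy; apply/asboolP/(dvrDS hS) => //; apply: (dvrNS hS).
by move=> /asboolP Sx /asboolP Sy; apply/asboolP/(dvrMS hS).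
Qed.

HB.instance Definition _ (K : fieldType) (S : set K) (pi : K) (v : K -> int) (hS : is_dvr S pi v) :=
  GRing.isSubringClosed.Build K (@dvr_pred K S pi v hS) (dvr_pred_subring hS).

Record dvr_sub (K : fieldType) (S : set K) (pi : K) (v : K -> int) (hS : is_dvr S pi v) :=
  DvrSub { dvr_val : K; dvr_valP : dvr_val \in dvr_pred hS }.

HB.instance Definition _ (K : fieldType) (S : set K) (pi : K) (v : K -> int) (hS : is_dvr S pi v) := [isSub for @dvr_val K S pi v hS].
HB.instance Definition _ (K : fieldType) (S : set K) (pi : K) (v : K -> int) (hS : is_dvr S pi v) := [Choice of @dvr_sub K S pi v hS by <:].
HB.instance Definition _ (K : fieldType) (S : set K) (pi : K) (v : K -> int) (hS : is_dvr S pi v) :=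
  [SubChoice_isSubComNzRing of @dvr_sub K S pi v hS by <:].

Section IntegralClosure.

Variables (K : fieldType) (S : set K) (pi : K) (v : K -> int).
Hypothesis hS : is_dvr S pi v.
Variables (L : fieldExtType K).
Local Notation T := (integral_closure S L).

Let emb : {rmorphism dvr_sub hS -> L} := in_alg L \o val.

Lemma integral_closureP y : T y <-> integralOver emb y.
Proof.
split=> [[p [pm Sp py]]|[p pm py]].
  pose c i : dvr_sub hS := insubd 0 p`_i.
  have cE i : val (c i) = p`_i by rewrite insubdK //; apply/asboolP.
  pose q : {poly dvr_sub hS} := \poly_(i < size p) c i.
  have qp : map_poly val q = p.
    apply/polyP=> i; rewrite coef_map_id0 ?rmorph0 // coef_poly; case: ltnP => // le_pi.
    by rewrite rmorph0 nth_default.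
  exists q; last by rewrite map_poly_comp qp.
  have szq : size q = size p by rewrite -qp size_map_inj_poly ?rmorph0 //; exact: val_inj.
  apply/eqP/val_inj; rewrite /= -[RHS](eqP pm) /lead_coef szq coef_poly.
  rewrite ltn_predL size_poly_gt0 monic_neq0 // cE //.
by exists (map_poly val p); split=> [|i|]; [exact: monic_map | rewrite coef_map; apply/asboolP/(valP p`_i) |
  rewrite -map_poly_comp].
Qed.

Lemma integral_closureM y z : T y -> T z -> T (y * z).
Proof. by rewrite !integral_closureP; apply: integral_mul. Qed.

Lemma integral_closure_gact (gT : finGroupType) (to : galAction L gT) y s :
  T y -> T (to y s).
Proof.
move=> [p [pm Sp py]]; exists p; split=> //.
have toB := gactD to s; have to0 := gact0 to s.
have toM := (Defs.gactM to s).2; have to1 := (Defs.gactM to s).1.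
have toX z i : to (z ^+ i) s = to z s ^+ i.
  by elim: i => [|i IHi]; rewrite ?expr0 // !exprS toM IHi.
apply/rootP; have -> : (map_poly (in_alg L) p).[to y s] = to (map_poly (in_alg L) p).[y] s.
  rewrite !horner_coef [RHS](big_morph _ toB to0); apply: eq_bigr => i _.
  by rewrite toM toX coef_map /= gact_scale to1.
by rewrite (rootP py) to0.
Qed.

End IntegralClosure.

(** * Lattices in coordinates *)

Section LatticeCoordinates.

Variables (K : fieldType) (S : set K) (pi : K) (v : K -> int).
Hypothesis hS : is_dvr S pi v.

Lemma volM m (P Q : 'M[K]_m) : P \in unitmx -> Q \in unitmx ->
  vol v (P *m Q) = vol v P + vol v Q.
Proof.
by rewrite !unitmxE !unitfE => P0 Q0; rewrite /vol det_mulmx (dvrM hS).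
Qed.

Lemma vol1 m : vol v (1%:M : 'M[K]_m) = 0.
Proof. by rewrite /vol det1 (val1 hS). Qed.

Lemma vol_inv m (P : 'M[K]_m) : P \in unitmx -> vol v (invmx P) = - vol v P.
Proof.
move=> uP; have := volM uP (_ : invmx P \in unitmx); rewrite unitmx_inv mulmxV // vol1.
by move=> /(_ uP); lia.
Qed.

(** M contains a multiple of the standard lattice, and integrality of the form on M places M inside
    the dual of that multiple; between two lattices [lat_sandwich] applies. This is how finite
    generation follows from the form. *)
Lemma self_dual_lattice m (B : 'M[K]_m) (M : set 'rV_m) : B \in unitmx ->
  is_submod S M -> (forall x, exists e, M (pi ^+ e *: x)) ->
  (forall x y, M x -> M y -> S ((x *m B *m y^T) 0 0)) ->
  exists2 P, P \in unitmx & M = lat S P.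
Proof.
move=> uB hM spM dM; have [e He] := choice (fun j : 'I_m => spM (delta_mx 0 j)).
pose f := (\max_j e j)%N; have [_ MD MZ] := hM.
have uP : pi ^+ f *: (1%:M : 'M[K]_m) \in unitmx.
  by rewrite unitmxZ ?unitmx1 // unitfE; exact: (piX_neq0 hS).
have sPM : lat S (pi ^+ f *: (1%:M : 'M[K]_m)) `<=` M.
  move=> _ [u Su ->]; rewrite -scalemxAr mulmx1 (row_sum_delta u) scaler_sumr.
  apply: (submod_sum _ hM) => j _; rewrite scalerA mulrC -scalerA; apply: (MZ) => //.
  rewrite -(subnK (leq_bigmax j : (e j <= f)%N)) exprD -scalerA; apply: (MZ) => //.
  exact: (dvr_piXS hS).
have [R [uR _] eR] := lat_dual hS uP uB.
have sMR : M `<=` lat S R.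
  by rewrite -eR => x Mx y /sPM My; exact: dM.
have [Q [l [uQ eM _ _]]] := lat_sandwich hS uP uR hM sPM sMR.
by exists Q.
Qed.

Lemma lat_mul m (Q D : 'M[K]_m) x : D \in unitmx -> lat S Q (x *m D) <-> lat S (Q *m invmx D) x.
Proof.
move=> uD; split=> [[w Sw e]|[w Sw ->]]; exists w => //; last by rewrite mulmxA mulmxKV.
by rewrite mulmxA -e mulmxK.
Qed.

Lemma lattice_basis (W : lmodType K) (U : set W) m (b : 'I_m -> W) (M : set W) :
  (forall x y, U x -> U y -> U (x + y)) -> U 0 -> (forall c x, U x -> U (c *: x)) ->
  free_basis ( *:%R : K -> W -> W) setT U b ->
  fin_gen S M -> M `<=` U -> spans M U ->
  exists2 b' : 'I_m -> W, free_basis ( *:%R : K -> W -> W) setT U b' &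
    forall c : 'I_m -> K, M (\sum_j c j *: b' j) <-> forall j, S (c j).
Proof.
move=> UD U0 UZ hb fg sMU spM; have [P uP eM] := fin_gen_lat hS UD U0 UZ hb fg sMU spM.
pose b' j := rowc b (row j P).
have sumE (c : 'I_m -> K) : \sum_j c j *: b' j = rowc b ((\row_j c j) *m P).
  have -> : (\row_j c j) *m P = \sum_j c j *: row j P.
    by rewrite mulmx_sum_row; apply: eq_bigr => j _; rewrite mxE.
  by rewrite rowc_sum; apply: eq_bigr => j _; rewrite rowcZ.
exists b' => [|c].
  split=> [j|w Uw]; first exact: rowcU.
  have [x ex] := rowc_surj hb Uw.
  exists [ffun j => (x *m invmx P) 0 j]; split.
    split=> //; rewrite sumE ex; congr rowc; rewrite -[LHS](mulmxKV uP); congr (_ *m P).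
    by apply/rowP=> j; rewrite [RHS]mxE ffunE.
  move=> c [_]; rewrite sumE ex => /(rowc_inj UD U0 UZ hb) ->.
  by apply/ffunP=> j; rewrite ffunE mulmxK // mxE.
rewrite sumE eM; split=> [[x [w Sw ->]] /(rowc_inj UD U0 UZ hb)/(can_inj (mulmxK uP)) e j|Sc].
  by have /rowP/(_ j) := e; rewrite mxE => <-; exact: Sw.
by exists ((\row_j c j) *m P) => //; exists (\row_j c j) => // i j; rewrite mxE.
Qed.

Lemma fg_submod_fin_gen (A : algType K) (Lam : set A) (X : rmod A) (V : set X) :
  fin_gen S Lam -> fg_submod Lam V -> fin_gen S V.
Proof.
move=> [q [a eL]] [m [w ->]]; pose J : finType := ('I_m * 'I_q)%type.
exists #|J|, (fun x => rm_act X (a (enum_val x).2) (w (enum_val x).1)).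
have sumE (c : J -> K) : \sum_(x < #|J|) c (enum_val x) *:
    rm_act X (a (enum_val x).2) (w (enum_val x).1) = \sum_j rm_act X (\sum_l c (j, l) *: a l) (w j).
  rewrite -(big_enum_val (fun t : J => c t *: rm_act X (a t.2) (w t.1))) /=.
  rewrite (eq_bigr (fun t => c (t.1, t.2) *: rm_act X (a t.2) (w t.1))) => [|[]//].
  rewrite -(pair_bigA _ (fun j l => c (j, l) *: rm_act X (a l) (w j))) /=.
  apply: eq_bigr => j _; rewrite linear_sum /= sum_lfunE; apply: eq_bigr => l _.
  by rewrite linearZ /= scale_lfunE.
apply/seteqP; split=> x.
  move=> [c [Lc ->]]; have H j : exists g : 'I_q -> K, (forall l, S (g l)) /\ c j = \sum_l g l *: a l.
    by have := Lc j; rewrite eL.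
  have [g Hg] := choice H.
  exists (fun x => g (enum_val x).1 (enum_val x).2); split=> [y|]; first by case: (Hg (enum_val y).1).
  rewrite (sumE (fun t => g t.1 t.2)); apply: eq_bigr => j _.
  by case: (Hg j) => _ ->.
move=> [c [Sc ->]]; exists (fun j => \sum_l c (enum_rank (j, l)) *: a l); split.
  by move=> j; rewrite eL; exists (fun l => c (enum_rank (j, l))).
rewrite -(sumE (fun t => c (enum_rank t))); apply: eq_bigr => y _.
by rewrite enum_valK.
Qed.

Lemma colength_rowc (W : lmodType K) m (b : 'I_m -> W) (N M : set W) l :
  free_basis ( *:%R : K -> W -> W) setT setT b ->
  is_colength S N M l -> is_colength S (rowc b @^-1` N) (rowc b @^-1` M) l.
Proof.
move=> hb cl; have H w : exists x, w = rowc b x by apply: (rowc_surj hb).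
have [g Hg] := choice H.
have inj : injective (rowc b) by apply: (rowc_inj (U := setT)) hb.
have gE (F : set W) : rowc b @^-1` F = g @` F.
  apply/seteqP; split=> x; first by move=> Fx; exists (rowc b x) => //; apply: inj; rewrite -Hg.
  by move=> [w Fw <-]; rewrite /preimage /= -Hg.
rewrite !gE; apply: colength_image cl => [x y|c x|x y e]; last by rewrite (Hg x) e -Hg.
  by apply: inj; rewrite rowcD -!Hg.
by apply: inj; rewrite rowcZ -!Hg.
Qed.

End LatticeCoordinates.

(** * The lattice T wr G and its dual *)

Section TwistedLattice.

Variables (K : fieldType) (L : fieldExtType K) (gT : finGroupType).
Variable to : galAction L gT.
Hypothesis hn : #|kernel to|%:R != 0 :> K.
Variables (S : set K) (pi : K) (v : K -> int).
Hypothesis hS : is_dvr S pi v.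
Variable T : set L.
Hypothesis TM : forall y z, T y -> T z -> T (y * z).
Hypothesis TG : forall y s, T y -> T (to y s).
Hypothesis hT : is_submod S T.

Lemma twisted_over_submod : is_submod S (twisted_over to T).
Proof.
have [T0 TD TZ] := hT; split.
- by move=> s; rewrite ffunE.
- by move=> a b Ta Tb s; rewrite ffunE; apply: TD.
- by move=> c a Sc Ta s; rewrite ffunE; apply: TZ.
Qed.

Lemma twisted_overM a b :
  twisted_over to T a -> twisted_over to T b -> twisted_over to T (a * b).
Proof.
move=> Ta Tb s; rewrite ffunE; apply: (submod_sum _ hT) => t _.
by apply: TM; [apply: TG; exact: Ta|exact: Tb].
Qed.

Lemma twisted_over_clear a : spans T setT -> exists e, twisted_over to T (pi ^+ e *: a).
Proof.
move=> spT; have H s : exists e, forall e', (e <= e')%N -> T (pi ^+ e' *: a s).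
  exact: (spans_clear hS hT spT).
have [e He] := choice H; exists (\max_s e s)%N => s; rewrite ffunE.
by apply: He; exact: (leq_bigmax s).
Qed.

Lemma field_dualE y : field_dual S T y <-> forall t, T t -> S (gtrace (y * t)).
Proof.
split=> H t Tt; first by have [c [Sc /(is_trace_gtrace to) <-]] := H t Tt.
by exists (gtrace (y * t)); split; [exact: H | apply/(is_trace_gtrace to)].
Qed.

Lemma field_dual_gact y s : field_dual S T (to y s) <-> field_dual S T y.
Proof.
have H z r : field_dual S T z -> field_dual S T (to z r).
  rewrite !field_dualE => Hz t Tt.
  have -> : to z r * t = to (z * to t r^-1%g) r.
    by rewrite (Defs.gactM to r).2 -gact_mulg mulVg gact_id.
  by rewrite (gtrace_gact hn); apply: Hz; exact: TG.
split; last exact: H.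
by move=> /(H _ s^-1%g); rewrite -gact_mulg mulgV gact_id.
Qed.

(** Pairing with single terms [tw to s t] tests one coefficient at a time, and both T and the trace
    are stable under G. *)
Lemma twisted_dual a : (forall b, twisted_over to T b -> S (tform (a * b))) <->
  twisted_over to (field_dual S T) a.
Proof.
split=> [Ha s|Ha b Tb].
  apply/(field_dual_gact (a s) s^-1%g)/field_dualE => t Tt.
  have := Ha (tw to s^-1%g t); rewrite tform_mul_tw invgK; apply.
  by move=> r; rewrite ffunE; case: ifP => // _; case: hT.
rewrite tform_mul; apply: (dvr_sum hS) => s _.
have /field_dualE : field_dual S T (to (a s^-1%g) s) by apply/field_dual_gact/Ha.
by apply; exact: Tb.
Qed.

Lemma twisted_colength l : is_colength S T (field_dual S T) l ->
  is_colength S (twisted_over to T) (twisted_over to (field_dual S T)) (#|gT| * l).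
Proof.
move=> cl; have := colength_prod (W := twisted to) (J := gT) (Wj := fun=> L) (N := fun=> T)
  (M := fun=> field_dual S T) (l := fun=> l) hS (p := fun s a => a s) (e := fun s y => tw to s y).
rewrite sum_nat_const; apply=> //.
- by move=> s x y; rewrite ffunE.
- by move=> s c x; rewrite ffunE.
- by move=> s x y; apply/ffunP=> r; rewrite !ffunE; case: ifP; rewrite ?addr0.
- by move=> s c x; apply/ffunP=> r; rewrite !ffunE; case: ifP; rewrite ?scaler0.
- by move=> s y _; rewrite ffunE eqxx.
- by move=> s t y _ /negbTE nst; rewrite ffunE nst.
Qed.

End TwistedLattice.

(** * The product of the End V_i as matrices over the S_i *)

Section MatrixLattice.

Variables (K : fieldType) (A : algType K) (I : finType) (X : I -> rmod A).
Hypothesis simX : forall i, rm_simple (X i).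
Hypothesis distX : forall i j, rm_iso (X i) (X j) -> i = j.
Hypothesis injX : forall a, (forall i x, rm_act (X i) a x = 0) -> a = 0.
Variables (n : I -> nat) (u : forall i, 'I_(n i) -> X i).
Hypothesis hu : forall i,
  free_basis (fun (f : 'End(X i)) w => f w) (rm_end (X i)) setT (@u i).
Local Notation D i := (rm_end (X i)).
Local Notation th i j l c := (@theta K A I X simX distX n u hu i j l c).
Variables (S : set K) (pi : K) (v : K -> int).
Hypothesis hS : is_dvr S pi v.
Variable O_ : forall i, set 'End(X i).
Local Notation O i := (@O_ i).
Hypothesis OD : forall i, O i `<=` D i.
Hypothesis hO : forall i, is_submod S (O i).
Hypothesis O1 : forall i, O i \1%VF.
Hypothesis OM : forall i f g, O i f -> O i g -> O i (f \o g)%VF.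

Definition coef_set (F : forall i, set 'End(X i)) : set A :=
  [set a | forall i j l, F i (coef hu a (i := i) j l)].

Lemma coef_colength (F : forall i, set 'End(X i)) (e : I -> nat) :
  (forall i, F i `<=` D i) -> (forall i, is_colength S (O i) (F i) (e i)) ->
  is_colength S (coef_set O_) (coef_set F) (\sum_i n i ^ 2 * e i).
Proof.
move=> FD cl; pose J : finType := {i : I & ('I_(n i) * 'I_(n i))%type}.
have := colength_prod (W := A) (J := J) (Wj := fun x => 'End(X (tag x)))
  (N := fun x => O (tag x)) (M := fun x => F (tag x)) (l := fun x => e (tag x)) hS
  (p := fun x a => coef hu a (tagged x).1 (tagged x).2)
  (e := fun x c => th (tag x) (tagged x).1 (tagged x).2 c).
have -> : (\sum_(x : J) e (tag x) = \sum_i n i ^ 2 * e i)%N.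
  pose G i (_ : 'I_(n i) * 'I_(n i)) := e i.
  transitivity (\sum_(x : J) G (tag x) (tagged x))%N; first by [].
  transitivity (\sum_i \sum_jl G i jl)%N; first by rewrite sig_big_dep.
  by apply: eq_bigr => i _; rewrite sum_nat_const card_prod card_ord mulnn.
have eS (F' : forall i, set 'End(X i)) : [set x | forall j : J, F' (tag j) (coef hu x (tagged j).1 (tagged j).2)] = coef_set F'.
  apply/seteqP; split=> a Ha; first by move=> i j l; exact: (Ha (Tagged (fun i => ('I_(n i) * 'I_(n i))%type) (j, l))).
  by move=> [i [j l]]; exact: Ha.
rewrite !eS; apply.
- by move=> x a b; rewrite (coefD simX).
- by move=> x c a; rewrite (coefZ simX).
- by move=> x c c'; rewrite (thetaD simX distX injX).
- by move=> x c c'; rewrite (thetaZ simX distX injX).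
- by move=> [i [j l]] c Fc; rewrite (coef_theta simX distX) ?eqxx //; exact: FD Fc.
- move=> [i [j l]] [i' [j' l']] c Fc nx /=.
  have [ei|ni] := eqVneq i i'; last by rewrite coef_theta_other.
  subst i'; rewrite (coef_theta simX distX); last exact: FD Fc.
  by case: andP => // -[/eqP ej /eqP el]; move: nx; rewrite ej el eqxx.
- by move=> x; exact: cl.
Qed.

Variable V_ : forall i, set (X i).
Local Notation V i := (@V_ i).
Hypothesis hV : forall i x, V i x <->
  exists2 c : 'I_(n i) -> 'End(X i), forall j, O i (c j) & x = \sum_j c j (u j).

Lemma coef_setP a : coef_set O_ a <-> forall i x, V i x -> V i (rm_act (X i) a x).
Proof.
split=> [Oa i x /hV[c Oc ->]|Ha i j l].
  apply/hV; exists (fun l => \sum_j (c j \o coef hu a j l)%VF) => [l|].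
    by apply: (submod_sum _ (hO i)) => j _; apply: OM; [exact: Oc|exact: Oa].
  rewrite linear_sum; under [RHS]eq_bigr => l _ do rewrite sum_lfunE.
  rewrite exchange_big; apply: eq_bigr => j _ /=.
  rewrite -(OD (Oc j)) coef_sum linear_sum; apply: eq_bigr => l _.
  by rewrite comp_lfunE.
have Vj : V i (u j).
  apply/hV; exists (fun l => if l == j then \1%VF else 0) => [l0|].
    by case: ifP => // _; case: (hO i).
  rewrite (bigD1 j) //= eqxx id_lfunE big1 ?addr0 // => k /negbTE ->.
  by rewrite zero_lfunE.
have [c Oc ec] := (hV _).1 (Ha _ _ Vj).
by rewrite (coefP hu (c := c)) // => k; exact: OD.
Qed.

Hypothesis surjX : forall f : forall i, 'End(X i),
  (forall i d x, rm_end (X i) d -> f i (d x) = d (f i x)) ->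
  exists a, forall i x, rm_act (X i) a x = f i x.
Hypothesis O_spans : forall i, spans (O i) (D i).
Hypothesis V_spans : forall i, spans (V i) setT.

(** An endomorphism commuting with S_i on V_i commutes with K_i on X_i, since S_i spans K_i and V_i
    spans X_i. So it comes from an element of A, which stabilises the V_i exactly when its entries
    lie in the S_i. *)
Lemma wedderburn_coef_set :
  wedderburn X @` coef_set O_ = setprod (fun i => bilattice_end (O i) (V i)).
Proof.
apply/seteqP; split=> f.
  move=> [a Oa <-] i; rewrite ffunE; split=> [x|d x Od Vx].
    exact: (coef_setP a).1 Oa i x.
  by rewrite (OD Od).
move=> Hf; have [a Ha] : exists a, forall i x, rm_act (X i) a x = f i x.
  apply: surjX => i d x Dd; have [_ Cf] := Hf i.
  have Cx w z : O i w -> f i (w z) = w (f i z).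
    move=> Ow; have [q [e [y [Vy ->]]]] := V_spans (Logic.I : [set: X i] z).
    rewrite [w _]linear_sum [f i _]linear_sum [f i (\sum_j _)]linear_sum [RHS]linear_sum.
    by apply: eq_bigr => k _; rewrite /= !linearZ /= Cf.
  have [m [c [w [Ow ->]]]] := O_spans Dd.
  rewrite !sum_lfunE linear_sum; apply: eq_bigr => j _ /=.
  by rewrite !scale_lfunE linearZ /= Cx.
exists a; last by apply/ffunP=> i; rewrite ffunE; apply/lfunP=> x.
by apply/coef_setP => i x Vx; rewrite Ha; case: (Hf i) => Sf _; exact: Sf.
Qed.

Variables (tau : forall i, 'End(X i) -> K) (kap : I -> K) (tf : A -> K).
Hypothesis tauT : forall i c, D i c -> is_total_trace (D i) c (tau c) /\
  forall t, is_total_trace (D i) c t -> t = tau c \/ t = - tau c.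
Hypothesis tauD : forall i (c c' : 'End(X i)), tau (c + c') = tau c + tau c'.
Hypothesis tauZ : forall i e (c : 'End(X i)), tau (e *: c) = e * tau c.
Hypothesis tfE : forall a, tf a = \sum_i kap i * \sum_j tau (coef hu a (i := i) j j).

(** The total trace is determined up to sign only, which does not affect membership in S. *)
Lemma order_dualE i c : order_dual S (D i) (O i) c <->
  D i c /\ forall s, O i s -> S (tau (c \o s)%VF).
Proof.
have [_ _ DM _ _] := rm_end_division (simX i).
split=> -[Dc H]; split=> // s Os; have [tot sg] := tauT (DM _ _ Dc (OD Os)).
  have [t [St tt]] := H s Os; have [e|e] := sg t tt; first by rewrite -e.
  by rewrite -[tau _]opprK -e; exact: (dvrNS hS).
by exists (tau (c \o s)%VF); split=> //; exact: H.
Qed.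

(** On block i the form is [kap i] times the trace of a matrix product, so pairing with matrix units
    over O i tests one entry at a time. *)
Lemma coef_set_dual a : (forall b, coef_set O_ b -> S (tf (a * b))) <->
  forall i j l, order_dual S (D i) (O i) (kap i *: coef hu a (i := i) j l).
Proof.
have tau0 i : tau (0 : 'End(X i)) = 0 by rewrite -(scale0r 0) tauZ mul0r.
have DZ i c (f : 'End(X i)) : D i f -> D i (c *: f) by have [_ _ _ DZ _] := rm_end_division (simX i); exact: DZ.
have tfM b : tf (a * b) = \sum_i \sum_j \sum_l tau ((kap i *: coef hu a (i := i) j l) \o coef hu b l j)%VF.
  rewrite tfE; apply: eq_bigr => i _; rewrite mulr_sumr; apply: eq_bigr => j _.
  rewrite (coefM simX) (big_morph _ (@tauD i) (tau0 i)) mulr_sumr; apply: eq_bigr => l _.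
  by rewrite -comp_lfunZl tauZ.
split=> [Ha i j l|Ha b Ob].
  apply/order_dualE; split=> [|s Os]; first by apply: DZ; exact: coef_end.
  have Ob : coef_set O_ (th i l j s).
    move=> i' j' l'; have [ei|ni] := eqVneq i i'; last first.
      by rewrite coef_theta_other //; case: (hO i').
    subst i'; rewrite (coef_theta simX distX); last exact: OD.
    by case: ifP => // _; case: (hO i).
  have := Ha _ Ob; rewrite tfM (bigD1 i) //= [X in _ + X]big1 ?addr0 => [|i' ni]; last first.
    rewrite big1 // => j' _; rewrite big1 // => l' _.
    by rewrite coef_theta_other 1?eq_sym // comp_lfun0r tau0.
  rewrite (bigD1 j) //= [X in _ + X]big1 ?addr0 => [|j' nj]; last first.
    rewrite big1 // => l' _; rewrite (coef_theta simX distX); last exact: OD.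
    by rewrite (negbTE nj) andbF comp_lfun0r tau0.
  rewrite (bigD1 l) //= [X in _ + X]big1 ?addr0 => [|l' nl]; last first.
    rewrite (coef_theta simX distX); last exact: OD.
    by rewrite (negbTE nl) comp_lfun0r tau0.
  by rewrite (coef_theta simX distX) ?eqxx //; exact: OD.
rewrite tfM; apply: (dvr_sum hS) => i _; apply: (dvr_sum hS) => j _; apply: (dvr_sum hS) => l _.
have [_ H] := (order_dualE _).1 (Ha i j l); apply: H; exact: Ob.
Qed.

End MatrixLattice.

(** * Volumes of the two lattices with respect to the trace form *)

Section TwistedVolume.

Variables (K : fieldType) (L : fieldExtType K) (gT : finGroupType).
Variable to : galAction L gT.
Local Notation A := (twisted to).
Hypothesis hn : #|kernel to|%:R != 0 :> K.
Variables (S : set K) (pi : K) (v : K -> int).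
Hypothesis hS : is_dvr S pi v.
Variables (m : nat) (b : 'I_m -> A).
Hypothesis hb : free_basis ( *:%R : K -> A -> A) setT setT b.

Lemma gram_form (x y : 'rV_m) :
  (x *m gram_mx b *m y^T) 0 0 = tform (rowc b x * rowc b y).
Proof.
rewrite mxE /rowc mulr_sumr tform_sum; apply: eq_bigr => l _.
rewrite !mxE -scalerAr tformZ mulrC mulr_suml tform_sum; congr (_ * _).
by apply: eq_bigr => k _; rewrite mxE -scalerAl tformZ.
Qed.

Variable T : set L.
Hypothesis TG : forall y s, T y -> T (to y s).
Hypothesis Tspan : spans T setT.
Variable delta : nat.
Hypothesis hdelta : is_colength S T (field_dual S T) delta.

Let hT : is_submod S T. Proof. by case: (colength_submod hdelta). Qed.

Lemma twisted_over_lattice : exists2 P : 'M_m, P \in unitmx &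
  rowc b @^-1` twisted_over to T = lat S P.
Proof.
apply: (self_dual_lattice hS (gram_unit hb)) => [|x|x y Tx Ty].
- exact/rowc_submod/twisted_over_submod.
- have [e He] := twisted_over_clear hS hT (rowc b x) Tspan.
  by exists e; rewrite /preimage /= rowcZ.
- rewrite gram_form; apply: (twisted_dual hn hS TG hT _).2 Ty => s.
  exact: (colength_sub hdelta) (Tx s).
Qed.

(** The dual has volume - vol P - vol B and contains the lattice with colength g delta; equating
    both expressions for the drop in volume gives the relation. *)
Lemma twisted_over_vol P : P \in unitmx -> rowc b @^-1` twisted_over to T = lat S P ->
  vol v P *+ 2 + vol v (gram_mx b) = (#|gT| * delta)%:Z.
Proof.
move=> uP eP; have uB := gram_unit hb.
have cl := colength_rowc hb (twisted_colength to hS hdelta).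
have [Q [uQ vQ] eQ] := lat_dual hS uP uB.
have eQ' : rowc b @^-1` twisted_over to (field_dual S T) = lat S Q.
  rewrite -eQ -eP; apply/seteqP; split=> x.
    by move=> /(twisted_dual hn hS TG hT) Hx y Hy; rewrite gram_form; exact: Hx.
  move=> Hx; apply/(twisted_dual hn hS TG hT) => c Tc.
  have [y ey] := rowc_surj hb (Logic.I : [set: A] c).
  by rewrite ey -gram_form; apply: Hx; rewrite /preimage /= -ey.
rewrite eP eQ' in cl; have := colength_val hS uP uQ cl; lia.
Qed.

End TwistedVolume.

Lemma intmx_lat (K : fieldType) (S : set K) m (x : 'rV[K]_m) : lat S 1%:M x <-> intmx S x.
Proof. by rewrite latP ?unitmx1 // invmx1 mulmx1. Qed.

Section OrderVolume.

Variables (K : fieldType) (L : fieldExtType K) (gT : finGroupType).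
Variable to : galAction L gT.
Local Notation A := (twisted to).
Variables (I : finType) (X : I -> rmod A).
Hypothesis simX : forall i, rm_simple (X i).
Hypothesis distX : forall i j, rm_iso (X i) (X j) -> i = j.
Hypothesis injX : forall a, (forall i x, rm_act (X i) a x = 0) -> a = 0.
Variables (n : I -> nat) (u : forall i, 'I_(n i) -> X i).
Hypothesis hu : forall i,
  free_basis (fun (f : 'End(X i)) w => f w) (rm_end (X i)) setT (@u i).
Local Notation D i := (rm_end (X i)).
Variables (S : set K) (pi : K) (v : K -> int).
Hypothesis hS : is_dvr S pi v.
Variable O_ : forall i, set 'End(X i).
Local Notation O i := (@O_ i).
Hypothesis OD : forall i, O i `<=` D i.
Hypothesis hO : forall i, is_submod S (O i).
Variables (r : I -> nat) (b : forall i, 'I_(r i) -> 'End(X i)).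
Hypothesis hb : forall i,
  free_basis ( *:%R : K -> 'End(X i) -> 'End(X i)) setT (D i) (@b i).
Hypothesis Ob : forall i (c : 'I_(r i) -> K), O i (\sum_j c j *: b j) <-> forall j, S (c j).
Variables (tau : forall i, 'End(X i) -> K) (kap : I -> K).
Hypothesis kap_neq0 : forall i, kap i != 0.
Hypothesis tauT : forall i c, D i c -> is_total_trace (D i) c (tau c) /\
  forall t, is_total_trace (D i) c t -> t = tau c \/ t = - tau c.
Hypothesis tauD : forall i (c c' : 'End(X i)), tau (c + c') = tau c + tau c'.
Hypothesis tauZ : forall i e (c : 'End(X i)), tau (e *: c) = e * tau c.
Hypothesis tfE : forall a, tform a = \sum_i kap i * \sum_j tau (coef hu a (i := i) j j).
Variable e : I -> nat.
Hypothesis hdelta : forall i, is_colength S (O i) (order_dual S (D i) (O i)) (e i).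

Local Notation ub := (unit_basis simX distX hu b).
Local Notation M := #|{: unit_index n r}|.

Let ubP := unit_basis_free simX distX injX hu hb.

Let coef_rowc (x : 'rV_M) i j l : coef hu (rowc ub x) (i := i) j l =
  \sum_m x 0 (enum_rank (Tagged (fun i => ('I_(n i) * 'I_(n i) * 'I_(r i))%type) (j, l, m))) *: b m.
Proof.
have -> : rowc ub x = \sum_y [ffun y => x 0 y] y *: ub y.
  by apply: eq_bigr => y _; rewrite ffunE.
by rewrite (coef_unit simX distX injX hu hb); apply: eq_bigr => m _; rewrite ffunE.
Qed.

Lemma coef_set_lattice : rowc ub @^-1` coef_set hu O_ = lat S 1%:M.
Proof.
apply/seteqP; split=> x Hx.
  apply/intmx_lat => i0 y; rewrite ord1 -[y]enum_valK; case: (enum_val y) => i [[j l] m].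
  by have := Hx i j l; rewrite coef_rowc => /Ob/(_ m).
by move=> i j l; rewrite coef_rowc; apply/Ob => m; move/intmx_lat: Hx; apply.
Qed.

Lemma coef_set_vol :
  vol v (gram_mx ub) = (\sum_i n i ^ 2 * e i)%:Z + \sum_i (n i ^ 2 * r i)%:Z * v (kap i).
Proof.
have uB := gram_unit ubP; have u1 := unitmx1 K M.
have dD i : order_dual S (D i) (O i) `<=` D i by move=> f [].
have cl := colength_rowc ubP (coef_colength simX distX injX hu hS dD hdelta).
have [Q [uQ vQ] eQ] := lat_dual hS u1 uB; rewrite (vol1 hS) in vQ.
(* By [coef_set_dual] the entries of dual elements lie in the order duals only after scaling by
   [kap i]; right multiplication by kd absorbs these factors. *)
pose kd : 'M[K]_M := diag_mx (\row_y (kap (tag (enum_val y)))^-1).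
have kd_det : \det kd = \prod_(y < M) (kap (tag (enum_val y)))^-1.
  by rewrite det_diag; apply: eq_bigr => y _; rewrite mxE.
have ukd : kd \in unitmx.
  by rewrite unitmxE unitfE kd_det; apply/prodf_neq0 => y _; rewrite invr_eq0.
have vkd : vol v kd = - \sum_i (n i ^ 2 * r i)%:Z * v (kap i).
  rewrite /vol kd_det (val_prod hS) => [|y _]; last by rewrite invr_eq0.
  rewrite -sumrN -(big_enum_val (fun t : unit_index n r => v (kap (tag t))^-1)) /=.
  pose G i (_ : 'I_(n i) * 'I_(n i) * 'I_(r i)) := v (kap i)^-1.
  transitivity (\sum_(t : unit_index n r) G (tag t) (tagged t)); first by [].
  transitivity (\sum_i \sum_t G i t); first by rewrite sig_big_dep.
  apply: eq_bigr => i _; rewrite sumr_const !card_prod !card_ord mulnn (valV hS) //.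
  by rewrite mulNrn -mulr_natl natz.
have eQ' : rowc ub @^-1` coef_set hu (fun i => order_dual S (D i) (O i)) = lat S (Q *m invmx kd).
  apply/seteqP; split=> x.
    move=> Hx; apply/lat_mul => //; rewrite -eQ -coef_set_lattice.
    suff H c : coef_set hu O_ c -> S (tform (rowc ub (x *m kd) * c)).
      by move=> y Oy; rewrite gram_form; exact: H.
    move: c.
    apply/(coef_set_dual simX distX hS OD hO tauT tauD tauZ tfE) => i j l.
    have -> : kap i *: coef hu (rowc ub (x *m kd)) j l = coef hu (rowc ub x) j l.
      rewrite !coef_rowc scaler_sumr; apply: eq_bigr => m _.
      by rewrite mul_mx_diag !mxE enum_rankK /= scalerA mulrCA mulfV // mulr1.
    exact: Hx.
  move=> /lat_mul-/(_ ukd); rewrite -eQ -coef_set_lattice => Hx i j l.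
  have -> : coef hu (rowc ub x) j l = kap i *: coef hu (rowc ub (x *m kd)) j l.
    rewrite !coef_rowc scaler_sumr; apply: eq_bigr => m _.
    by rewrite mul_mx_diag !mxE enum_rankK /= scalerA mulrCA mulfV // mulr1.
  move: i j l; apply/(coef_set_dual simX distX hS OD hO tauT tauD tauZ tfE) => c Oc.
  have [y ey] := rowc_surj ubP (Logic.I : [set: A] c).
  by rewrite ey -gram_form; apply: Hx; rewrite /preimage /= -ey.
rewrite coef_set_lattice eQ' in cl.
have ui : invmx kd \in unitmx by rewrite unitmx_inv.
have := colength_val hS u1 (_ : Q *m invmx kd \in unitmx) cl.
rewrite unitmx_mul uQ ui (volM hS) // (vol_inv hS) // (vol1 hS) vQ vkd => /(_ isT); lia.
Qed.

End OrderVolume.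

Theorem theorem2p15
  (* K, L, G, with n = #|kernel to| invertible in K *)
  (K : fieldType) (L : fieldExtType K) (gT : finGroupType)
  (to : galAction L gT)
  (hn : #|kernel to|%:R != 0 :> K)
  (* representatives X_1, ..., X_k of the simple modules, indexed from 0 *)
  (k : nat) (X : 'I_k.+1 -> rmod (twisted to))
  (hXsimple : forall i, rm_simple (X i))
  (hXdistinct : forall i j, rm_iso (X i) (X j) -> i = j)
  (hXall : forall Y : rmod (twisted to), rm_simple Y -> exists i, rm_iso Y (X i))
  (* X_1 = L *)
  (phi : 'Hom(L, X ord0))
  (hphi : bijective phi)
  (hphi_act : forall y s z,
    phi (to y s * z) = rm_act (X ord0) (tw to s z) (phi y))
  (* x_i, r_i, d_i, with K_i = rm_end (X i) *)
  (x r d : 'I_k.+1 -> nat)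
  (hx : forall i, has_dim (fun (f : 'End(X i)) u => f u) (rm_end (X i)) setT (x i))
  (hr : forall i, has_dim ( *:%R : K -> 'End(X i) -> 'End(X i)) setT
                    (rm_end (X i)) (r i))
  (hd : forall i, has_dim (@comp_lfun _ (X i) (X i) (X i))
                    (end_center (rm_end (X i))) (rm_end (X i)) (d i ^ 2)%N)
  (hd1 : forall i, (1 <= d i)%N)
  (* S, pi, v and T *)
  (S : set K) (pi : K) (v : K -> int)
  (hS : is_dvr S pi v)
  (T : set L)
  (hT : T = integral_closure S L)
  (* the lattices V_i, with S_i = lattice_end (twisted_over to T) (V i) *)
  (V : forall i, set (X i))
  (hVfg : forall i, fg_submod (twisted_over to T) (V i))
  (hVspan : forall i, spans (V i) setT)
  (SV : forall i, set 'End(X i))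
  (hSV : forall i, SV i = lattice_end (twisted_over to T) (V i))
  (hSVmax : forall i, is_max_order S (rm_end (X i)) (SV i))
  (hV1 : V ord0 = phi @` T)
  (* delta_{T/S} and delta_{S_i/S} *)
  (deltaT : nat) (deltaS : 'I_k.+1 -> nat)
  (hdeltaT : is_colength S T (field_dual S T) deltaT)
  (hdeltaS : forall i,
    is_colength S (SV i) (order_dual S (rm_end (X i)) (SV i)) (deltaS i)) :
  exists l : nat,
    is_colength S (wedderburn X @` twisted_over to T)
                  (setprod (fun i => bilattice_end (SV i) (V i))) l /\
    l%:R = 2^-1 *
      (#|gT|%:R * (deltaT%:R + (v #|kernel to|%:R)%:~R * (\dim {:L})%:R)
       - \sum_(i < k.+1) (x i)%:R ^+ 2 *
           ((deltaS i)%:R + (v (x i * d i %/ \dim {:L})%:R)%:~R * (r i)%:R)) :> rat.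
Proof.
subst T; set T := integral_closure S L.
have [hTs hTd] := colength_submod hdeltaT.
have TM y z : T y -> T z -> T (y * z) by exact: (integral_closureM hS).
have TG y s : T y -> T (to y s) by exact: integral_closure_gact.
(* V_1 is a copy of T and spans X_1, a copy of L. *)
have Tspan : spans T setT.
  move=> y _; have [m [c [w [Vw ey]]]] := hVspan ord0 (phi y) Logic.I.
  have H j : exists t, T t /\ phi t = w j.
    by have := Vw j; rewrite hV1 => -[t Tt <-]; exists t.
  have [t Ht] := choice H; exists m, c, t; split=> [j|]; first by case: (Ht j).
  apply: (bij_inj hphi); rewrite ey linear_sum; apply: eq_bigr => j _ /=.
  by rewrite linearZ /=; case: (Ht j) => _ ->.
pose Lam := twisted_over to T.
have hLam : is_submod S Lam by exact: twisted_over_submod.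
(* Obtained from integrality of the trace form on T wr G, not from finiteness of T over S. *)
have fgLam : fin_gen S Lam.
  have hb := tbasis_free to.
  have [P uP eP] := twisted_over_lattice hn hS hb TG Tspan hdeltaT.
  rewrite [Lam](rowc_preimage hb (fun _ _ => Logic.I)) eP; exact: lat_fin_gen.
have ord i : is_order S (rm_end (X i)) (SV i) by case: (hSVmax i).
have OD i : SV i `<=` rm_end (X i) by case: (ord i).
have O1 i : SV i \1%VF by case: (ord i).
have OM i f g : SV i f -> SV i g -> SV i (f \o g)%VF by case: (ord i) => _ _ H _ _; exact: H.
have fgO i : fin_gen S (SV i) by case: (ord i).
have spO i : spans (SV i) (rm_end (X i)) by case: (ord i).
have hO i : is_submod S (SV i) by exact: (fin_gen_submod hS).
have fgV i : fin_gen S (V i) by exact: (fg_submod_fin_gen fgLam).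
have hV i : is_submod S (V i) by exact: (fin_gen_submod hS).
have VLam i a y : Lam a -> V i y -> V i (rm_act (X i) a y).
  have [m [w eV]] := hVfg i; rewrite eV => La [c [Lc ->]].
  exists (fun j => c j * a); split=> [j|]; first exact: (twisted_overM TM TG hTs (Lc j) La).
  by rewrite linear_sum; apply: eq_bigr => j _; rewrite rm_act_mul.
have OV i f y : SV i f -> V i y -> V i (f y) by rewrite hSV => -[H _]; exact: H.
have DIV i := rm_end_division (hXsimple i).
have X0 i : (0 < \dim {:X i})%N.
  have [[y y0] _] := hXsimple i; rewrite lt0n dimv_eq0; apply: contra y0 => /eqP e.
  by rewrite -memv0 -e memvf.
have Hu i : exists w : 'I_(x i) -> X i,
    free_basis (fun (f : 'End(X i)) y => f y) (rm_end (X i)) setT w /\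
    forall y, V i y <-> exists2 c : 'I_(x i) -> 'End(X i), forall j, SV i (c j) & y = \sum_j c j (w j).
  have [w0 hw0] := hx i.
  have Xd : (0 < dim (X i))%N by rewrite -dimvf.
  exact: (free_lattice hS (DIV i) (hr i) (hSVmax i) Xd hw0 (hV i) (@OV i) (fgV i) (hVspan i)).
pose u i := projT1 (cid (Hu i)).
have hu i : free_basis (fun (f : 'End(X i)) y => f y) (rm_end (X i)) setT (u i).
  by rewrite /u; case: cid => w /= [].
have hVu i y : V i y <-> exists2 c : 'I_(x i) -> 'End(X i), forall j, SV i (c j) & y = \sum_j c j (u i j).
  by rewrite /u; case: cid => w /= [].
have Hb i : exists2 b : 'I_(r i) -> 'End(X i),
    free_basis ( *:%R : K -> 'End(X i) -> 'End(X i)) setT (rm_end (X i)) b &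
    forall c : 'I_(r i) -> K, SV i (\sum_j c j *: b j) <-> forall j, S (c j).
  have [b0 hb0] := hr i; have [_ _ _ DZ _] := DIV i.
  have D0 := division_set0 (DIV i); have DD := division_setD (DIV i).
  exact: (lattice_basis hS DD D0 DZ hb0 (fgO i) (OD i) (spO i)).
pose b i := s2val (cid2 (Hb i)).
have hb i : free_basis ( *:%R : K -> 'End(X i) -> 'End(X i)) setT (rm_end (X i)) (b i).
  by rewrite /b; case: cid2.
have Ob i (c : 'I_(r i) -> K) : SV i (\sum_j c j *: b i j) <-> forall j, S (c j).
  by move: c; rewrite /b; case: cid2.
pose y i := projT1 (cid (hd i)).
have hy i : free_basis (@comp_lfun _ (X i) (X i) (X i)) (end_center (rm_end (X i)))
    (rm_end (X i)) (y i) by rewrite /y; case: cid.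
have injX := twisted_inj hn hXall.
have sumr := sum_rank hn hXsimple hXdistinct hXall hu hb.
have [dvd m0 [tau [tauT [tauDZ tfE]]]] :=
  twisted_split hn hXsimple hXdistinct hXall hu hb hy.
have tauD i (c c' : 'End(X i)) : tau i (c + c') = tau i c + tau i c' by case: (tauDZ i).
have tauZ i e (c : 'End(X i)) : tau i (e *: c) = e * tau i c by case: (tauDZ i).
pose mu i : K := (x i * d i %/ \dim {:L})%:R.
pose kap i := mu i / #|kernel to|%:R.
have kap0 i : kap i != 0 by rewrite mulf_neq0 ?invr_eq0 ?m0.
have ubP := unit_basis_free hXsimple hXdistinct injX hu hb.
set ub := unit_basis _ _ _ _ in ubP.
have [P uP eP] := twisted_over_lattice hn hS ubP TG Tspan hdeltaT.
have vP := twisted_over_vol hn hS ubP TG hdeltaT uP eP.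
have eG := coef_set_lattice hXsimple hXdistinct injX hu hb Ob.
have vG := coef_set_vol hXsimple hXdistinct injX hS OD hO hb Ob kap0 tauT tauD tauZ tfE hdeltaS.
have sLG : Lam `<=` coef_set hu SV.
  by move=> a La; apply/(coef_setP hu OD hO O1 OM hVu) => i z; exact: VLam.
have sLG' : lat S P `<=` lat S 1%:M.
  by rewrite -eP -eG => z; exact: sLG.
(* The larger lattice is standard in the basis [ub], of volume 0, so l is the volume of P. *)
have [l cl vl] := lat_colength hS uP (unitmx1 _ _) sLG'.
exists l; split.
  have cl1 : is_colength S Lam (coef_set hu SV) l.
    rewrite [Lam](rowc_preimage ubP (fun _ _ => Logic.I)) eP.
    rewrite [coef_set hu SV](rowc_preimage ubP (fun _ _ => Logic.I)) eG.
    apply: colength_image cl; [exact: rowcD|exact: rowcZ|].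
    by apply: (rowc_inj (U := setT)) ubP.
  rewrite -(wedderburn_coef_set hu OD hO O1 OM hVu (wedderburn_surj hXsimple hXdistinct hu) spO hVspan).
  apply: colength_image cl1 => [a c|e a|a c E].
  - by apply/ffunP=> i; rewrite !ffunE linearD.
  - by apply/ffunP=> i; rewrite !ffunE linearZ.
  - apply/eqP; rewrite -subr_eq0; apply/eqP/injX => i z.
    have := congr1 (fun f : endprod X => f i z) E; rewrite !ffunE linearB /= => e.
    by rewrite add_lfunE opp_lfunE e subrr.
rewrite (vol1 hS) in vl.
have vkap i : v (kap i) = v (mu i) - v #|kernel to|%:R.
  by rewrite (dvrM hS) ?invr_eq0 ?m0 // (valV hS).
have sumr' : \sum_i (x i ^ 2 * r i)%:Z = (#|gT| * \dim {:L})%:Z.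
  by rewrite -sumr -!natz natr_sum; apply: eq_bigr => i _; rewrite natz.
(* The volume of the Gram matrix is eliminated between [vP] and [vG]; the terms v(n) are collected
   by the identity that the x_i^2 r_i add up to g h. *)
have main : l%:Z *+ 2 = #|gT|%:Z * (deltaT%:Z + v #|kernel to|%:R * (\dim {:L})%:Z)
   - \sum_(i < k.+1) (x i)%:Z ^+ 2 * ((deltaS i)%:Z + v (mu i) * (r i)%:Z).
  have e1 : \sum_i (x i ^ 2 * r i)%:Z * v (kap i) =
     \sum_i (x i)%:Z ^+ 2 * (v (mu i) * (r i)%:Z) - v #|kernel to|%:R * (#|gT| * \dim {:L})%:Z.
    rewrite -sumr' mulr_sumr -sumrB; apply: eq_bigr => i _.
    by rewrite vkap !PoszM; ring.
  have e2 : \sum_i (x i)%:Z ^+ 2 * ((deltaS i)%:Z + v (mu i) * (r i)%:Z) =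
     (\sum_i x i ^ 2 * deltaS i)%:Z + \sum_i (x i)%:Z ^+ 2 * (v (mu i) * (r i)%:Z).
    rewrite -natz natr_sum -big_split; apply: eq_bigr => i _ /=.
    by rewrite natz !PoszM; ring.
  rewrite e2; move: vP vG vl; rewrite e1 !PoszM => vP vG vl.
  move: vP; rewrite vG vl add0r; lia.
apply: (mulfI (_ : 2 != 0 :> rat)) => //; rewrite mulrA mulfV // mul1r.
have := congr1 (fun z : int => z%:~R : rat) main.
rewrite /= !(rmorphB, rmorphMn, rmorphM, rmorphD) /= rmorph_sum /= => e.
rewrite [LHS]mulr_natl; apply: etrans e _; congr (_ - _); apply: eq_bigr => i _.
by rewrite rmorphM rmorphXn rmorphD rmorphM.
Qed.
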